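(* Let $K$ be a number field and $E/K$ an elliptic curve given by a Weierstrass equation with coefficients in $\mathcal{O}_K$, having complex multiplication by an order $\mathbb{Z}[\omega]$ of an imaginary quadratic field $F\subseteq K$. Let $\mathfrak{p}$ be a prime of $\mathcal{O}_K$ with normalised valuation $\nu$, let $P\in E(K)$ be a non-torsion point and let $z=z_1+z_2\omega\in\mathbb{Z}[\omega]$ with $z_1,z_2\in\mathbb{Z}$. Then: (1) If $P$ is non-singular modulo $\nu$, then \[ g_{z,\nu}(P)=-2\,d_{\mathfrak{p}}\big(F_{(z_1,z_2)}(P,[\omega]P)\big)=(z_1z_2-z_1^2)\max(0,-\nu(x(P)))+(z_1z_2-z_2^2)\max(0,-\nu(x([\omega]P)))-(z_1z_2)\max(0,-\nu(x([1+\omega]P))). \] (2) If $P$ is singular modulo $\nu$ (in which case $\nu(x(P))\ge 0$), let $r\in\mathrm{Ann}(P)$ and $\alpha=a+b\omega\in\mathbb{Z}[\omega]$ with $a,b\in\mathbb{Z}$. Then \[ g_{z,\nu}(P)=(a^2-ab)\mu+(b^2-ab)\mu_\omega+(ab)\mu_{1+\omega}\quad\text{if } z=\alpha r\in\mathrm{Ann}(P), \] and, if $z=\alpha r\pm\beta\notin\mathrm{Ann}(P)$ with $\beta\in\mathbb{Z}[\omega]$, \[ g_{z,\nu}(P)=2\nu(\psi_\beta)\pm 2a\Big[\nu\Big(\frac{\psi_\beta}{\psi_{r-\beta}}\Big)+\frac{\mu}{2}\Big]\pm 2b\Big[\nu\Big(\frac{\psi_\beta}{\psi_{r\omega-\beta}}\Big)+\frac{\mu_\omega}{2}\Big]+(a^2-ab)\mu+(b^2-ab)\mu_\omega+(ab)\mu_{1+\omega},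 \] where $\mu=\mu(r)=g_{r,\nu}(P)$, $\mu_\omega=\mu_\omega(r)=g_{r\omega,\nu}(P)$, $\mu_{1+\omega}=\mu_{1+\omega}(r)=g_{r(1+\omega),\nu}(P)$, and $\psi_\gamma$ means $\psi_\gamma(P)$. Moreover, if $\mathbb{Z}[\omega]$ is a principal ideal domain and $r$ generates $\mathrm{Ann}(P)$, then one of the two cases in (2) always holds.
   Context: The Weierstrass equation is $y^2+a_1xy+a_3y=x^3+a_2x^2+a_4x+a_6$, $a_i\in\mathcal{O}_K$. ''Complex multiplication by $\mathbb{Z}[\omega]$'' means $\mathrm{End}(E)=\mathbb{Z}[\omega]$ with all endomorphisms defined over $K$, so $[z]P\in E(K)$. $\nu$ is the normalised discrete valuation of $K$ at $\mathfrak{p}$ ($\nu(\pi)=1$ for a uniformiser $\pi$); for a fractional ideal $\mathfrak{a}$, $d_{\mathfrak{p}}(\mathfrak{a})$ is the exponent of $\mathfrak{p}$ in its prime factorisation. $E_0(K)$ is the set of points of $E(K)$ with non-singular reduction modulo $\mathfrak{p}$; it is a $\mathbb{Z}[\omega]$-submodule of $E(K)$, and $\mathrm{Ann}(P)$ is the annihilator in $\mathbb{Z}[\omega]$ of the class of $P$ in the $\mathbb{Z}[\omega]$-module $E(K)/E_0(K)$. $P$ is singular modulo $\nu$ if $P\notin E_0(K)$, non-singular otherwise. Net polynomials: for an $r$-tuple $\mathbf{P}=(P_1,\dots,P_r)$, $P_i=(x_i,y_i)\in E(K)\setminus\{O\}$ with $x_i\neq x_j$ for $i\ne j$, the values $\Psi_{\mathbf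 v}(\mathbf P)$ ($\mathbf v\in\mathbb{Z}^r$) are given by the unique map $W=\Psi:\mathbb{Z}^r\to K$ with $W(\mathbf 0)=0$ satisfying, for all $\mathbf p,\mathbf q,\mathbf r,\mathbf s$, $W(\mathbf p+\mathbf q+\mathbf s)W(\mathbf p-\mathbf q)W(\mathbf r+\mathbf s)W(\mathbf r)+W(\mathbf q+\mathbf r+\mathbf s)W(\mathbf q-\mathbf r)W(\mathbf p+\mathbf s)W(\mathbf p)+W(\mathbf r+\mathbf p+\mathbf s)W(\mathbf r-\mathbf p)W(\mathbf q+\mathbf s)W(\mathbf q)=0$ (an elliptic net), with initial values $\Psi_{\mathbf e_i}=1$, $\Psi_{2\mathbf e_i}=2y_i+a_1x_i+a_3$, $\Psi_{\mathbf e_i+\mathbf e_j}=1$, $\Psi_{2\mathbf e_i+\mathbf e_j}=2x_i+x_j-\lambda_{ij}^2-a_1\lambda_{ij}+a_2$ where $\lambda_{ij}=(y_j-y_i)/(x_j-x_i)$ ($i\neq j$); and $\Phi_{\mathbf v}(\mathbf P)=\Psi_{\mathbf v}(\mathbf P)^2x_1-\Psi_{\mathbf v+\mathbf e_1}(\mathbf P)\Psi_{\mathbf v-\mathbf e_1}(\mathbf P)$, so that $x(v_1P_1+\dots+v_rP_r)=\Phi_{\mathbf v}/\Psi_{\mathbf v}^2$. For $z=z_1+z_2\omega$: $\psi_z(P)=\Psi_{(z_1,z_2)}(P,[\omega]P)$, $\phi_z(P)=\Phi_{(z_1,z_2)}(P,[\omega]P)$. $g_{z,\nu}(P)=\min(2\nu(\psi_z(P)),\nu(\phi_z(P)))$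 if $[z]P\ne O$, and $g_{z,\nu}(P)=0$ if $[z]P=O$. Denominator ideals: for $Q\in E(K)\setminus\{O\}$ write $x(Q)\mathcal{O}_K=A_QD_Q^{-2}$ with $A_Q,D_Q$ coprime integral ideals. With $A_{11}=D_P$, $A_{22}=D_{[\omega]P}$, $A_{12}=D_{P+[\omega]P}D_P^{-1}D_{[\omega]P}^{-1}$, set $F_{(v_1,v_2)}(P,[\omega]P)=A_{11}^{v_1^2}A_{22}^{v_2^2}A_{12}^{v_1v_2}$. *)

(* Defs.v *)
(* mpoly has to be loaded before classical_sets: in the other order their
   notations clash. *)
From HB Require Import structures.
From mathcomp Require Import all_boot all_order all_algebra all_field.
From mathcomp Require Import mpoly.
From mathcomp Require Import boolp classical_sets constructive_ereal.

Set Implicit Arguments.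
Unset Strict Implicit.
Unset Printing Implicit Defensive.

Import Order.TTheory GRing.Theory Num.Theory.
Local Open Scope classical_set_scope.
Local Open Scope ring_scope.

(** * Ideals and valuations of a number field *)

Section NumberField.
Variable K : fieldExtType rat.
Implicit Types (I J p R : set K) (x y : K).

Definition ringOfIntegers : set K := [set x | integralOver (intr : int -> K) x].

Local Notation OK := ringOfIntegers.

(* [R] is meant to be a subring of [K]. *)
Definition is_ideal R I : Prop :=
  [/\ I `<=` R, I 0, (forall x y, I x -> I y -> I (x + y)) &
      forall x y, R x -> I y -> I (x * y)].

Definition principal_ideal R x : set K := [set y * x | y in R].

Definition is_prime p : Prop :=
  [/\ is_ideal OK p, p != [set 0], ~ p 1 &
      forall x y, OK x -> OK y -> p (x * y) -> p x \/ p y].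

Definition ideal_add I J : set K :=
  [set x | exists u v, [/\ I u, J v & x = u + v]].

Definition ideal_mul I J : set K :=
  [set x | exists n (u v : 'I_n -> K),
     [/\ forall i, I (u i), forall i, J (v i) & x = \sum_i u i * v i]].

Definition ideal_inv I : set K := [set x | forall y, I y -> OK (x * y)].

Definition ideal_exp I (n : int) : set K :=
  match n with
  | Posz m => iter m (ideal_mul I) OK
  | Negz m => iter m.+1 (ideal_mul (ideal_inv I)) OK
  end.

(* [e] is the exponent of [p] in a factorisation of [I] into powers of pairwise
   distinct primes.  The exponent zero is allowed, so that [p] may always be
   listed among the factors. *)
Definition is_exponent p I (e : int) : Prop :=
  exists n (q : 'I_n -> set K) (f : 'I_n -> int),
    [/\ injective q, forall i, is_prime (q i),
        I = \big[ideal_mul/OK]_i ideal_exp (q i) (f i) &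
        exists2 i, q i = p & f i = e].

Definition dp p I : int := xget 0 [set e | is_exponent p I e].

Definition nu p x : \bar int :=
  if x == 0 then +oo%E else (dp p (principal_ideal OK x))%:E.

(* The factorisation x O_K = A / D^2 is written without inverses; A = 0 and
   D = O_K when x = 0. *)
Definition is_denominator x (D : set K) : Prop :=
  exists A, [/\ is_ideal OK A, is_ideal OK D, D != [set 0],
               ideal_add A D = OK &
               ideal_mul (principal_ideal OK x) (ideal_exp D 2) = A].

Definition denominator x : set K := xget OK [set D | is_denominator x D].

End NumberField.

Arguments ringOfIntegers {K}.

(** * Weierstrass curves *)

Record weierstrass (L : Type) :=
  Weierstrass { a1 : L; a2 : L; a3 : L; a4 : L; a6 : L }.

Definition map_curve (k L : Type) (f : k -> L) (E : weierstrass k) :=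
  Weierstrass (f (a1 E)) (f (a2 E)) (f (a3 E)) (f (a4 E)) (f (a6 E)).

(* [None] is the point at infinity O. *)
Definition wpoint (L : Type) : Type := option (L * L).

HB.instance Definition _ (L : choiceType) := Choice.on (wpoint L).

Definition map_point (k L : Type) (f : k -> L) : wpoint k -> wpoint L :=
  omap (fun xy => (f xy.1, f xy.2)).

Section Curve.
Variable L : fieldType.
Implicit Types (E : weierstrass L) (P Q : wpoint L).

Definition on_curve E P : bool :=
  if P is Some (x, y) then
    y ^+ 2 + a1 E * x * y + a3 E * y ==
    x ^+ 3 + a2 E * x ^+ 2 + a4 E * x + a6 E
  else true.

Definition discriminant E : L :=
  let b2 := a1 E ^+ 2 + 4 * a2 E in
  let b4 := 2 * a4 E + a1 E * a3 E in
  let b6 := a3 E ^+ 2 + 4 * a6 E in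
  let b8 := a1 E ^+ 2 * a6 E + 4 * a2 E * a6 E - a1 E * a3 E * a4 E
            + a2 E * a3 E ^+ 2 - a4 E ^+ 2 in
  - b2 ^+ 2 * b8 - 8 * b4 ^+ 3 - 27 * b6 ^+ 2 + 9 * b2 * b4 * b6.

Definition elliptic E : Prop := discriminant E != 0.

(* The affine coordinates; the values at O are irrelevant. *)
Definition affine P : L * L := odflt (0, 0) P.
Definition xcoord P : L := (affine P).1.

Definition padd E P Q : wpoint L :=
  match P, Q with
  | None, _ => Q
  | _, None => P
  | Some (x1, y1), Some (x2, y2) =>
      let third lambda :=
        let x3 := lambda ^+ 2 + a1 E * lambda - a2 E - x1 - x2 in
        Some (x3, - (lambda + a1 E) * x3 - (y1 - lambda * x1) - a3 E) in
      if x1 != x2 then third ((y2 - y1) / (x2 - x1))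
      else if y1 + y2 + a1 E * x2 + a3 E == 0 then None
      else third ((3 * x1 ^+ 2 + 2 * a2 E * x1 + a4 E - a1 E * y1)
                  / (2 * y1 + a1 E * x1 + a3 E))
  end.

Definition nontorsion E P : Prop :=
  forall n : nat, (0 < n)%N -> iter n (padd E P) None != None.

Definition proj (P : wpoint L) : 'I_3 -> L :=
  if P is Some (x, y) then tnth [tuple x; y; 1] else tnth [tuple 0; 1; 0].

Definition same_proj (u v : 'I_3 -> L) : Prop :=
  exists2 c : L, c != 0 & forall i, v i = c * u i.

Definition weierstrass_form E : {mpoly L[3]} :=
  let X : {mpoly L[3]} := 'X_0 in
  let Y : {mpoly L[3]} := 'X_1 in
  let Z : {mpoly L[3]} := 'X_(2 : 'I_3) in
  Y ^+ 2 * Z + a1 E *: (X * Y * Z) + a3 E *: (Y * Z ^+ 2)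
  - (X ^+ 3 + a2 E *: (X ^+ 2 * Z) + a4 E *: (X * Z ^+ 2) + a6 E *: Z ^+ 3).

End Curve.

(** * Endomorphisms and complex multiplication *)

Section Endomorphisms.
Variables (k L : fieldType) (f : {rmorphism k -> L}) (E : weierstrass k).
Local Notation EL := (map_curve f E).

(* A morphism of projective curves defined over [k], given by its action on the
   points over [L] (meant to be algebraically closed): around each point it is
   given by three forms of the same degree with coefficients in [k]. *)
Definition is_morphism (h : wpoint L -> wpoint L) : Prop :=
  (forall P, on_curve EL P -> on_curve EL (h P)) /\
  forall P, on_curve EL P ->
    exists d (F : 'I_3 -> {mpoly k[3]}),
      [/\ forall i, F i \is d.-homog,
          exists i, mmap f (proj P) (F i) != 0 &
          forall Q, on_curve EL Q ->
            (exists i, mmap f (proj Q) (F i) != 0) ->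
            same_proj (proj (h Q)) (fun i => mmap f (proj Q) (F i))].

Definition is_endomorphism (h : wpoint L -> wpoint L) : Prop :=
  is_morphism h /\ h None = None.

End Endomorphisms.

Section ComplexMultiplication.
Variables (K : fieldExtType rat) (iota : {rmorphism K -> algC}).
Variables (E : weierstrass K) (omega : K).
Local Notation Ebar := (map_curve iota E).

Definition Zomega : set K :=
  [set z | exists z1 z2 : int, z = z1%:~R + z2%:~R * omega].

(* omega is a root of a monic integral quadratic polynomial with negative
   discriminant, i.e. Z[omega] is an order of the imaginary quadratic field
   Q(omega). *)
Definition imaginary_quadratic_integer : Prop :=
  exists t n : int,
    omega ^+ 2 - t%:~R * omega + n%:~R = 0 /\ t ^+ 2 < 4 * n.

(* The coordinates in the basis (1, omega) of an element of Z[omega]. *)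
Definition Zcoord (z : K) : int * int :=
  xget (0, 0) [set c | z = c.1%:~R + c.2%:~R * omega].

Definition Zomega_PID : Prop :=
  forall I : set K, is_ideal Zomega I ->
    exists2 g, I g & I = principal_ideal Zomega g.

(* [m] is a ring isomorphism from Z[omega] onto the ring of all endomorphisms
   of E over the algebraic closure [algC] of [K], and all of these are defined
   over [K].  The maps [m z] are only relevant on the points of the curve. *)
Record complex_multiplication (m : K -> wpoint algC -> wpoint algC) : Prop := {
  cm_endo : forall z, Zomega z -> is_endomorphism iota E (m z);
  cm_one : forall P, on_curve Ebar P -> m 1 P = P;
  cm_add : forall z w P, Zomega z -> Zomega w -> on_curve Ebar P ->
    m (z + w) P = padd Ebar (m z P) (m w P);
  cm_mul : forall z w P, Zomega z -> Zomega w -> on_curve Ebar P ->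
    m (z * w) P = m z (m w P);
  cm_inj : forall z w, Zomega z -> Zomega w ->
    (forall P, on_curve Ebar P -> m z P = m w P) -> z = w;
  cm_surj : forall h, is_endomorphism (idfun : {rmorphism algC -> algC}) Ebar h ->
    exists2 z, Zomega z & forall P, on_curve Ebar P -> h P = m z P
}.

(* [z]P as a K-rational point. *)
Definition cm_act (m : K -> wpoint algC -> wpoint algC) (z : K) (P : wpoint K) :
    wpoint K :=
  xget None [set Q | on_curve E Q /\ map_point iota Q = m z (map_point iota P)].

End ComplexMultiplication.

(** * Reduction modulo a prime *)

Section Reduction.
Variables (K : fieldExtType rat) (E : weierstrass K) (p : set K).

Definition integral_coefficients : Prop :=
  [/\ ringOfIntegers (a1 E), ringOfIntegers (a2 E), ringOfIntegers (a3 E),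
      ringOfIntegers (a4 E) & ringOfIntegers (a6 E)].

(* Points with non-singular reduction: for p-primitive homogeneous coordinates
   [u], some partial derivative of the Weierstrass form does not vanish at [u]
   modulo p. *)
Definition E0 : set (wpoint K) :=
  [set P | on_curve E P /\
     exists u : 'I_3 -> K,
       [/\ same_proj (proj P) u, forall i, (0 <= nu p (u i))%E,
           exists i, nu p (u i) = 0%E &
           exists i, nu p (mderiv i (weierstrass_form E)).@[u] = 0%E]].

End Reduction.

(** * Net polynomials *)

Section Nets.
Variable K : fieldType.

Definition elliptic_net (r : nat) (W : 'rV[int]_r -> K) : Prop :=
  forall p q t s : 'rV[int]_r,
    W (p + q + s) * W (p - q) * W (t + s) * W t
    + W (q + t + s) * W (q - t) * W (p + s) * W p
    + W (t + p + s) * W (t - p) * W (q + s) * W q = 0.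

Definition unit_vec (r : nat) (i : 'I_r) : 'rV[int]_r := delta_mx 0 i.

(* [W] is the net v |-> Psi_v(Ps). *)
Record net_polynomials (E : weierstrass K) (r : nat) (Ps : r.-tuple (K * K))
    (W : 'rV[int]_r -> K) : Prop := {
  net_elliptic : elliptic_net W;
  net_0 : W 0 = 0;
  net_e : forall i, W (unit_vec i) = 1;
  net_2e : forall i,
    W (unit_vec i *+ 2) =
      2 * (tnth Ps i).2 + a1 E * (tnth Ps i).1 + a3 E;
  net_ee : forall i j, i != j -> W (unit_vec i + unit_vec j) = 1;
  net_2ee : forall i j, i != j ->
    let: (xi, yi) := tnth Ps i in
    let: (xj, yj) := tnth Ps j in
    let lambda := (yj - yi) / (xj - xi) in
    W (unit_vec i *+ 2 + unit_vec j) =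
      2 * xi + xj - lambda ^+ 2 - a1 E * lambda + a2 E
}.

Definition Phi (r : nat) (Ps : r.+1.-tuple (K * K)) (W : 'rV[int]_r.+1 -> K)
    (v : 'rV[int]_r.+1) : K :=
  W v ^+ 2 * (tnth Ps 0).1 - W (v + unit_vec 0) * W (v - unit_vec 0).

End Nets.

(** * The quantities attached to a point of a CM curve *)

Section CMPoint.
Variables (K : fieldExtType rat) (iota : {rmorphism K -> algC}).
Variables (E : weierstrass K) (omega : K) (m : K -> wpoint algC -> wpoint algC).
Variables (P : wpoint K) (W : 'rV[int]_2 -> K) (p : set K).
Local Notation "[[ z ]]" := (cm_act iota E m z P).

Definition cm_pair : 2.-tuple (K * K) := [tuple affine P; affine [[omega]]].

Definition Zvec (z : K) : 'rV[int]_2 :=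
  \row_i tnth [tuple (Zcoord omega z).1; (Zcoord omega z).2] i.

Definition psi (z : K) : K := W (Zvec z).
Definition phi (z : K) : K := Phi cm_pair W (Zvec z).

(* The minimum is finite when [z]P is not O, since then psi z is not 0. *)
Definition g_nu (z : K) : int :=
  if [[z]] == None then 0
  else fine (Order.min (2%:E * nu p (psi z)) (nu p (phi z)))%E.

Definition Ann : set K := [set z | Zomega omega z /\ E0 E p [[z]]].

Definition net_ideal (v1 v2 : int) : set K :=
  let A11 := denominator (xcoord P) in
  let A22 := denominator (xcoord [[omega]]) in
  let A12 := ideal_mul (denominator (xcoord (padd E P [[omega]])))
               (ideal_mul (ideal_inv A11) (ideal_inv A22)) in
  ideal_mul (ideal_exp A11 (v1 ^+ 2))
    (ideal_mul (ideal_exp A22 (v2 ^+ 2)) (ideal_exp A12 (v1 * v2))).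

End CMPoint.

(* Main.v *)
(* Write x_z = x([z]P).  The proof rests on the identity
   psi_(z+l) psi_(z-l) = psi_z^2 psi_l^2 (x_l - x_z), which follows from the
   recursion of the net along lines parallel to the axes, and on the behaviour
   modulo p of the relation between x(S), x(T), x(S + T) and x(S - T) on the
   Kummer line.  This relation has no common factor at two non-singular points,
   and x(S) - x(T) has the least possible valuation if just one of S, T is
   singular.  Taking valuations gives g_(z+l) + g_(z-l) = 2 g_z + 2 g_l for all z
   and all l in Ann(P), so that g is a polynomial of degree 2 in the
   coordinates on each coset of Z[omega] r.

   It is also needed that omega preserves non-singular points.  On x-coordinates
   omega is a rational function A / B that commutes with the Kummer relation.
   Over a valuation ring of an algebraically closed field that dominates O_p
   there is a semistable model.  There the reduction of A / B is not a finite
   constant, and the Kummer relation between a given point and generic points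
   shows that A / B maps non-singular points to non-singular ones. *)

Require Import Defs.
From mathcomp Require Import all_boot all_order all_algebra all_field.
From mathcomp Require Import mpoly.
From mathcomp Require Import boolp classical_sets constructive_ereal.
From mathcomp Require Import ring zify.

Set Implicit Arguments.
Unset Strict Implicit.
Unset Printing Implicit Defensive.

Import Order.TTheory GRing.Theory Num.Theory.
Local Open Scope classical_set_scope.
Local Open Scope ring_scope.

(** The obstacle is a model with cuspidal reduction. There [A / B] may reduce to a finite constant,
    and then generic points say nothing about a given one. Such a constant is forced to be the
    singular point, and at a node the leading terms of the Kummer relation exclude this; hence the
    detour through a semistable model. That model is obtained by extracting roots of the invariants,
    and over an algebraically closed field no discrete valuation is available. So the argument runs
    with a bare valuation ring [V] and its maximal ideal [vmax V], without residue field or value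
    group.

    Only x-coordinates enter. The relation [kum] consists of two polynomial equations whose
    coefficients come from the b-invariants, and it stays usable in residue characteristic 2.

    The minimum that defines g becomes additive: g_z = 2 v(psi_z) + v([hgt] x_z), where division by
    [hgt x] makes the coordinates (x : 1) primitive. For z = l or z = -l both sides of the product
    formula vanish and give no information. The missing equality g_(2l) = 4 g_l, for l in Ann(P), is
    recovered with the help of the independent element omega l. *)

Record valring (F : fieldType) (V : set F) : Prop := {
  vr1 : V 1;
  vrD : forall x y, V x -> V y -> V (x + y);
  vrN : forall x, V x -> V (- x);
  vrM : forall x y, V x -> V y -> V (x * y);
  vr_total : forall x, V x \/ V x^-1
}.

(** The non-units of [V]. The clause [x = 0] is separate because [0^-1 = 0] belongs to [V]. *)
Definition vmax (F : fieldType) (V : set F) : set F := [set x | x = 0 \/ ~ V x^-1].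

(** * Arithmetic of a valuation ring and its maximal ideal *)

Section ValuationRing.
Variables (F : fieldType) (V : set F).
Hypothesis HV : valring V.
Local Notation M := (vmax V).

Lemma vr0 : V 0.
Proof. by rewrite -(addrN 1); apply: (vrD HV); [|apply: (vrN HV)]; exact: (vr1 HV). Qed.

Lemma vrB x y : V x -> V y -> V (x - y).
Proof. by move=> Vx Vy; apply: (vrD HV) => //; apply: (vrN HV). Qed.

Lemma vrn n : V n%:R.
Proof.
elim: n => [|n IH]; first exact: vr0.
by rewrite -natr1; apply: (vrD HV) => //; exact: (vr1 HV).
Qed.

Lemma vrX x n : V x -> V (x ^+ n).
Proof.
move=> Vx; elim: n => [|n IH]; first by rewrite expr0; exact: (vr1 HV).
by rewrite exprS; apply: (vrM HV).
Qed.

Lemma vmax_sub x : M x -> V x.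
Proof. by case=> [->|nV]; [exact: vr0 | case: (vr_total HV x)]. Qed.

Lemma vmax0 : M 0. Proof. by left. Qed.

Lemma not_vr_inv x : ~ V x -> M x^-1.
Proof. by move=> nV; right; rewrite invrK. Qed.

Lemma vmaxMl x y : V x -> M y -> M (x * y).
Proof.
move=> Vx [->|nVy]; first by rewrite mulr0; left.
have [->|x0] := eqVneq x 0; first by rewrite mul0r; left.
right => Vxy; apply: nVy.
by have := vrM HV Vx Vxy; rewrite invfM mulrA divff // mul1r.
Qed.

Lemma vmaxMr x y : M x -> V y -> M (x * y).
Proof. by move=> Mx Vy; rewrite mulrC; apply: vmaxMl. Qed.

Lemma vmaxN x : M x -> M (- x).
Proof. by move=> Mx; rewrite -mulN1r; apply: vmaxMl => //; apply: (vrN HV) => //; exact: (vr1 HV). Qed.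

Lemma vmax1 : ~ M 1.
Proof.
case=> [/eqP|]; first by rewrite oner_eq0.
by rewrite invr1; apply; exact: (vr1 HV).
Qed.

(** One of x / y and y / x is integral, so the sum is an integral multiple of one of its terms. *)
Lemma vmaxD x y : M x -> M y -> M (x + y).
Proof.
have [->|y0] := eqVneq y 0; first by rewrite addr0.
have [->|x0] := eqVneq x 0; first by rewrite add0r.
move=> Mx My; have key u v : u != 0 -> M v -> V (u / v) -> v != 0 -> M (u + v).
  move=> u0 Mv Vuv v0; have -> : u + v = (u / v + 1) * v by field.
  by apply: vmaxMl => //; apply: (vrD HV) => //; exact: (vr1 HV).
case: (vr_total HV (x / y)) => Vxy; first exact: key.
by rewrite addrC; apply: key => //; rewrite invfM invrK mulrC in Vxy.
Qed.

Lemma vmaxB x y : M x -> M y -> M (x - y).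
Proof. by move=> Mx My; apply: vmaxD => //; apply: vmaxN. Qed.

Lemma vunit x : V x -> ~ M x -> x != 0 /\ V x^-1.
Proof.
move=> Vx nM; split; first by apply/eqP => x0; apply: nM; left.
by apply: contra_notP nM; right.
Qed.

Lemma vmax_prime x y : V x -> V y -> M (x * y) -> M x \/ M y.
Proof.
move=> Vx Vy Mxy; apply: contrapT => /not_orP[nx ny].
have [x0 Vxi] := vunit Vx nx; have [y0 Vyi] := vunit Vy ny.
case: Mxy => [/eqP|]; first by rewrite mulf_eq0 (negPf x0) (negPf y0).
by apply; rewrite invfM; apply: (vrM HV).
Qed.

Lemma vmaxX_inv x n : V x -> M (x ^+ n) -> M x.
Proof.
move=> Vx; elim: n => [|n IH]; first by rewrite expr0 => /vmax1.
by rewrite exprS => /(vmax_prime Vx (vrX n Vx))[].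
Qed.

Lemma vmaxX x n : M x -> (0 < n)%N -> M (x ^+ n).
Proof.
by case: n => // n Mx _; rewrite exprS; apply: vmaxMr => //; apply/vrX/vmax_sub.
Qed.

Lemma nvmaxM x y : V x -> V y -> ~ M x -> ~ M y -> ~ M (x * y).
Proof. by move=> Vx Vy nx ny /(vmax_prime Vx Vy)[]. Qed.

Lemma nvmaxDl x y : M y -> ~ M x -> ~ M (x + y).
Proof. by move=> My nx Mxy; apply: nx; rewrite -(addrK y x); apply: vmaxB. Qed.

Lemma vmax_divu x u : V u -> ~ M u -> M x -> M (x / u).
Proof. by move=> Vu nu Mx; have [_ ?] := vunit Vu nu; apply: vmaxMr. Qed.

Lemma vr_divu x u : V u -> ~ M u -> V x -> V (x / u).
Proof. by move=> Vu nu Mx; have [_ ?] := vunit Vu nu; apply: (vrM HV). Qed.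

(** Integral closedness in degree two: if z were not integral, dividing the equation by z would
    write it as p + q / z with 1 / z in [M]. *)
Lemma vr_quad p q z : V p -> V q -> z ^+ 2 = p * z + q -> V z.
Proof.
move=> Vp Vq e; apply: contrapT => nV; have Mi := not_vr_inv nV.
have z0 : z != 0 by apply/eqP => z0; apply: nV; rewrite z0; exact: vr0.
apply: nV; have -> : z = p + q * z^-1.
  by apply: (mulIf z0); rewrite mulrDl -mulrA mulVf // mulr1 -e.
by apply: (vrD HV) => //; apply: (vrM HV) => //; apply: vmax_sub.
Qed.

Lemma vmax_quad p q z : M p -> M q -> z ^+ 2 = p * z + q -> M z.
Proof.
move=> Mp Mq e.
have Vz : V z by apply: vr_quad e; apply: vmax_sub.
apply: (@vmaxX_inv z 2) => //; rewrite e.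
by apply: vmaxD => //; apply: vmaxMr.
Qed.

End ValuationRing.

Ltac vr_solve HV :=
  repeat first [ assumption | exact: (vr0 HV) | exact: (vr1 HV) | exact: (vrn HV)
    | apply: (vrB HV) | apply: (vrD HV) | apply: (vrN HV) | apply: (vrX HV)
    | apply: (vrM HV) | by apply: (vmax_sub HV) ].

Ltac vm_solve HV :=
  repeat first [ assumption | apply: (vmaxB HV) | apply: (vmaxD HV)
    | apply: (vmaxN HV) | by apply: (vmaxX HV)
    | solve [apply: (vmaxMl HV); [vr_solve HV | vm_solve HV]]
    | solve [apply: (vmaxMr HV); [vm_solve HV | vr_solve HV]] ].

(** * Kummer quotients *)

(* The invariants b2, b4, b6, b8 of a Weierstrass equation. *)
Record kummer (F : Type) := Kummer { c2 : F; c4 : F; c6 : F; c8 : F }.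

Section Kummer.
Variable F : fieldType.
Implicit Types (k : kummer F) (x y s t r u z : F).

(** The classical relation between b2, b4, b6 and b8. The fourth invariant is kept as a datum
    because solving for it divides by 4, which destroys integrality in residue characteristic 2. *)
Definition kwf k := 4 * c8 k = c2 k * c6 k - c4 k ^+ 2.

Definition kdisc k := - c2 k ^+ 2 * c8 k - 8 * c4 k ^+ 3 - 27 * c6 k ^+ 2
  + 9 * c2 k * c4 k * c6 k.

Definition kU k x y :=
  2 * x * y * (x + y) + c2 k * x * y + c4 k * (x + y) + c6 k.

Definition kV k x y :=
  x ^+ 2 * y ^+ 2 - c4 k * x * y - c6 k * (x + y) - c8 k.

(* For x = x(S), y = x(T), the pair {s, t} is {x(S + T), x(S - T)}. *)
Definition kum k x y s t :=
  (x - y) ^+ 2 * (s * t) = kV k x y /\ (x - y) ^+ 2 * (s + t) = kU k x y.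

(* x(2S) = phi2 x / psi2 x for x = x(S). *)
Definition psi2 k x := 4 * x ^+ 3 + c2 k * x ^+ 2 + 2 * c4 k * x + c6 k.
Definition phi2 k x := x ^+ 4 - c4 k * x ^+ 2 - 2 * c6 k * x - c8 k.

(** The invariants in the coordinate x - r. The new [c6] and [c8] are the values at r of the 2- and
    3-division polynomials, so a root of one of these can be used to kill an invariant. *)
Definition kshift r k := Kummer (c2 k + 12 * r)
  (c4 k + r * c2 k + 6 * r ^+ 2) (psi2 k r)
  (c8 k + 3 * r * c6 k + 3 * r ^+ 2 * c4 k + r ^+ 3 * c2 k + 3 * r ^+ 4).

Definition kscale u k := Kummer (c2 k / u ^+ 2) (c4 k / u ^+ 4)
  (c6 k / u ^+ 6) (c8 k / u ^+ 8).

Lemma kum_shift r k x y s t :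
  kum (kshift r k) (x - r) (y - r) (s - r) (t - r) <-> kum k x y s t.
Proof.
have eU : kU (kshift r k) (x - r) (y - r) = kU k x y - 2 * r * (x - y) ^+ 2.
  by rewrite /kU /kshift /psi2 /=; ring.
have eV : kV (kshift r k) (x - r) (y - r) =
    kV k x y - r * kU k x y + r ^+ 2 * (x - y) ^+ 2.
  by rewrite /kV /kU /kshift /psi2 /=; ring.
rewrite /kum eU eV; have -> : x - r - (y - r) = x - y by ring.
split=> -[e1 e2].
  have e3 : (x - y) ^+ 2 * (s + t) = kU k x y.
    apply: (addIr (- (2 * r * (x - y) ^+ 2))); rewrite -e2; ring.
  split=> //; apply: (addIr (- (r * kU k x y) + r ^+ 2 * (x - y) ^+ 2)).
  by rewrite [RHS]addrA -e1 -e3; ring.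
by rewrite -e1 -e2; split; ring.
Qed.

Lemma psi2_shift r k x : psi2 (kshift r k) (x - r) = psi2 k x.
Proof. by rewrite /psi2 /= /psi2; ring. Qed.

Lemma phi2_shift r k x : phi2 (kshift r k) (x - r) = phi2 k x - r * psi2 k x.
Proof. by rewrite /phi2 /psi2 /= /psi2; ring. Qed.

Lemma kwf_shift r k : kwf k -> kwf (kshift r k).
Proof. rewrite /kwf /= /psi2 => e; ring: e. Qed.

Lemma kum_scale u k x y s t : u != 0 ->
  kum (kscale u k) (x / u ^+ 2) (y / u ^+ 2) (s / u ^+ 2) (t / u ^+ 2) <->
  kum k x y s t.
Proof.
move=> u0.
have eU : kU (kscale u k) (x / u ^+ 2) (y / u ^+ 2) = kU k x y / u ^+ 6.
  by rewrite /kU /=; field.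
have eV : kV (kscale u k) (x / u ^+ 2) (y / u ^+ 2) = kV k x y / u ^+ 8.
  by rewrite /kV /=; field.
rewrite /kum eU eV; split=> -[e1 e2].
  split.
    have := congr1 ( *%R^~ (u ^+ 8)) e1; rewrite divfK ?expf_neq0 // => <-.
    by field.
  have := congr1 ( *%R^~ (u ^+ 6)) e2; rewrite divfK ?expf_neq0 // => <-.
  by field.
by rewrite -e1 -e2; split; field.
Qed.

Lemma psi2_scale u k x : u != 0 ->
  psi2 (kscale u k) (x / u ^+ 2) = psi2 k x / u ^+ 6.
Proof. by move=> u0; rewrite /psi2 /=; field. Qed.

Lemma phi2_scale u k x : u != 0 ->
  phi2 (kscale u k) (x / u ^+ 2) = phi2 k x / u ^+ 8.
Proof. by move=> u0; rewrite /phi2 /=; field. Qed.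

Lemma kwf_scale u k : u != 0 -> kwf k -> kwf (kscale u k).
Proof.
rewrite /kwf /= => u0 e; have -> : 4 * (c8 k / u ^+ 8) = 4 * c8 k / u ^+ 8 by field.
by rewrite e; field.
Qed.

Lemma kumC k x y s t : kum k x y s t -> kum k y x s t.
Proof.
rewrite /kum => -[e1 e2]; rewrite -opprB sqrrN; split; rewrite ?e1 ?e2.
  by rewrite /kV; ring.
by rewrite /kU; ring.
Qed.

Lemma kum_swap k x y s t : kum k x y s t -> kum k x y t s.
Proof. by rewrite /kum mulrC (addrC s t) [s * t]mulrC mulrC. Qed.

(* The relation x(S + T) = z is symmetric in the three points. *)
Lemma kum_sym k x y s t z : kum k x y s t ->
  (x - z) ^+ 2 * y ^+ 2 - kU k x z * y + kV k x z =
  (x - y) ^+ 2 * (z - s) * (z - t).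
Proof.
move=> [e1 e2].
have -> : (x - y) ^+ 2 * (z - s) * (z - t) =
  (x - y) ^+ 2 * z ^+ 2 - (x - y) ^+ 2 * (s + t) * z + (x - y) ^+ 2 * (s * t).
  by ring.
by rewrite e1 e2 /kU /kV; ring.
Qed.

(** The left side is the discriminant of the quadratic polynomial with roots s and t, cleared of
    denominators; modulo [kwf] it splits into one factor for each of the two points. *)
Lemma kum_psi2 k x y s t : kwf k -> kum k x y s t ->
  ((x - y) ^+ 2 * (s - t)) ^+ 2 = psi2 k x * psi2 k y.
Proof.
move=> wf [e1 e2].
have -> : ((x - y) ^+ 2 * (s - t)) ^+ 2 =
  ((x - y) ^+ 2 * (s + t)) ^+ 2 - 4 * (x - y) ^+ 2 * ((x - y) ^+ 2 * (s * t)).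
  by ring.
rewrite e1 e2.
have -> : kU k x y ^+ 2 - 4 * (x - y) ^+ 2 * kV k x y = psi2 k x * psi2 k y -
    (x - y) ^+ 2 * (c2 k * c6 k - c4 k ^+ 2 - 4 * c8 k).
  by rewrite /psi2 /kU /kV; ring.
by rewrite -wf subrr mulr0 subr0.
Qed.

End Kummer.

(** * Reduction of the Kummer relation *)

Section Reduction.
Variables (F : fieldType) (V : set F).
Hypothesis HV : valring V.
Local Notation M := (vmax V).
Implicit Types (k : kummer F) (x y s t : F).

Definition kint k := [/\ V (c2 k), V (c4 k), V (c6 k) & V (c8 k)].

(* x is the x-coordinate of points that reduce to a singular point. *)
Definition sing k x := [/\ V x, M (psi2 k x) & M (phi2 k x)].

Lemma kint_shift r k : V r -> kint k -> kint (kshift r k).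
Proof. by move=> Vr [V2 V4 V6 V8]; split; rewrite /= /psi2; vr_solve HV. Qed.

Lemma kint_phi2 k x : kint k -> V x -> V (phi2 k x).
Proof. by move=> [V2 V4 V6 V8] Vx; rewrite /phi2; vr_solve HV. Qed.

Lemma sing_shift r k x : kint k -> V r -> sing (kshift r k) (x - r) <-> sing k x.
Proof.
move=> ki Vr; rewrite /sing psi2_shift phi2_shift; split=> -[Vx m1 m2].
  split=> //; first by rewrite -(subrK r x); vr_solve HV.
  by rewrite -(subrK (r * psi2 k x) (phi2 k x)); vm_solve HV.
by split=> //; [vr_solve HV | vm_solve HV].
Qed.

(** At the origin [psi2] and [phi2] are [c6] and - [c8]; then [kwf] puts the square of [c4] in
    [M]. *)
Lemma sing0_coef k : kwf k -> kint k -> sing k 0 -> [/\ M (c4 k), M (c6 k) & M (c8 k)].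
Proof.
move=> wf [V2 V4 V6 V8] [_].
have -> : psi2 k 0 = c6 k by rewrite /psi2; ring.
have -> : phi2 k 0 = - c8 k by rewrite /phi2; ring.
move=> m6 /(vmaxN HV); rewrite opprK => m8; split=> //.
apply: (@vmaxX_inv _ _ HV _ 2) => //.
have -> : c4 k ^+ 2 = c2 k * c6 k - 4 * c8 k by rewrite wf; ring.
by vm_solve HV.
Qed.

Lemma sing_center k x : kint k -> M (c4 k) -> M (c6 k) -> M (c8 k) ->
  sing k x <-> M x.
Proof.
move=> [V2 V4 V6 V8] m4 m6 m8; split=> [[Vx m1 m2]|Mx].
  apply: (@vmaxX_inv _ _ HV _ 4) => //.
  have -> : x ^+ 4 = phi2 k x + c4 k * x ^+ 2 + 2 * c6 k * x + c8 k.
    by rewrite /phi2; ring.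
  by vm_solve HV.
have Vx := vmax_sub HV Mx.
by split=> //; rewrite /psi2 /phi2; vm_solve HV.
Qed.

(** A cubic has at most one singular point: once it sits at the origin, [phi2] reduces to the fourth
    power of the coordinate. *)
Lemma sing_iff k x y : kwf k -> kint k -> sing k x -> sing k y <-> M (y - x).
Proof.
move=> wf ki sx; have [Vx _ _] := sx.
have /sing0_coef[||m4 m6 m8] : sing (kshift x k) 0.
- by rewrite -(subrr x) sing_shift.
- exact: kwf_shift.
- exact: kint_shift.
by rewrite -(sing_shift _ ki Vx) sing_center //; apply: kint_shift.
Qed.

Lemma vr_inv_nvmax y : ~ M y -> V y^-1 /\ y != 0.
Proof.
move=> ny; split; first by apply: contra_notP ny; right.
by apply/eqP => y0; apply: ny; left.
Qed.

(** With the singular point at the origin, s and t are roots of a monic quadratic polynomial whose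
    lower coefficients lie in [M]. Only the inverse of y enters them, so y need not be integral. *)
Lemma sing_add k x y s t : kwf k -> kint k -> sing k x -> ~ sing k y ->
  kum k x y s t -> sing k s /\ sing k t.
Proof.
move=> wf ki sx ny; have [Vx _ _] := sx.
rewrite (sing_iff _ wf ki sx) in ny; rewrite !(sing_iff _ wf ki sx).
move=> /kum_shift-/(_ x); rewrite subrr.
have /sing0_coef[||m4 m6 m8] : sing (kshift x k) 0.
- by rewrite -(subrr x) sing_shift.
- exact: kwf_shift.
- exact: kint_shift.
move: {k wf ki sx} (kshift x k) (y - x) ny (s - x) (t - x) m4 m6 m8.
move=> k {s t} {}y ny s t m4 m6 m8 [e1 e2].
have [Viy y0] := vr_inv_nvmax ny.
have key s' t' : (0 - y) ^+ 2 * (s' * t') = kV k 0 y ->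
    (0 - y) ^+ 2 * (s' + t') = kU k 0 y -> M s'.
  move=> f1 f2; apply: (@vmax_quad _ _ HV (c4 k * y^-1 + c6 k * y^-1 ^+ 2)
    (c6 k * y^-1 + c8 k * y^-1 ^+ 2)); [by vm_solve HV..|].
  have -> : s' ^+ 2 = (y^-1 ^+ 2 * ((0 - y) ^+ 2 * (s' + t'))) * s'
      - y^-1 ^+ 2 * ((0 - y) ^+ 2 * (s' * t')) by field.
  by rewrite f1 f2 /kV /kU; field.
by split; [apply: (key s t) | apply: (key t s); rewrite // 1?(mulrC t) 1?(addrC t)].
Qed.

(** The content of the vector (x, 1), up to units: after division by [hgt x] both entries are
    integral and one of them is a unit. *)
Definition hgt x := if `[< V x >] then 1 else x.

Lemma hgtV x : V x -> hgt x = 1.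
Proof. by rewrite /hgt => Vx; case: asboolP. Qed.

Lemma hgtNV x : ~ V x -> hgt x = x.
Proof. by rewrite /hgt => Vx; case: asboolP. Qed.

Lemma hgt_neq0 x : hgt x != 0.
Proof.
rewrite /hgt; case: asboolP => [_|nV]; first exact: oner_neq0.
by apply/eqP => x0; apply: nV; rewrite x0; exact: vr0.
Qed.

(** The points x and y have distinct reductions on the projective line, and x is integral; so in
    primitive coordinates their difference is a unit. *)
Lemma sing_sub k x y : kwf k -> kint k -> sing k x -> ~ sing k y ->
  V ((x - y) / hgt y) /\ ~ M ((x - y) / hgt y).
Proof.
move=> wf ki sx ny; have [Vx _ _] := sx; rewrite (sing_iff _ wf ki sx) in ny.
have [Vy|nVy] := pselect (V y).
  rewrite (hgtV Vy) divr1; split; first by vr_solve HV.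
  by move=> /(vmaxN HV); rewrite opprB.
rewrite (hgtNV nVy); have My := not_vr_inv nVy; have y0 := hgt_neq0 y.
rewrite (hgtNV nVy) in y0; have -> : (x - y) / y = -1 + x * y^-1 by field.
split; first by vr_solve HV.
apply: (nvmaxDl HV); first by vm_solve HV.
by move=> /(vmaxN HV); rewrite opprK; apply: vmax1.
Qed.

(* The duplication and addition forms have no common zero at pairs of
   non-singular points. *)
Lemma nonsing_content k x y : kint k -> ~ sing k x -> ~ sing k y ->
  let h := hgt x ^+ 2 * hgt y ^+ 2 in
  [/\ V ((x - y) ^+ 2 / h), V (kU k x y / h), V (kV k x y / h) &
    ~ [/\ M ((x - y) ^+ 2 / h), M (kU k x y / h) & M (kV k x y / h)]].
Proof.
move=> ki; have [V2 V4 V6 V8] := ki.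
have mixed x' y' : V x' -> ~ V y' -> let h := hgt x' ^+ 2 * hgt y' ^+ 2 in
  [/\ V ((x' - y') ^+ 2 / h), V (kU k x' y' / h), V (kV k x' y' / h) &
    ~ M ((x' - y') ^+ 2 / h)].
  move=> Vx nVy; rewrite /= (hgtV Vx) (hgtNV nVy) expr1n mul1r.
  have My := not_vr_inv nVy; have Vy := vmax_sub HV My.
  have y0 := hgt_neq0 y'; rewrite (hgtNV nVy) in y0.
  have -> : (x' - y') ^+ 2 / y' ^+ 2 = 1 + (x' ^+ 2 * y'^-1 ^+ 2 - 2 * x' * y'^-1).
    by field.
  have -> : kU k x' y' / y' ^+ 2 = 2 * x' * (x' * y'^-1 + 1) + c2 k * x' * y'^-1 +
    c4 k * (x' * y'^-1 + 1) * y'^-1 + c6 k * y'^-1 ^+ 2 by rewrite /kU; field.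
  have -> : kV k x' y' / y' ^+ 2 = x' ^+ 2 - c4 k * x' * y'^-1 -
    c6 k * (x' * y'^-1 + 1) * y'^-1 - c8 k * y'^-1 ^+ 2 by rewrite /kV; field.
  split; [by vr_solve HV..|].
  by apply: (nvmaxDl HV); [vm_solve HV | exact: vmax1].
have [Vx|nVx] := pselect (V x); have [Vy|nVy] := pselect (V y) => nx ny.
- rewrite /= (hgtV Vx) (hgtV Vy) !expr1n mulr1 !divr1.
  have VD : V (x - y) by vr_solve HV.
  split; [by rewrite /kU /kV; vr_solve HV..|] => -[mD mU mV].
  have {}mD : M (x - y) by apply: (@vmaxX_inv _ _ HV _ 2).
  (* On the diagonal [kU] and [kV] specialise to [psi2] and [phi2], so a common zero with x = y
     modulo [M] is a singular point. *)
  apply: nx; split=> //.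
    have -> : psi2 k x = kU k x y + (x - y) * (4 * x ^+ 2 + 2 * x * y
      + c2 k * x + c4 k) - 2 * x * (x - y) * (x - y) * 0.
      by rewrite /psi2 /kU; ring.
    by vm_solve HV.
  have -> : phi2 k x = kV k x y + (x - y) * (x ^+ 2 * (x + y) - c4 k * x - c6 k).
    by rewrite /phi2 /kV; ring.
  by vm_solve HV.
- by have [] := mixed x y Vx nVy; split=> // -[].
- have [] := mixed y x Vy nVx; rewrite /= [hgt y ^+ 2 * _]mulrC -(opprB x y) sqrrN.
  have -> : kU k y x = kU k x y by rewrite /kU; ring.
  have -> : kV k y x = kV k x y by rewrite /kV; ring.
  by move=> ? ? ? nm; split=> // -[/nm].
- rewrite /= (hgtNV nVx) (hgtNV nVy).
  have Mx := not_vr_inv nVx; have My := not_vr_inv nVy.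
  have Wx := vmax_sub HV Mx; have Wy := vmax_sub HV My.
  have x0 := hgt_neq0 x; rewrite (hgtNV nVx) in x0.
  have y0 := hgt_neq0 y; rewrite (hgtNV nVy) in y0.
  have -> : (x - y) ^+ 2 / (x ^+ 2 * y ^+ 2) = (y^-1 - x^-1) ^+ 2 by field; apply/andP.
  have -> : kU k x y / (x ^+ 2 * y ^+ 2) = 2 * (x^-1 + y^-1) + c2 k * x^-1 * y^-1
    + c4 k * (x^-1 + y^-1) * x^-1 * y^-1 + c6 k * x^-1 ^+ 2 * y^-1 ^+ 2.
    by rewrite /kU; field; apply/andP.
  have -> : kV k x y / (x ^+ 2 * y ^+ 2) = 1 - (c4 k * x^-1 * y^-1
    + c6 k * (x^-1 + y^-1) * x^-1 * y^-1 + c8 k * x^-1 ^+ 2 * y^-1 ^+ 2).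
    by rewrite /kV; field; apply/andP.
  split; [by vr_solve HV..|] => -[_ _]; apply: (nvmaxDl HV); last exact: vmax1.
  by vm_solve HV.
Qed.

(** Gauss's lemma for the quadratic form with coefficients (x - y)^2, -[kU], [kV] and roots s and t.
    Its linear factors X - s Z and X - t Z have contents [hgt s] and [hgt t], while
    [nonsing_content] computes the content of the whole form from x and y. *)
Lemma nonsing_add k x y s t : kint k -> ~ sing k x -> ~ sing k y ->
  kum k x y s t ->
  let w := (x - y) ^+ 2 * hgt s * hgt t / (hgt x ^+ 2 * hgt y ^+ 2) in
  V w /\ ~ M w.
Proof.
move=> ki nx ny [e1 e2]; have := nonsing_content ki nx ny.
have := hgt_neq0 x; have := hgt_neq0 y; move=> hy0 hx0 /=.
set h := hgt x ^+ 2 * hgt y ^+ 2.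
have h0 : h != 0 by rewrite mulf_neq0 ?expf_neq0.
rewrite -e1 -e2 ![_ ^+ 2 * _ / h]mulrAC.
set d := (x - y) ^+ 2 / h => -[Vd Vu Vv nM].
rewrite (_ : (x - y) ^+ 2 * hgt s * hgt t / h = d * hgt s * hgt t); last first.
  by rewrite /d; field.
have [Vs|nVs] := pselect (V s); have [Vt|nVt] := pselect (V t).
- rewrite (hgtV Vs) (hgtV Vt) !mulr1; split=> // Md.
  by apply: nM; split=> //; vm_solve HV.
- rewrite (hgtV Vs) (hgtNV nVt) mulr1.
  have t0 := hgt_neq0 t; rewrite (hgtNV nVt) in t0; have Mt := not_vr_inv nVt.
  have eu : d * (s + t) = d * t * (1 + s * t^-1) by field.
  have un : ~ M (1 + s * t^-1).
    by apply: (nvmaxDl HV); [vm_solve HV | exact: vmax1].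
  split.
    have [z0 Vz] := vunit (vrD HV (vr1 HV) (vrM HV Vs (vmax_sub HV Mt))) un.
    by rewrite -(mulfK z0 (d * t)) -eu; vr_solve HV.
  move=> Md; apply: nM; split.
  + by rewrite -(mulfK t0 d); vm_solve HV.
  + by rewrite eu; vm_solve HV.
  + by rewrite mulrCA; vm_solve HV.
- rewrite (hgtV Vt) (hgtNV nVs) mulr1.
  have s0 := hgt_neq0 s; rewrite (hgtNV nVs) in s0; have Ms := not_vr_inv nVs.
  have eu : d * (s + t) = d * s * (1 + t * s^-1) by field.
  have un : ~ M (1 + t * s^-1).
    by apply: (nvmaxDl HV); [vm_solve HV | exact: vmax1].
  split.
    have [z0 Vz] := vunit (vrD HV (vr1 HV) (vrM HV Vt (vmax_sub HV Ms))) un.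
    by rewrite -(mulfK z0 (d * s)) -eu; vr_solve HV.
  move=> Md; apply: nM; split.
  + by rewrite -(mulfK s0 d); vm_solve HV.
  + by rewrite eu; vm_solve HV.
  + by rewrite mulrA; vm_solve HV.
- rewrite (hgtNV nVs) (hgtNV nVt) -mulrA; split=> // Mv; apply: nM.
  have s0 := hgt_neq0 s; rewrite (hgtNV nVs) in s0; have Ms := not_vr_inv nVs.
  have t0 := hgt_neq0 t; rewrite (hgtNV nVt) in t0; have Mt := not_vr_inv nVt.
  split=> //.
    have -> : d = d * (s * t) * (s^-1 * t^-1) by field; apply/andP.
    by vm_solve HV.
  have -> : d * (s + t) = d * (s * t) * (s^-1 + t^-1) by field; apply/andP.
  by vm_solve HV.
Qed.

End Reduction.

(** * Polynomials over a valuation ring *)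

Section ValuedPolynomials.
Variables (F : closedFieldType) (V : set F).
Hypothesis HV : valring V.
Local Notation M := (vmax V).
Implicit Types (p q g : {poly F}) (x y z s t : F).

Definition polyV p := forall i, V p`_i.
Definition polyM p := forall i, M p`_i.

Lemma vr_sum (I : Type) (r : seq I) (P : pred I) (f : I -> F) :
  (forall i, P i -> V (f i)) -> V (\sum_(i <- r | P i) f i).
Proof. by move=> Vf; elim/big_ind: _ => // *; vr_solve HV. Qed.

Lemma vmax_sum (I : Type) (r : seq I) (P : pred I) (f : I -> F) :
  (forall i, P i -> M (f i)) -> M (\sum_(i <- r | P i) f i).
Proof. by move=> Vf; elim/big_ind: _ => //; [left | move=> *; vm_solve HV]. Qed.

Lemma polyV_const c : V c -> polyV c%:P.
Proof. by move=> Vc i; rewrite coefC; case: ifP => // _; exact: vr0. Qed.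

Lemma polyVX : polyV 'X.
Proof. by move=> i; rewrite coefX; exact: vrn. Qed.

Lemma polyVD p q : polyV p -> polyV q -> polyV (p + q).
Proof. by move=> Vp Vq i; rewrite coefD; apply: vrD. Qed.

Lemma polyVN p : polyV p -> polyV (- p).
Proof. by move=> Vp i; rewrite coefN; apply: vrN. Qed.

Lemma polyVB p q : polyV p -> polyV q -> polyV (p - q).
Proof. by move=> Vp Vq; apply: polyVD => //; apply: polyVN. Qed.

Lemma polyVM p q : polyV p -> polyV q -> polyV (p * q).
Proof. by move=> Vp Vq i; rewrite coefM; apply: vr_sum => j _; apply: vrM. Qed.

Lemma polyVZ c p : V c -> polyV p -> polyV (c *: p).
Proof. by move=> Vc Vp i; rewrite coefZ; apply: vrM. Qed.

Lemma polyMM p q : polyM p -> polyV q -> polyM (p * q).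
Proof. by move=> Vp Vq i; rewrite coefM; apply: vmax_sum => j _; apply: vmaxMr. Qed.

Lemma polyMD p q : polyM p -> polyM q -> polyM (p + q).
Proof. by move=> Vp Vq i; rewrite coefD; apply: vmaxD. Qed.

Lemma polyMV p : polyM p -> polyV p.
Proof. by move=> Mp i; apply: vmax_sub. Qed.

Lemma hornerV p x : polyV p -> V x -> V p.[x].
Proof.
move=> Vp Vx; rewrite horner_coef; apply: vr_sum => i _.
by apply: vrM => //; apply: vrX.
Qed.

Lemma hornerM_max p x : polyM p -> V x -> M p.[x].
Proof.
move=> Vp Vx; rewrite horner_coef; apply: vmax_sum => i _.
by apply: vmaxMr => //; apply: vrX.
Qed.

Lemma horner_cong p x y : polyV p -> V x -> V y -> M (x - y) -> M (p.[x] - p.[y]).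
Proof.
move=> Vp Vx Vy Mxy; rewrite !horner_coef -sumrB; apply: vmax_sum => i _.
rewrite -mulrBr subrXX; apply: vmaxMl => //; apply: vmaxMr => //.
by apply: vr_sum => j _; apply: vrM => //; apply: vrX.
Qed.

Definition prim p := polyV p /\ ~ polyM p.

(** Leading terms with coefficient in [M] are dropped until a unit comes on top. This gives access
    to the degree of the reduction without forming the residue field. *)
Lemma prim_trunc g : prim g ->
  exists g', [/\ polyV g', ~ M (lead_coef g') & polyM (g - g')].
Proof.
move: {2}(size g) (leqnn (size g)) => n; elim: n g => [|n IH] g.
  rewrite leqn0 size_poly_eq0 => /eqP -> [_ []] i; rewrite coef0; exact: vmax0.
move=> sg [Vg nMg]; have [Ml|nMl] := pselect (M (lead_coef g)); last first.
  by exists g; split=> // i; rewrite subrr coef0; exact: vmax0.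
pose h := g - lead_coef g *: 'X^((size g).-1).
have Mgh : polyM (g - h).
  move=> i; rewrite opprB addrC subrK coefZ coefXn; apply: vmaxMr => //.
  exact: vrn.
have Vh : polyV h.
  have -> : h = g - (g - h) by rewrite opprB addrC subrK.
  by apply: polyVB => //; apply: polyMV.
have sh : (size h <= n)%N.
  apply/leq_sizeP => j nj; rewrite coefB coefZ coefXn.
  have [->|jn] := eqVneq j (size g).-1; first by rewrite mulr1 subrr.
  rewrite mulr0 subr0 nth_default //; move: nj sg jn; case: (size g) => //= m.
  by move=> ? ? ?; lia.
have [|g' [Vg' nM' Mg']] := IH h sh.
  split=> // Mh; apply: nMg; rewrite -(subrK h g); exact: polyMD.
by exists g'; split=> //; rewrite -(subrKA h); apply: polyMD => //.
Qed.

(** Gauss's lemma: the truncated factors have unit leading coefficients, and so has their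
    product. *)
Lemma primM p q : prim p -> prim q -> prim (p * q).
Proof.
move=> pp pq; have [Vp _] := pp; have [Vq _] := pq.
have [p' [Vp' lp' Mp]] := prim_trunc pp; have [q' [Vq' lq' Mq]] := prim_trunc pq.
split; first exact: polyVM.
move=> Mpq; have Mpq' : polyM (p' * q').
  have -> : p' * q' = p * q + ((p - p') * (- q) + (q - q') * (- p')) by ring.
  by apply: polyMD => //; apply: polyMD; apply: polyMM => //; apply: polyVN.
have := Mpq' (size (p' * q')).-1; rewrite -lead_coefE lead_coefM.
by apply: nvmaxM => //; rewrite lead_coefE.
Qed.

Lemma prim_monic p : polyV p -> p \is monic -> prim p.
Proof.
move=> Vp /monicP m; split=> // /(_ (size p).-1).
by rewrite -lead_coefE m; apply: vmax1.
Qed.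

(** At a root outside [V], division of p(x) = 0 by the top power of x would express the leading
    coefficient through positive powers of 1 / x. *)
Lemma root_vr p x : polyV p -> ~ M (lead_coef p) -> root p x -> V x.
Proof.
move=> Vp nMl /rootP px; apply: contrapT => nVx; apply: nMl.
have Mi := not_vr_inv nVx.
have x0 : x != 0 by apply/eqP => x0; apply: nVx; rewrite x0; exact: vr0.
case sp : (size p) => [|n].
  by move/eqP: sp; rewrite size_poly_eq0 => /eqP ->; rewrite lead_coef0; left.
rewrite lead_coefE sp /=.
have := congr1 ( *%R^~ (x^-1 ^+ n)) px; rewrite mul0r horner_coef sp big_ord_recr /=.
rewrite mulrDl -mulrA -exprMn divff // expr1n mulr1 => /eqP.
rewrite addrC addr_eq0 => /eqP ->; apply: vmaxN => //; rewrite mulr_suml.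
apply: vmax_sum => i _; rewrite -mulrA; apply: vmaxMl => //.
have -> : x ^+ i * x^-1 ^+ n = x^-1 ^+ (n - i).
  have -> : x^-1 ^+ n = x^-1 ^+ i * x^-1 ^+ (n - i).
    by rewrite -exprD subnKC // ltnW.
  by rewrite mulrA -exprMn divff // expr1n mul1r.
by apply: vmaxX => //; rewrite subn_gt0.
Qed.

(* A root of X g(X) - 1, where g has been truncated to have a unit as leading
   coefficient. *)
Lemma generic g : prim g -> exists2 x, V x & ~ M g.[x].
Proof.
move=> pg; have [g' [Vg' lg' Mg]] := prim_trunc pg.
have g'0 : g' != 0 by apply/eqP => g0; apply: lg'; rewrite g0 lead_coef0; left.
have sX : (1 < size ('X * g')%R)%N by rewrite mulrC size_mulX // ltnS size_poly_gt0.
pose h := 'X * g' - 1.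
have lh : lead_coef h = lead_coef g'.
  by rewrite /h lead_coefDl ?size_polyN ?size_poly1 // (mulrC 'X) lead_coefMX.
have sh : size h != 1.
  by rewrite /h size_polyDl ?size_polyN ?size_poly1 //; case: size sX => [|[]].
have /closed_rootP[x rx] := sh.
have Vx : V x.
  apply: (root_vr _ _ rx); last by rewrite lh.
  apply: polyVB; first by apply: polyVM => //; apply: polyVX.
  by apply: polyV_const; exact: vr1.
exists x => // Mgx; apply: (vmax1 HV).
move: rx => /rootP; rewrite /h !hornerE => /eqP; rewrite subr_eq0 => /eqP <-.
have -> : g'.[x] = g.[x] - (g - g').[x] by rewrite hornerD hornerN opprB addrC subrK.
by apply: vmaxMl => //; apply: vmaxB => //; apply: hornerM_max.
Qed.

(** The element sought is one of largest absolute value; it is what coefficients have to be divided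
    by to become primitive. *)
Lemma max_elt (l : seq F) : has (fun x => x != 0) l ->
  exists c, [/\ c \in l, c != 0 & forall y, y \in l -> V (y / c)].
Proof.
elim: l => //= a l IH; have [/IH[c [cl c0 cV]] _|hl] := boolP (has _ l).
  have [Vac|nVac] := pselect (V (a / c)).
    exists c; rewrite inE cl orbT; split=> // y; rewrite inE => /predU1P[->//|].
    exact: cV.
  have Vca : V (c / a) by case: (vr_total HV (a / c)) => //; rewrite invfM invrK mulrC.
  have a0 : a != 0 by apply/eqP => a0; apply: nVac; rewrite a0 mul0r; exact: vr0.
  exists a; rewrite inE eqxx; split=> // y; rewrite inE => /predU1P[->|yl].
    by rewrite divff //; exact: vr1.
  have -> : y / a = y / c * (c / a) by field; apply/andP.
  by apply: vrM => //; apply: cV.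
rewrite orbF => a0; exists a; rewrite inE eqxx; split=> // y.
rewrite inE => /predU1P[->|yl]; first by rewrite divff //; exact: vr1.
move: hl => /hasPn/(_ y yl); rewrite negbK => /eqP ->; rewrite mul0r; exact: vr0.
Qed.

Lemma scale_pair p q : p != 0 \/ q != 0 -> exists c,
  [/\ c != 0, polyV (c^-1 *: p), polyV (c^-1 *: q) &
      ~ (polyM (c^-1 *: p) /\ polyM (c^-1 *: q))].
Proof.
move=> pq0; have [|c [cl c0 cV]] := @max_elt (polyseq p ++ polyseq q).
  have aux (r : {poly F}) : r != 0 -> has (fun x => x != 0) r.
    move=> r0; apply/hasP; exists (lead_coef r); last by rewrite lead_coef_eq0.
    by rewrite lead_coefE mem_nth // -subn1 ltn_subrL size_poly_gt0 r0.
  by rewrite has_cat; apply/orP; case: pq0 => /aux; [left | right].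
have aux (r : {poly F}) : (forall y, y \in polyseq r -> V (y / c)) ->
    polyV (c^-1 *: r).
  move=> rV i; rewrite coefZ mulrC.
  have [ir|ri] := ltnP i (size r); first by apply: rV; apply: mem_nth.
  by rewrite nth_default // mul0r; exact: vr0.
exists c; split=> //.
- by apply: aux => y yp; apply: cV; rewrite mem_cat yp.
- by apply: aux => y yp; apply: cV; rewrite mem_cat yp orbT.
have aux2 (r : {poly F}) : c \in polyseq r -> ~ polyM (c^-1 *: r).
  move=> /(nthP 0)[i ir ci] /(_ i); rewrite coefZ ci mulVf //; exact: vmax1.
by move=> [Mp Mq]; move: cl; rewrite mem_cat => /orP[/aux2|/aux2]; apply.
Qed.

Lemma scale_prim p : p != 0 -> exists c, c != 0 /\ prim (c^-1 *: p).
Proof.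
move=> p0; have [|c [c0 Vp Vq nM]] := @scale_pair p p; first by left.
by exists c; split=> //; split=> // Mp; apply: nM.
Qed.

Lemma poly_roots p : polyV p -> ~ M (lead_coef p) ->
  exists2 r : seq F, p = lead_coef p *: \prod_(z <- r) ('X - z%:P) &
    forall z, z \in r -> V z.
Proof.
move=> Vp lp; have [r e] := closed_field_poly_normal p; exists r => // z zr.
apply: (root_vr Vp lp); rewrite e /root hornerZ horner_prod (big_rem z) //=.
by rewrite hornerXsubC subrr mul0r mulr0.
Qed.

Lemma nvmax_prod (r : seq F) (f : F -> F) :
  (forall z, z \in r -> V (f z)) -> ~ M (\prod_(z <- r) f z) <->
  forall z, z \in r -> ~ M (f z).
Proof.
elim: r => [|a r IH] Vf.
  by rewrite big_nil; split=> // _; apply: vmax1.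
have Va : V (f a) by apply: Vf; rewrite inE eqxx.
have {}Vf z : z \in r -> V (f z) by move=> zr; apply: Vf; rewrite inE zr orbT.
have {IH} := IH Vf; rewrite big_cons => IH.
have Vp : V (\prod_(z <- r) f z).
  rewrite big_seq; elim/big_ind: _ => //; first exact: vr1.
  by move=> *; apply: vrM.
split=> [nM z|nM].
  rewrite inE => /predU1P[->|zr]; first by move=> Ma; apply: nM; apply: vmaxMr.
  by apply: (proj1 IH) => // Mp; apply: nM; apply: vmaxMl.
apply: nvmaxM => //; first by apply: nM; rewrite inE eqxx.
by apply/IH => z zr; apply: nM; rewrite inE zr orbT.
Qed.

(** Far from the integers a polynomial with integral coefficients is governed by its coefficient of
    index n. *)
Lemma horner_vr_inv p x n : polyV p -> (size p <= n.+1)%N -> ~ V x ->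
  M (p.[x] / x ^+ n - p`_n).
Proof.
move=> Vp sp nVx; have Mi := not_vr_inv nVx.
have x0 : x != 0 by apply/eqP => x0; apply: nVx; rewrite x0; exact: vr0.
rewrite (horner_coef_wide _ sp) big_ord_recr /= mulrDl mulfK ?expf_neq0 //.
rewrite addrK mulr_suml; apply: vmax_sum => i _; rewrite -mulrA; apply: vmaxMl => //.
have -> : x ^+ i / x ^+ n = x^-1 ^+ (n - i).
  have -> : x ^+ n = x ^+ i * x ^+ (n - i) by rewrite -exprD subnKC // ltnW.
  by rewrite invfM mulrA divff ?mul1r ?exprVn // expf_neq0.
by apply: vmaxX => //; rewrite subn_gt0.
Qed.

End ValuedPolynomials.

(** * Lattes maps and non-singular points *)

Section Lattes.
Variables (F : closedFieldType) (V : set F).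
Hypothesis HV : valring V.
Local Notation M := (vmax V).
Implicit Types (A B p q g : {poly F}) (k : kummer F) (x y z s t u r : F).

(* A / B behaves like the map x(S) |-> x(f(S)) of an endomorphism f. *)
Definition lattes k A B := forall x y s t, x != y -> kum k x y s t ->
  B.[x] != 0 -> B.[y] != 0 -> B.[s] != 0 -> B.[t] != 0 ->
  kum k (A.[x] / B.[x]) (A.[y] / B.[y]) (A.[s] / B.[s]) (A.[t] / B.[t]).

(* The reduction of A / B is not a constant other than infinity. *)
Definition nonconst A B := forall z, V z -> ~ polyM V (A - z *: B).

(* The singular point is a node: c2 k + 12 x is the value of b2 after x has been
   moved to the origin. *)
Definition semistable k := forall x, sing V k x -> ~ M (c2 k + 12 * x).

Lemma kum_exists k x y : x != y -> exists s t, kum k x y s t.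
Proof.
rewrite -subr_eq0 => xy0; pose D := (x - y) ^+ 2.
have D0 : D != 0 by rewrite expf_neq0.
pose q := 'X^2 - (kU k x y / D) *: 'X + (kV k x y / D)%:P.
have sq : size q = 3.
  rewrite /q -addrA size_polyDl size_polyXn // ltnS.
  rewrite (leq_trans (size_polyD _ _)) // geq_max size_polyN.
  rewrite (leq_trans (size_scale_leq _ _)) ?size_polyX //=.
  by rewrite (leq_trans (size_polyC_leq1 _)).
have /closed_rootP[s /rootP] : size q != 1 by rewrite sq.
rewrite /q !hornerE => es; exists s, (kU k x y / D - s).
split; rewrite -/D; last by field.
have -> : D * (s * (kU k x y / D - s)) = kV k x y - D * (s ^+ 2 - kU k x y / D * s + kV k x y / D).
  by field.
by rewrite es mulr0 subr0.
Qed.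

(** A non-integral y means that T reduces to O, so S + T and S - T reduce to the same point as S. *)
Lemma kum_near k x y s t : kint V k -> V x -> ~ V y -> kum k x y s t ->
  M (s - x) /\ M (t - x).
Proof.
move=> ki Vx nVy /kum_shift-/(_ x); rewrite subrr.
have := kint_shift HV Vx ki; move: (kshift x k) => {}k {}ki.
have {nVy} nVy : ~ V (y - x).
  by move=> Vyx; apply: nVy; rewrite -(subrK x y); apply: vrD.
move: (y - x) nVy (s - x) (t - x) => {s t} {}y nVy s t [e1 e2].
have My := not_vr_inv nVy; have [V2 V4 V6 V8] := ki.
have y0 : y != 0 by apply/eqP => y0; apply: nVy; rewrite y0; exact: vr0.
have key s' t' : (0 - y) ^+ 2 * (s' * t') = kV k 0 y ->
    (0 - y) ^+ 2 * (s' + t') = kU k 0 y -> M s'.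
  move=> f1 f2; apply: (@vmax_quad _ _ HV (c4 k * y^-1 + c6 k * y^-1 ^+ 2)
    (c6 k * y^-1 + c8 k * y^-1 ^+ 2)); [by vm_solve HV..|].
  have -> : s' ^+ 2 = (y^-1 ^+ 2 * ((0 - y) ^+ 2 * (s' + t'))) * s'
      - y^-1 ^+ 2 * ((0 - y) ^+ 2 * (s' * t')) by field.
  by rewrite f1 f2 /kV /kU; field.
by split; [apply: (key s t) | apply: (key t s); rewrite // 1?(mulrC t) 1?(addrC t)].
Qed.

Lemma kum_vr k x y s t : kint V k -> V x -> V y -> ~ M (x - y) ->
  kum k x y s t -> V s /\ V t.
Proof.
move=> [V2 V4 V6 V8] Vx Vy nM [e1 e2].
have [d0 Vd] := vunit (vrB HV Vx Vy) nM.
have key s' t' : (x - y) ^+ 2 * (s' * t') = kV k x y ->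
    (x - y) ^+ 2 * (s' + t') = kU k x y -> V s'.
  move=> f1 f2; apply: (@vr_quad _ _ HV ((x - y)^-1 ^+ 2 * kU k x y)
    (- ((x - y)^-1 ^+ 2 * kV k x y))); [by rewrite /kU /kV; vr_solve HV..|].
  by rewrite -f1 -f2; field.
by split; [apply: (key s t) | apply: (key t s); rewrite // 1?(mulrC t) 1?(addrC t)].
Qed.

(** Not only x but also s and t have to avoid the roots z of g modulo [M]. By the symmetry of the
    Kummer relation, s or t is close to z only if x is close to a root of the quadratic polynomial
    [q z] attached to y and z. As y is non-singular, [q z] is primitive, so these conditions are
    again met by a generic x. *)
Lemma generic_kum k y g : kwf k -> kint V k -> V y -> ~ sing V k y -> prim V g ->
  exists x s t, [/\ V x, V s & V t] /\ [/\ ~ M (x - y), kum k x y s t,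
    ~ M g.[x], ~ M g.[s] & ~ M g.[t]].
Proof.
move=> wf ki Vy ny pg; have [V2 V4 V6 V8] := ki; have [Vg _] := pg.
have [g' [Vg' lg' Mg]] := prim_trunc HV pg.
have [r er Vr] := poly_roots HV Vg' lg'.
pose q z := ((y - z) ^+ 2)%:P * 'X^2 - (kU k y z)%:P * 'X + (kV k y z)%:P.
have hq z x : (q z).[x] = (y - z) ^+ 2 * x ^+ 2 - kU k y z * x + kV k y z.
  by rewrite /q !hornerE.
have pq z : V z -> prim V (q z).
  move=> Vz; split.
    move=> i; rewrite /q !coefD coefN !coefCM coefXn coefX coefC; case: (i == 0)%N;
      rewrite /kU /kV; vr_solve HV.
  move=> Mq; have q2 : (q z)`_2 = (y - z) ^+ 2.
    by rewrite /q !coefD coefN !coefCM coefXn coefX coefC /=; ring.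
  have q1 : (q z)`_1 = - kU k y z.
    by rewrite /q !coefD coefN !coefCM coefXn coefX coefC /=; ring.
  have q0 : (q z)`_0 = kV k y z.
    by rewrite /q !coefD coefN !coefCM coefXn coefX coefC /=; ring.
  have Myz : M (y - z).
    by apply: (@vmaxX_inv _ _ HV _ 2); [apply: vrB | rewrite -q2].
  have nz : ~ sing V k z.
    by move=> sz; apply: ny; apply/(sing_iff HV _ wf ki sz).
  have [_ _ _] := nonsing_content HV ki ny nz; rewrite (hgtV Vy) (hgtV Vz).
  rewrite !expr1n mulr1 !divr1; apply; rewrite -q2 -q0; split=> //.
  by rewrite -(opprK (kU k y z)) -q1; apply: vmaxN.
pose gg := g * ('X - y%:P) * \prod_(z <- r) q z.
have pgg : prim V (g * ('X - y%:P) * \prod_(z <- r | z \in r) q z).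
  apply: primM => //.
    apply: primM => //; apply: prim_monic => //; last exact: monicXsubC.
    by apply: polyVB; [|apply: polyVX | apply: polyV_const].
  elim/big_ind: _ => //; last 2 first.
  - by move=> *; apply: primM.
  - by move=> z /Vr; exact: pq.
  by apply: prim_monic => //; [apply: polyV_const => //; exact: vr1 | exact: monic1].
have [x Vx ngx] := generic HV pgg; rewrite -big_seq in ngx.
have Vq z : V z -> V (q z).[x].
  by move=> /pq[Vq _]; apply: hornerV.
have [ng nxy nqx] : [/\ ~ M g.[x], ~ M (x - y) & forall z, z \in r -> ~ M (q z).[x]].
  move: ngx; rewrite !hornerM hornerXsubC horner_prod => nm.
  have Vgx := hornerV HV Vg Vx; have Vxy := vrB HV Vx Vy.
  have Vpr : V (\prod_(z <- r) (q z).[x]).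
    rewrite big_seq; elim/big_ind: _ => //; first exact: vr1.
      by move=> *; apply: vrM.
    by move=> z /Vr /Vq.
  split.
  - by move=> Mm; apply: nm; do 2!apply: vmaxMr => //.
  - by move=> Mm; apply: nm; apply: vmaxMr => //; apply: vmaxMl.
  - apply/(nvmax_prod HV) => [z /Vr /Vq //|Mm].
    by apply: nm; apply: vmaxMl => //; apply: vrM.
have xy : x != y by rewrite -subr_eq0; apply/eqP => e; apply: nxy; rewrite e; left.
have [s [t kst]] := kum_exists k xy.
have [Vs Vt] := kum_vr ki Vx Vy nxy kst.
have key s' t' : V s' -> V t' -> kum k x y s' t' -> ~ M g.[s'].
  move=> Vs' Vt' k' Mgs.
  have : M g'.[s'].
    have -> : g'.[s'] = g.[s'] - (g - g').[s'].
      by rewrite hornerD hornerN opprB addrC subrK.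
    by apply: vmaxB => //; apply: hornerM_max.
  rewrite er hornerZ horner_prod => Mp.
  have Vp z : z \in r -> V ('X - z%:P).[s'].
    by move=> /Vr Vz; rewrite hornerXsubC; apply: vrB.
  have Vl : V (lead_coef g') by rewrite lead_coefE.
  have Vpr : V (\prod_(z <- r) ('X - z%:P).[s']).
    rewrite big_seq; elim/big_ind: _ => //; first exact: vr1.
    by move=> *; apply: vrM.
  case: (vmax_prime HV Vl Vpr Mp) => //; apply/(nvmax_prod HV Vp).
  move=> z zr; rewrite hornerXsubC => Mz; apply: (nqx z zr); rewrite hq.
  rewrite (kum_sym z (kumC k')); have -> : (y - x) ^+ 2 * (z - s') * (z - t') =
    (s' - z) * (- (x - y) ^+ 2 * (z - t')) by ring.
  have Vz := Vr z zr; vm_solve HV.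
exists x, s, t; split=> //; split=> //; first exact: key kst.
by apply: (key t s) => //; apply: kum_swap.
Qed.

(** Here y is generic too. To apply [generic_kum] it has to be non-singular, which is one more open
    condition because [phi2] is a monic quartic. *)
Lemma generic_kum4 k g : kwf k -> kint V k -> prim V g ->
  exists x y s t, [/\ V x, V y, V s & V t] /\ [/\ x != y, kum k x y s t &
    [/\ ~ M g.[x], ~ M g.[y], ~ M g.[s] & ~ M g.[t]]].
Proof.
move=> wf ki pg; have [V2 V4 V6 V8] := ki; have [Vg _] := pg.
pose f : {poly F} := 'X^4 - (c4 k *: 'X^2 + (2 * c6 k) *: 'X + (c8 k)%:P).
have sf : (size (c4 k *: 'X^2 + (2 * c6 k) *: 'X + (c8 k)%:P)%R < 5)%N.
  rewrite ltnS; apply/leq_sizeP => j j4.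
  by rewrite !coefD !coefZ coefXn coefX coefC; case: j j4 => [|[|[|j]]] //= _; ring.
have pf : prim V f.
  apply: prim_monic => //.
    move=> i; rewrite coefB !coefD !coefZ coefX !coefXn coefC; case: (i == 0)%N; vr_solve HV.
  by apply/monicP; rewrite lead_coefDl ?size_polyN ?size_polyXn // lead_coefXn.
have hf y : f.[y] = phi2 k y.
  by rewrite /f !(hornerD, hornerN, hornerZ, hornerXn, hornerX, hornerC) /phi2; ring.
have [y Vy] := generic HV (primM HV pg pf); rewrite hornerM hf => nM.
have ny : ~ sing V k y.
  by move=> [_ _ Mf]; apply: nM; apply: vmaxMl => //; apply: hornerV.
have [x [s [t [[Vx Vs Vt] [nxy kk gx gs gt]]]]] := generic_kum wf ki Vy ny pg.
exists x, y, s, t; split=> //; split=> //.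
  by apply/eqP => e; apply: nxy; rewrite e subrr; left.
by split=> // Mg; apply: nM; apply: vmaxMr => //; apply: kint_phi2.
Qed.

Lemma nvmax_neq0 x : ~ M x -> x != 0.
Proof. by move=> nM; apply/eqP => e; apply: nM; left. Qed.

Lemma horner_subZ A B z x : (A - z *: B).[x] = A.[x] - z * B.[x].
Proof. by rewrite hornerD hornerN hornerZ. Qed.

Lemma polyV_subZ A B z : polyV V A -> polyV V B -> V z -> polyV V (A - z *: B).
Proof. by move=> VA VB Vz; apply: polyVB => //; apply: polyVZ. Qed.

(** A constant reduction z puts the images of four generic points together, so modulo [M] the
    quadruple (z, z, z, z) satisfies the Kummer relation. With z at the origin this says that [c6]
    and [c8] lie in [M]. *)
Lemma const_sing k A B z : kwf k -> kint V k -> lattes k A B ->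
  polyV V A -> prim V B -> V z -> polyM V (A - z *: B) -> sing V k z.
Proof.
move=> wf ki lat VA pB Vz Mz; have [VB _] := pB.
have [x [y [s [t [[Vx Vy Vs Vt] [xy kk [nx ny ns nt]]]]]]] := generic_kum4 wf ki pB.
have := lat _ _ _ _ xy kk (nvmax_neq0 nx) (nvmax_neq0 ny) (nvmax_neq0 ns) (nvmax_neq0 nt).
have key w : V w -> ~ M B.[w] -> M (A.[w] / B.[w] - z).
  move=> Vw nw; have B0 := nvmax_neq0 nw.
  have -> : A.[w] / B.[w] - z = (A - z *: B).[w] / B.[w].
    by rewrite horner_subZ; field.
  by apply: vmax_divu => //; [apply: hornerV | apply: hornerM_max].
move: (key x Vx nx) (key y Vy ny) (key s Vs ns) (key t Vt nt).
move: (A.[x] / _) (A.[y] / _) (A.[s] / _) (A.[t] / _) => a b a' b' Ma Mb Ma' Mb'.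
move=> /kum_shift-/(_ z); rewrite -(sing_shift HV _ ki Vz) subrr.
have := kint_shift HV Vz ki; move: (kshift z k) => {wf lat kk Mz key} {}k {}ki.
move: (a - z) (b - z) (a' - z) (b' - z) Ma Mb Ma' Mb' => {}a {}b {}a' {}b' Ma Mb Ma' Mb'.
have [V2 V4 V6 V8] := ki; move=> [e1 e2].
have M6 : M (c6 k).
  have -> : c6 k = kU k a b - (2 * a * b * (a + b) + c2 k * a * b + c4 k * (a + b)).
    by rewrite /kU; ring.
  by rewrite -e2; vm_solve HV.
split; first exact: vr0.
  by have -> : psi2 k 0 = c6 k by rewrite /psi2; ring.
have -> : phi2 k 0 = kV k a b - (a ^+ 2 * b ^+ 2 - c4 k * a * b - c6 k * (a + b)).
  by rewrite /phi2 /kV; ring.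
by rewrite -e1; vm_solve HV.
Qed.

(** At a node the singular point of the reduction can be lifted so that [c4] vanishes exactly; this
    is a Hensel argument, carried out with roots in the algebraically closed field. *)
Lemma sing_node k z : kwf k -> kint V k -> sing V k z -> ~ M (c2 k + 12 * z) ->
  exists2 r, M (r - z) & c4 (kshift r k) = 0.
Proof.
move=> wf ki sz n2; have [Vz _ _] := sz.
have [|||m4 m6 m8] := @sing0_coef _ _ HV (kshift z k).
- exact: kwf_shift.
- exact: kint_shift.
- by rewrite -(subrr z) sing_shift.
pose c := c2 k + 12 * z; have [d ed] : exists d, d = c4 (kshift z k) by eexists.
have ec4 : c4 k = d - z * c2 k - 6 * z ^+ 2 by rewrite ed /=; ring.
rewrite -ed in m4.
have [V2 V4 V6 V8] := ki.
have Vc : V c by rewrite /c; vr_solve HV.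
(* A shift by delta turns d into d + c delta + 6 delta^2. With delta = d / w this vanishes when w^2
   + c w + 6 d = 0, an equation that is monic in every characteristic. Its roots have sum - c, a
   unit, and product in [M], so one of them is a unit. *)
pose q : {poly F} := 'X^2 + c *: 'X + (6 * d)%:P.
have sq : size q = 3.
  rewrite /q -addrA size_polyDl size_polyXn // ltnS.
  rewrite (leq_trans (size_polyD _ _)) // geq_max.
  rewrite (leq_trans (size_scale_leq _ _)) ?size_polyX //=.
  by rewrite (leq_trans (size_polyC_leq1 _)).
have /closed_rootP[w0 /rootP] : size q != 1 by rewrite sq.
rewrite /q !hornerE => e0.
have main w : ~ M w -> V w -> w ^+ 2 + c * w + 6 * d = 0 ->
    exists2 r, M (r - z) & c4 (kshift r k) = 0.
  move=> nw Vw e; have [w1 Vw1] := vunit Vw nw; exists (z + d / w).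
    by rewrite addrAC subrr add0r; apply: vmaxMr.
  have -> : c4 (kshift (z + d / w) k) = d / w ^+ 2 * (w ^+ 2 + c * w + 6 * d).
    by rewrite /= ec4 /c; field.
  by rewrite e mulr0.
have Vd : V d by apply: vmax_sub.
have Vw0 : V w0.
  by apply: (@vr_quad _ _ HV (- c) (- (6 * d))); [vr_solve HV..|]; apply/eqP;
     rewrite -subr_eq0 -e0; apply/eqP; ring.
have [Mw|nw] := pselect (M w0); last exact: main e0.
apply: (main (- c - w0)); last by rewrite -e0; ring.
  move=> Mm; apply: n2; rewrite -/c; have -> : c = - ((- c - w0) + w0) by ring.
  by vm_solve HV.
by vr_solve HV.
Qed.

(** If the constant is the node, centre the coordinate at the lift r with [c4] zero. Then A / B - r
    equals al times a unit at generic points, with al in [M]. Comparing powers of al, the product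
    equation makes [c8] divisible by al^4, after which the sum equation has the single dominant term
    [c2] a b, a unit. *)
Lemma semistable_nonconst k A B : kwf k -> kint V k -> semistable k ->
  lattes k A B -> polyV V A -> prim V B -> (forall z, A != z *: B) ->
  nonconst A B.
Proof.
move=> wf ki ss lat VA pB nc z Vz Mz; have [VB nMB] := pB.
have sz := const_sing wf ki lat VA pB Vz Mz.
have n2 := ss z sz; have [r Mr e4] := sing_node wf ki sz n2.
have Vr : V r by rewrite -(subrK z r); apply: vrD => //; apply: vmax_sub.
have MA : polyM V (A - r *: B).
  have -> : A - r *: B = (A - z *: B) + (z - r)%:P * B by rewrite mul_polyC scalerBl addrA subrK.
  apply: polyMD => //; apply: polyMM => // i; rewrite coefC; case: ifP => _; last by left.
  by rewrite -opprB; apply: vmaxN.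
have A0 : A - r *: B != 0 by rewrite subr_eq0.
have [al [al0 pA]] := scale_prim HV A0; have [VA1 nMA1] := pA.
have Mal : M al.
  apply: contrapT => nal; apply: nMA1 => i; rewrite coefZ mulrC.
  apply: contrapT => nM; apply: nM; case: (vr_total HV al) => Va.
    by apply: vmax_divu.
  by apply: vmaxMr.
have pg := primM HV pB pA.
have [x [y [s [t [[Vx Vy Vs Vt] [xy kk [nx ny ns nt]]]]]]] := generic_kum4 wf ki pg.
set A1 := al^-1 *: (A - r *: B) in pA VA1 nMA1 pg nx ny ns nt.
have key w : V w -> ~ M (B * A1).[w] -> B.[w] != 0 /\
    exists e, [/\ V e, ~ M e & A.[w] / B.[w] - r = al * e].
  rewrite hornerM => Vw nw; have VBw := hornerV HV VB Vw.
  have VAw := hornerV HV VA1 Vw.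
  have nB : ~ M B.[w] by move=> Mm; apply: nw; apply: vmaxMr.
  have nA : ~ M A1.[w] by move=> Mm; apply: nw; apply: vmaxMl.
  have B0 := nvmax_neq0 nB; split=> //; exists (A1.[w] / B.[w]); split.
  - exact: vr_divu.
  - move=> Mm; apply: nA; rewrite -(divfK B0 A1.[w]); exact: vmaxMr.
  - rewrite /A1 hornerZ horner_subZ; field.
    by apply/andP; split.
have [Bx [a [Va na ea]]] := key x Vx nx; have [By [b [Vb nb eb]]] := key y Vy ny.
have [Bs [a' [Va' na' ea']]] := key s Vs ns; have [Bt [b' [Vb' nb' eb']]] := key t Vt nt.
have := lat _ _ _ _ xy kk Bx By Bs Bt; move=> /kum_shift-/(_ r).
rewrite ea eb ea' eb'; have wf' := kwf_shift r wf.
have Vc2 : V (c2 (kshift r k)) by have [? _ _ _] := kint_shift HV Vr ki.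
have nc2 : ~ M (c2 (kshift r k)).
  rewrite /= => Mm; apply: n2.
  have -> : c2 k + 12 * z = c2 k + 12 * r - 12 * (r - z) by ring.
  by apply: vmaxB => //; apply: vmaxMl => //; exact: vrn.
have [c0 Vci] := vunit Vc2 nc2.
move: (kshift r k) wf' e4 Vc2 nc2 c0 Vci => k' wf' e4 Vc2 nc2 c0 Vci [e1 e2].
rewrite /kwf e4 in wf'; rewrite /kU e4 in e2; rewrite /kV e4 in e1.
have e6 : c6 k' = 4 * c8 k' / c2 k' by rewrite wf'; field.
(* All four coordinates are of the exact order of al, so al^4 is the order of both sides of the
   product equation; [E1] then shows that m is integral. *)
pose m := c8 k' / al ^+ 4; have em : c8 k' = m * al ^+ 4 by rewrite /m; field.
have E1 : m * (1 + 4 / c2 k' * al * (a + b)) =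
    a ^+ 2 * b ^+ 2 - (a - b) ^+ 2 * (a' * b').
  have al4 : al ^+ 4 != 0 by rewrite expf_neq0.
  apply: (mulfI al4); rewrite mulrBr.
  have -> : al ^+ 4 * ((a - b) ^+ 2 * (a' * b')) =
     (al * a - al * b) ^+ 2 * (al * a' * (al * b')) by ring.
  by rewrite e1 e6 em; field.
have E2 : c2 k' * a * b = al * ((a - b) ^+ 2 * (a' + b') - 2 * a * b * (a + b))
    - 4 / c2 k' * m * al ^+ 2.
  have al2 : al ^+ 2 != 0 by rewrite expf_neq0.
  apply: (mulfI al2); rewrite mulrBr.
  have -> : al ^+ 2 * (al * ((a - b) ^+ 2 * (a' + b') - 2 * a * b * (a + b))) =
     (al * a - al * b) ^+ 2 * (al * a' + al * b') - al ^+ 3 * (2 * a * b * (a + b)) by ring.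
  by rewrite e2 e6 em; field.
have un : ~ M (1 + 4 / c2 k' * al * (a + b)).
  by apply: (nvmaxDl HV); [vm_solve HV | exact: vmax1].
have Vun : V (1 + 4 / c2 k' * al * (a + b)) by vr_solve HV.
have [u0 _] := vunit Vun un.
have Vm : V m.
  rewrite -(mulfK u0 m) E1; apply: vr_divu => //; vr_solve HV.
have : ~ M (c2 k' * a * b) by apply: nvmaxM => //; [apply: vrM | apply: nvmaxM].
by apply; rewrite E2; vm_solve HV.
Qed.

End Lattes.

(** * Lattes maps with non-constant reduction, and the existence of semistable models *)

Section LattesReduction.
Variables (F : closedFieldType) (V : set F).
Hypothesis HV : valring V.
Local Notation M := (vmax V).
Implicit Types (A B p q g : {poly F}) (k : kummer F) (x y z s t u r : F).

Lemma polyM_or_prim p : polyV V p -> polyM V p \/ prim V p.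
Proof. by move=> Vp; have [|nM] := pselect (polyM V p); [left | right]. Qed.

Lemma nonconst_prim A B : polyV V A -> polyV V B -> nonconst V A B ->
  prim V A /\ forall z, V z -> prim V (A - z *: B).
Proof.
move=> VA VB nc; split.
  by split=> // MA; apply: (nc 0); [exact: vr0 | rewrite scale0r subr0].
by move=> z Vz; split; [apply: polyV_subZ | apply: nc].
Qed.

(* If R reduces to the constant infinity, then generic points have
   non-integral images, and so does every point by the addition relation. *)
Lemma polyM_denominator k A B : kint V k -> lattes k A B -> prim V A ->
  polyM V B -> B != 0 ->
  exists2 g, prim V g & forall x y s t, V x -> V s -> x != y -> kum k x y s t ->
    ~ M g.[x] -> ~ M g.[s] -> ~ M g.[t] -> B.[y] != 0 -> ~ V (A.[y] / B.[y]).
Proof.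
move=> ki lat pA MB B0; have [b [b0 pB]] := scale_prim HV B0.
have [VA _] := pA; have [VB1 _] := pB.
exists (A * (b^-1 *: B)); first exact: primM.
move=> x y s t Vx Vs xy kk nx ns nt By VRy.
have B0w w : ~ M (A * (b^-1 *: B)).[w] -> B.[w] != 0.
  rewrite hornerM hornerZ => nm; apply/eqP => e; apply: nm.
  by rewrite e !mulr0; left.
have key w : V w -> ~ M (A * (b^-1 *: B)).[w] -> ~ V (A.[w] / B.[w]).
  move=> Vw nw VR; have Bw := B0w w nw; apply: nw.
  rewrite hornerM; apply: vmaxMr => //; last by apply: hornerV.
  by rewrite -(divfK Bw A.[w]); apply: vmaxMl => //; apply: hornerM_max.
have kk' := kumC (lat _ _ _ _ xy kk (B0w _ nx) By (B0w _ ns) (B0w _ nt)).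
have [Ma _] := kum_near HV ki VRy (key x Vx nx) kk'.
apply: (key s Vs ns); rewrite -(subrK (A.[y] / B.[y]) (A.[s] / B.[s])).
by apply: vrD => //; apply: vmax_sub.
Qed.

(** Suppose the image b of y is integral. Adding and subtracting a point near O moves x very little,
    so the images of x, s and t nearly coincide. Hence the image a of x nearly satisfies a quartic
    equation depending only on b, which leaves finitely many values of a modulo [M]. A generic x
    avoids them because the reduction of A / B is not constant. *)
Lemma lattes_pole k A B : kwf k -> kint V k -> lattes k A B ->
  polyV V A -> polyV V B -> nonconst V A B ->
  forall y, ~ V y -> B.[y] != 0 -> ~ V (A.[y] / B.[y]).
Proof.
move=> wf ki lat VA VB nc y nVy By; have [pA pAB] := nonconst_prim VA VB nc.
have [V2 V4 V6 V8] := ki.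
have xy x : V x -> x != y by move=> Vx; apply/eqP => e; apply: nVy; rewrite -e.
have near x s t : V x -> kum k x y s t -> [/\ M (s - x), M (t - x), V s & V t].
  move=> Vx kk; have [Ms Mt] := kum_near HV ki Vx nVy kk; split=> //.
    by rewrite -(subrK x s); apply: vrD => //; apply: vmax_sub.
  by rewrite -(subrK x t); apply: vrD => //; apply: vmax_sub.
have gen g : prim V g -> exists x s t, [/\ [/\ V x, V s & V t], kum k x y s t,
    ~ M g.[x], ~ M g.[s] & ~ M g.[t]] /\ M (s - x) /\ M (t - x).
  move=> pg; have [x Vx nx] := generic HV pg; have [Vg _] := pg.
  have [s [t kk]] := kum_exists k (xy x Vx); have [Ms Mt Vs Vt] := near _ _ _ Vx kk.
  exists x, s, t; split=> //; split=> //.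
    rewrite -(subrK g.[x] g.[s]) addrC; apply: (nvmaxDl HV) nx.
    exact: (horner_cong HV).
  rewrite -(subrK g.[x] g.[t]) addrC; apply: (nvmaxDl HV) nx.
  exact: (horner_cong HV).
have [MB|pB] := polyM_or_prim VB.
  have B0 : B != 0 by apply/eqP => e; move: By; rewrite e horner0 eqxx.
  have [g pg gP] := polyM_denominator ki lat pA MB B0.
  have [x [s [t [[[Vx Vs Vt] kk nx ns nt] _]]]] := gen g pg.
  exact: (gP x y s t Vx Vs (xy x Vx)).
move=> VRy; set b := A.[y] / B.[y] in VRy.
(* The quartic [phi2] - b [psi2]: it is [kum_sym] with the third point equal to the first. It is
   monic, so its roots are integral. *)
pose f : {poly F} := 'X^4 - ((4 * b) *: 'X^3 + (c4 k + b * c2 k) *: 'X^2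
  + (2 * c6 k + 2 * b * c4 k) *: 'X + (c8 k + b * c6 k)%:P).
have sf : (size ((4 * b) *: 'X^3 + (c4 k + b * c2 k) *: 'X^2
  + (2 * c6 k + 2 * b * c4 k) *: 'X + (c8 k + b * c6 k)%:P)%R < 5)%N.
  rewrite ltnS; apply/leq_sizeP => j j4.
  by rewrite !coefD !coefZ !coefXn coefX coefC; case: j j4 => [|[|[|[|j]]]] //= _; ring.
have Vf : polyV V f.
  move=> i; rewrite coefB !coefD !coefZ coefX !coefXn coefC; case: (i == 0)%N; vr_solve HV.
have lf : lead_coef f = 1 by rewrite lead_coefDl ?size_polyN ?size_polyXn // lead_coefXn.
have hf w : f.[w] = phi2 k w - b * psi2 k w.
  rewrite /f !(hornerD, hornerN, hornerZ, hornerXn, hornerX, hornerC) /phi2 /psi2.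
  ring.
have [|r er Vr] := poly_roots HV Vf; first by rewrite lf; apply: vmax1.
rewrite lf scale1r in er.
have pg : prim V (B * \prod_(z <- r | z \in r) (A - z *: B)).
  apply: primM => //; elim/big_ind: _ => [|p q|z /Vr /pAB //].
    by apply: prim_monic => //; [apply: polyV_const => //; exact: vr1 | exact: monic1].
  exact: primM.
rewrite -big_seq in pg.
have [x [s [t [[[Vx Vs Vt] kk nx ns nt] [Ms Mt]]]]] := gen _ pg.
rewrite !hornerM in nx ns nt.
have VABp w : V w -> V (\prod_(z <- r) (A - z *: B)).[w].
  move=> Vw; rewrite horner_prod big_seq; elim/big_ind: _ => //; first exact: vr1.
    by move=> *; apply: vrM.
  by move=> z /Vr Vz; apply: hornerV => //; apply: polyV_subZ.
have nB w : V w -> ~ M (B.[w] * (\prod_(z <- r) (A - z *: B)).[w]) -> ~ M B.[w].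
  by move=> Vw nm Mm; apply: nm; apply: vmaxMr => //; apply: VABp.
have [nBx nBs nBt] := And3 (nB _ Vx nx) (nB _ Vs ns) (nB _ Vt nt).
have [Bx0 Bs0 Bt0] := And3 (nvmax_neq0 nBx) (nvmax_neq0 nBs) (nvmax_neq0 nBt).
have kk' := lat _ _ _ _ (xy x Vx) kk Bx0 By Bs0 Bt0.
set a := A.[x] / B.[x] in kk'.
have VR w : V w -> ~ M B.[w] -> V (A.[w] / B.[w]).
  by move=> Vw nw; apply: vr_divu => //; apply: hornerV.
have Mc : M (a - A.[s] / B.[s]).
  have -> : a - A.[s] / B.[s] =
    (A.[x] * (B.[s] - B.[x]) - (A.[s] - A.[x]) * B.[x]) / B.[x] / B.[s].
    by rewrite /a; field; apply/andP.
  have VAx := hornerV HV VA Vx; have VBx := hornerV HV VB Vx.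
  have VBs := hornerV HV VB Vs.
  apply: vmax_divu => //; apply: vmax_divu => //; apply: vmaxB => //.
    by apply: vmaxMl => //; apply: horner_cong.
  by apply: vmaxMr => //; apply: horner_cong.
have Va : V a by apply: VR.
have : M f.[a].
  have -> : f.[a] = (a - b) ^+ 2 * (a - A.[s] / B.[s]) * (a - A.[t] / B.[t]).
    rewrite hf -(kum_sym a kk') -/b subrr expr0n mul0r add0r /kU /kV /phi2 /psi2.
    ring.
  have VRt := VR t Vt nBt; apply: vmaxMr => //; last exact: vrB.
  by apply: vmaxMl => //; apply: vrX => //; apply: vrB.
rewrite er horner_prod; apply/(nvmax_prod HV) => [z /Vr Vz|z zr].
  by rewrite hornerXsubC; apply: vrB.
rewrite hornerXsubC => Maz; apply: nx; apply: vmaxMl => //; first exact: hornerV.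
rewrite horner_prod; apply: contrapT => nM; move: zr Maz.
have /(nvmax_prod HV)[+ _] : forall z, z \in r -> V (A - z *: B).[x].
  by move=> z' /Vr Vz; apply: hornerV => //; apply: polyV_subZ.
move=> /(_ nM z) nz /nz {}nz Maz; apply: nz.
have -> : (A - z *: B).[x] = B.[x] * (a - z) by rewrite horner_subZ /a; field.
by apply: vmaxMl => //; apply: hornerV.
Qed.

(** If y were sent to the singular point b while a generic x is not, then [sing_add] would send s to
    a singular point, hence to b modulo [M]. But s is generic as well. *)
Lemma lattes_nonsing_integral k A B : kwf k -> kint V k -> lattes k A B ->
  polyV V A -> polyV V B -> nonconst V A B ->
  forall y, V y -> ~ sing V k y -> B.[y] != 0 -> ~ sing V k (A.[y] / B.[y]).
Proof.
move=> wf ki lat VA VB nc y Vy ny By sb; have [pA pAB] := nonconst_prim VA VB nc.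
have [VRy _ _] := sb; set b := A.[y] / B.[y] in sb VRy.
have neq x : ~ M (x - y) -> x != y.
  by move=> nxy; apply/eqP => e; apply: nxy; rewrite e subrr; left.
have [MB|pB] := polyM_or_prim VB.
  have B0 : B != 0 by apply/eqP => e; move: By; rewrite e horner0 eqxx.
  have [g pg gP] := polyM_denominator ki lat pA MB B0.
  have [x [s [t [[Vx Vs Vt] [nxy kk nx ns nt]]]]] := generic_kum HV wf ki Vy ny pg.
  exact: (gP x y s t Vx Vs (neq _ nxy)).
have pg := primM HV pB (pAB b VRy).
have [x [s [t [[Vx Vs Vt] [nxy kk nx ns nt]]]]] := generic_kum HV wf ki Vy ny pg.
rewrite !hornerM !horner_subZ in nx ns nt.
have key w : V w -> ~ M (B.[w] * (A.[w] - b * B.[w])) ->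
    B.[w] != 0 /\ ~ M (A.[w] / B.[w] - b).
  move=> Vw nw; have B0 : B.[w] != 0.
    by apply/eqP => e; apply: nw; rewrite e mul0r; left.
  split=> // Mm; apply: nw.
  have -> : B.[w] * (A.[w] - b * B.[w]) = B.[w] ^+ 2 * (A.[w] / B.[w] - b) by field.
  by apply: vmaxMl => //; apply: vrX => //; apply: hornerV.
have [[Bx na] [Bs ns'] [Bt nt']] := And3 (key _ Vx nx) (key _ Vs ns) (key _ Vt nt).
have kk' := kumC (lat _ _ _ _ (neq _ nxy) kk Bx By Bs Bt).
rewrite -!(sing_iff HV _ wf ki sb) in na ns' nt'.
by have [/ns'] := sing_add HV wf ki sb na kk'.
Qed.

(* All roots of A and A - B are integral, hence A and B are, up to scaling by
   the leading coefficient of A. *)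
Lemma lattes_expand A B : (size B < size A)%N ->
  (forall x, A.[x] = 0 -> B.[x] != 0) ->
  (forall y, ~ V y -> B.[y] != 0 -> ~ V (A.[y] / B.[y])) ->
  forall y, ~ V y -> A.[y] != 0 /\ V (y * (B.[y] / A.[y])).
Proof.
move=> sBA cop pole y nVy.
have rootV z p : V z -> p = A - z *: B -> polyV V ((lead_coef A)^-1 *: p).
  move=> Vz ->; have lA : lead_coef (A - z *: B) = lead_coef A.
    by rewrite lead_coefDl // size_polyN (leq_ltn_trans (size_scale_leq _ _)).
  have A0 : A != 0 by rewrite -size_poly_gt0; apply: leq_ltn_trans sBA.
  have [r er] := closed_field_poly_normal (A - z *: B).
  rewrite lA in er; rewrite er scalerA mulVf ?lead_coef_eq0 // scale1r.
  suff Vr w : w \in r -> V w.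
    rewrite big_seq; elim/big_ind: _ => [|p1 q1|w /Vr Vw].
    - by apply: polyV_const => //; exact: vr1.
    - exact: polyVM.
    - by apply: polyVB => //; [apply: polyVX | apply: polyV_const].
  move=> wr; have ew : A.[w] - z * B.[w] = 0.
    rewrite -horner_subZ er hornerZ horner_prod (big_rem w) //= hornerXsubC.
    by rewrite subrr mul0r mulr0.
  apply: contrapT => nVw; have Bw : B.[w] != 0.
    have [Bw0|//] := eqVneq B.[w] 0; move: ew; rewrite Bw0 mulr0 subr0 => /cop.
    by rewrite Bw0 eqxx.
  apply: (pole w nVw Bw); move/eqP: ew; rewrite subr_eq0 => /eqP ->.
  by rewrite mulfK.
set l := lead_coef A in rootV.
have A0 : A != 0 by rewrite -size_poly_gt0; apply: leq_ltn_trans sBA.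
have l0 : l != 0 by rewrite lead_coef_eq0.
have VA : polyV V (l^-1 *: A) by apply: (rootV 0); [exact: vr0 | rewrite scale0r subr0].
have VB : polyV V (l^-1 *: B).
  have -> : l^-1 *: B = l^-1 *: A - l^-1 *: (A - B).
    by rewrite -scalerBr opprB addrC subrK.
  by apply: polyVB => //; apply: (rootV 1); [exact: vr1 | rewrite scale1r].
have y0 : y != 0 by apply/eqP => e; apply: nVy; rewrite e; exact: vr0.
case sA : (size A) sBA => [//|n] sB.
have eA : (l^-1 *: A)`_n = 1.
  by rewrite coefZ /l lead_coefE sA /= mulVf // -/(n.+1.-1) -sA -lead_coefE.
have sA' : (size (l^-1 *: A) <= n.+1)%N by rewrite (leq_trans (size_scale_leq _ _)) ?sA.
have := horner_vr_inv HV VA sA' nVy; rewrite eA hornerZ => M1.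
have un : ~ M (l^-1 * A.[y] / y ^+ n).
  by rewrite -(subrK 1 (_ / _)) addrC; apply: (nvmaxDl HV) => //; exact: vmax1.
have Vu : V (l^-1 * A.[y] / y ^+ n).
  by rewrite -(subrK 1 (_ / _)); apply: vrD => //; [exact: vmax_sub | exact: vr1].
have [u0 _] := vunit Vu un.
have Ay0 : A.[y] != 0 by apply: contra_neq u0 => ->; rewrite mulr0 mul0r.
split=> //; case: n {sA sA' eA M1} sB un Vu u0 => [|n] sB un Vu u0.
  move: sB; rewrite ltnS leqn0 size_poly_eq0 => /eqP ->.
  by rewrite horner0 mul0r mulr0; exact: vr0.
have sB' : (size (l^-1 *: B) <= n.+1)%N by rewrite (leq_trans (size_scale_leq _ _)).
have := horner_vr_inv HV VB sB' nVy; rewrite hornerZ => M2.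
have V2 : V (l^-1 * B.[y] / y ^+ n).
  by rewrite -(subrK (l^-1 *: B)`_n (_ / _)); apply: vrD => //; exact: vmax_sub.
have -> : y * (B.[y] / A.[y]) = (l^-1 * B.[y] / y ^+ n) / (l^-1 * A.[y] / y ^+ n.+1).
  by rewrite exprS; field; rewrite expf_neq0 //; apply/and4P.
exact: vr_divu.
Qed.

Lemma root_exists n (c : F) : (0 < n)%N -> exists y, y ^+ n = c.
Proof.
move=> n0; have /closed_rootP[y /rootP] : size ('X^n - c%:P) != 1.
  by rewrite size_XnsubC // eqSS -lt0n.
by rewrite !hornerE => /eqP; rewrite subr_eq0 => /eqP e; exists y.
Qed.

Lemma vr_root n (y : F) : (0 < n)%N -> V (y ^+ n) -> V y.
Proof.
move=> n0 Vy; apply: contrapT => nV; have := vmaxX HV (not_vr_inv nV) n0.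
rewrite exprVn => -[/eqP|]; last by rewrite invrK; apply.
rewrite invr_eq0 expf_eq0 n0 => /eqP y0; apply: nV; rewrite y0; exact: vr0.
Qed.

Lemma vr_ratio x y : x != 0 \/ y != 0 ->
  (y != 0 /\ V (x / y)) \/ (x != 0 /\ V (y / x)).
Proof.
have [->|x0] := eqVneq x 0.
  case=> // y0; left; rewrite mul0r; split=> //; exact: vr0.
have [->|y0] := eqVneq y 0; first by right; rewrite mul0r; split=> //; exact: vr0.
by case: (vr_total HV (x / y)) => ?; [left | right; rewrite -invf_div].
Qed.

(** This keeps the scaling factor of [semistable_model] away from 0: if all four invariants
    vanished, so would the discriminant. *)
Lemma kdisc_shift_neq0 k r : kdisc k != 0 ->
  c4 (kshift r k) = 0 -> c6 (kshift r k) = 0 -> c8 (kshift r k) = 0 ->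
  c2 (kshift r k) != 0.
Proof.
move=> d0 e4 e6 e8; apply: contra_neq d0 => e2.
have f2 : c2 k = - 12 * r by rewrite -(addr0 (_ * r)) -e2 /=; ring.
have f4 : c4 k = 6 * r ^+ 2 by rewrite -(addr0 (6 * _)) -e4 /= f2; ring.
have f6 : c6 k = - 4 * r ^+ 3.
  by rewrite -(addr0 (_ * r ^+ 3)) -e6 /= /psi2 f2 f4; ring.
have f8 : c8 k = 3 * r ^+ 4 by rewrite -(addr0 (3 * _)) -e8 /= f2 f4 f6; ring.
by rewrite /kdisc f2 f4 f6 f8; ring.
Qed.

(* For residue characteristic 2 the new origin is a point of order 3 (c8 = 0),
   otherwise it is a point of order 2 (c6 = 0). *)
Lemma semistable_model k : kwf k -> kint V k -> kdisc k != 0 ->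
  exists r u, [/\ V r, V u, u != 0, kint V (kscale u (kshift r k)) &
    semistable V (kscale u (kshift r k))].
Proof.
move=> wf [V2 V4 V6 V8] d0.
have [M2|n2] := pselect (M 2).
  have n3 : ~ M 3.
    move=> M3; apply: (vmax1 HV); have -> : 1 = 3 - 2 :> F by ring.
    exact: vmaxB.
  (* The 3-division polynomial. Its leading coefficient is a unit since 2 lies in [M], so its root
     is integral. *)
  pose f : {poly F} := 3 *: 'X^4 + (c2 k *: 'X^3 + (3 * c4 k) *: 'X^2
    + (3 * c6 k) *: 'X + (c8 k)%:P).
  have sf : (size (c2 k *: 'X^3 + (3 * c4 k) *: 'X^2
    + (3 * c6 k) *: 'X + (c8 k)%:P)%R < 5)%N.
    rewrite ltnS; apply/leq_sizeP => j j4.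
    by rewrite !coefD !coefZ !coefXn coefX coefC; case: j j4 => [|[|[|[|j]]]] //= _; ring.
  have t0 : 3 != 0 :> F := nvmax_neq0 n3.
  have s3 : size (3 *: 'X^4 : {poly F}) = 5%N by rewrite size_scale // size_polyXn.
  have Vf : polyV V f.
    move=> i; rewrite !coefD !coefZ coefX !coefXn coefC; case: (i == 0)%N; vr_solve HV.
  have lf : lead_coef f = 3.
    by rewrite lead_coefDl ?s3 // lead_coefZ lead_coefXn mulr1.
  have /closed_rootP[r rr] : size f != 1 by rewrite size_polyDl ?s3.
  have Vr : V r by apply: (root_vr HV Vf _ rr); rewrite lf.
  have e8 : c8 (kshift r k) = 0.
    move/rootP: rr => <-; rewrite /f.
    by rewrite !(hornerD, hornerZ, hornerXn, hornerX, hornerC) /=; ring.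
  have [W2 W4 W6 _] := kint_shift HV Vr (And4 V2 V4 V6 V8).
  have wf' := kwf_shift r wf; rewrite /kwf e8 mulr0 in wf'.
  have nz := @kdisc_shift_neq0 k r d0.
  exists r; move: (kshift r k) wf' W2 W4 W6 e8 nz => {wf d0 f sf Vf lf rr V2 V4 V6 V8} {}k.
  move=> wf V2 V4 V6 e8 nz.
  (* Since [c8] = 0, the relation [kwf] reads [c2] [c6] = [c4]^2, which is solved by [c2] = a^2,
     [c4] = a c, [c6] = c^2: the model y^2 + a x y + c y = x^3. With c = g^3 both a and g have
     weight 1, and scaling by the larger one makes it a unit and keeps the other integral. *)
  have [a ea] := root_exists (c2 k) (isT : 0 < 2)%N.
  have [c [ec eac]] : exists c, c ^+ 2 = c6 k /\ a * c = c4 k.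
    have [a0|a0] := eqVneq a 0.
      have [c ec] := root_exists (c6 k) (isT : 0 < 2)%N; exists c; split=> //.
      rewrite a0 mul0r; apply/esym/eqP; rewrite -sqrf_eq0 -[_ ^+ 2]opprK oppr_eq0.
      by move: wf; rewrite -ea a0 expr0n mul0r sub0r => <-.
    exists (c4 k / a); split; last by field.
    have -> : (c4 k / a) ^+ 2 = c4 k ^+ 2 / a ^+ 2 by field.
    move/esym/eqP: wf; rewrite subr_eq0 => /eqP <-; rewrite -ea; field.
    exact: a0.
  have [g eg] := root_exists c (isT : 0 < 3)%N.
  have Va : V a by apply: (@vr_root 2) => //; rewrite ea.
  have Vg : V g.
    by apply: (@vr_root 3) => //; rewrite eg; apply: (@vr_root 2) => //; rewrite ec.
  case: (@vr_ratio a g) => [|[g0 Vag]|[a0 Vga]].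
  - have [a0|] := eqVneq a 0; last by left.
    right; apply/eqP => g0; move: eg ec eac; rewrite g0 a0 expr0n /= => <-.
    rewrite expr0n mul0r => /esym e6 /esym e4; move: (nz e4 e6 e8).
    by rewrite -ea a0 expr0n eqxx.
  - exists g.
    have f2 : c2 (kscale g k) = (a / g) ^+ 2 by rewrite /= -ea; field.
    have f4 : c4 (kscale g k) = a / g by rewrite /= -eac -eg; field.
    have f6 : c6 (kscale g k) = 1 by rewrite /= -ec -eg; field.
    have f8 : c8 (kscale g k) = 0 by rewrite /= e8 mul0r.
    split=> //; first by split; rewrite ?f2 ?f4 ?f6 ?f8; vr_solve HV.
    move=> x [Vx Mp _]; rewrite f2 => Mm.
    have Mag : M (a / g).
      apply: (@vmaxX_inv _ _ HV _ 2) => //.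
      have -> : (a / g) ^+ 2 = (a / g) ^+ 2 + 12 * x - 2 * (6 * x) by ring.
      by apply: vmaxB => //; apply: vmaxMr => //; vr_solve HV.
    apply: (vmax1 HV).
    have -> : 1 = psi2 (kscale g k) x - (2 * (2 * x ^+ 3) +
      (a / g) * (a / g * x ^+ 2) + (a / g) * (2 * x)).
      by rewrite /psi2 f2 f4 f6; ring.
    apply: vmaxB => //; apply: vmaxD => //; [apply: vmaxD => //|];
      by apply: vmaxMr => //; vr_solve HV.
  - exists a.
    have f2 : c2 (kscale a k) = 1 by rewrite /= -ea; field.
    have f4 : c4 (kscale a k) = (g / a) ^+ 3 by rewrite /= -eac -eg; field.
    have f6 : c6 (kscale a k) = (g / a) ^+ 6 by rewrite /= -ec -eg; field.
    have f8 : c8 (kscale a k) = 0 by rewrite /= e8 mul0r.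
    split=> //; first by split; rewrite ?f2 ?f4 ?f6 ?f8; vr_solve HV.
    move=> x [Vx _ _]; rewrite f2; apply: (nvmaxDl HV); last exact: vmax1.
    have -> : 12 * x = 2 * (6 * x) by ring.
    by apply: vmaxMr => //; vr_solve HV.
pose f : {poly F} := 4 *: 'X^3 + (c2 k *: 'X^2 + (2 * c4 k) *: 'X + (c6 k)%:P).
have V2' : V 2 := vrn HV 2.
have n4 : ~ M 4.
  have -> : 4 = 2 * 2 :> F by ring.
  exact: nvmaxM.
have sf : (size (c2 k *: 'X^2 + (2 * c4 k) *: 'X + (c6 k)%:P)%R < 4)%N.
  rewrite ltnS; apply/leq_sizeP => j j4.
  by rewrite !coefD !coefZ !coefXn coefX coefC; case: j j4 => [|[|[|j]]] //= _; ring.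
have t0 : 4 != 0 :> F := nvmax_neq0 n4.
have s3 : size (4 *: 'X^3 : {poly F}) = 4%N by rewrite size_scale // size_polyXn.
have Vf : polyV V f.
  move=> i; rewrite !coefD !coefZ coefX !coefXn coefC; case: (i == 0)%N; vr_solve HV.
have lf : lead_coef f = 4.
  by rewrite lead_coefDl ?s3 // lead_coefZ lead_coefXn mulr1.
have /closed_rootP[r rr] : size f != 1 by rewrite size_polyDl ?s3.
have Vr : V r by apply: (root_vr HV Vf _ rr); rewrite lf.
have e6 : c6 (kshift r k) = 0.
  move/rootP: rr => <-; rewrite /f.
  by rewrite !(hornerD, hornerZ, hornerXn, hornerX, hornerC) /= /psi2; ring.
have [W2 W4 _ W8] := kint_shift HV Vr (And4 V2 V4 V6 V8).
have wf' := kwf_shift r wf; rewrite /kwf e6 mulr0 sub0r in wf'.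
have nz := @kdisc_shift_neq0 k r d0.
exists r; move: (kshift r k) wf' W2 W4 W8 e6 nz => {wf d0 f sf Vf lf rr V2 V4 V6 V8} {}k.
move=> wf V2 V4 V8 e6 nz.
(* Now [c6] = 0 and [c8] = - [c4]^2 / 4, so [c2] = c^2 and [c4] = g^4 determine the model. Again c
   and g have weight 1 and the larger of them is the scaling factor. *)
have [c ec] := root_exists (c2 k) (isT : 0 < 2)%N.
have [g eg] := root_exists (c4 k) (isT : 0 < 4)%N.
have e8 : c8 k = - (g ^+ 8) / 4.
  have -> : g ^+ 8 = (g ^+ 4) ^+ 2 by rewrite -exprM.
  by rewrite eg -wf; field.
have Vc : V c by apply: (@vr_root 2) => //; rewrite ec.
have Vg : V g by apply: (@vr_root 4) => //; rewrite eg.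
have Vq : V 4^-1 by have [] := vunit (vrn HV 4) n4.
case: (@vr_ratio c g) => [|[g0 Vcg]|[c0 Vgc]].
- have [c0|] := eqVneq c 0; last by left.
  right; apply/eqP => g0; move: eg; rewrite g0 expr0n /= => /esym e4.
  have e8' : c8 k = 0 by rewrite e8 g0 expr0n oppr0 mul0r.
  by move: (nz e4 e6 e8'); rewrite -ec c0 expr0n eqxx.
- exists g.
  have f2 : c2 (kscale g k) = (c / g) ^+ 2 by rewrite /= -ec; field.
  have f4 : c4 (kscale g k) = 1 by rewrite /= -eg; field.
  have f6 : c6 (kscale g k) = 0 by rewrite /= e6 mul0r.
  have f8 : c8 (kscale g k) = - 4^-1 by rewrite /= e8; field; apply/andP.
  split=> //; first by split; rewrite ?f2 ?f4 ?f6 ?f8; vr_solve HV.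
  move=> x [Vx Mp Mf]; rewrite f2 => Mm.
  have Mh : M (2 * x ^+ 2 - 1).
    apply: (@vmaxX_inv _ _ HV _ 2); first by vr_solve HV.
    have -> : (2 * x ^+ 2 - 1) ^+ 2 = 4 * phi2 (kscale g k) x.
      by rewrite /phi2 f4 f6 f8; field.
    by apply: vmaxMl => //; exact: vrn.
  have Mx : M (2 * x).
    have -> : 2 * x = - psi2 (kscale g k) x + ((c / g) ^+ 2 + 12 * x) * x ^+ 2
       - (2 * x ^+ 2 - 1) * (4 * x).
      by rewrite /psi2 f2 f4 f6; ring.
    apply: vmaxB => //; first apply: vmaxD => //; first exact: vmaxN.
      by apply: vmaxMr => //; vr_solve HV.
    by apply: vmaxMr => //; vr_solve HV.
  apply: (vmax1 HV); have -> : 1 = 2 * x * x - (2 * x ^+ 2 - 1) by ring.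
  by apply: vmaxB => //; apply: vmaxMr.
- exists c.
  have f2 : c2 (kscale c k) = 1 by rewrite /= -ec; field.
  have f4 : c4 (kscale c k) = (g / c) ^+ 4 by rewrite /= -eg; field.
  have f6 : c6 (kscale c k) = 0 by rewrite /= e6 mul0r.
  have f8 : c8 (kscale c k) = - (g / c) ^+ 8 / 4 by rewrite /= e8; field; apply/andP.
  split=> //; first by split; rewrite ?f2 ?f4 ?f6 ?f8; vr_solve HV.
  move=> x [Vx Mp Mf]; rewrite f2 => Mm.
  set b := (g / c) ^+ 4 in f4; have Vb : V b by apply: vrX.
  have {}f8 : c8 (kscale c k) = - b ^+ 2 / 4 by rewrite f8 /b -exprM.
  have Mh : M (2 * x ^+ 2 - b).
    apply: (@vmaxX_inv _ _ HV _ 2); first by vr_solve HV.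
    have -> : (2 * x ^+ 2 - b) ^+ 2 = 4 * phi2 (kscale c k) x.
      by rewrite /phi2 f4 f6 f8; field.
    by apply: vmaxMl => //; exact: vrn.
  have : M (x ^+ 2 * (8 * x + 1)).
    have -> : x ^+ 2 * (8 * x + 1) = psi2 (kscale c k) x + (2 * x ^+ 2 - b) * (2 * x).
      by rewrite /psi2 f2 f4 f6; ring.
    by apply: vmaxD => //; apply: vmaxMr => //; vr_solve HV.
  have fin : ~ M x.
    move=> Mx; apply: (vmax1 HV); have -> : 1 = (1 + 12 * x) - x * 12 by ring.
    by apply: vmaxB => //; apply: vmaxMr => //; exact: vrn.
  move=> /(vmax_prime HV (vrX HV 2 Vx))[]; first by vr_solve HV.
    by move=> /(vmaxX_inv HV Vx).
  move=> M8; have : M (4 * x).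
    have -> : 4 * x = (1 + 12 * x) - (8 * x + 1) by ring.
    exact: vmaxB.
  by move=> /(vmax_prime HV (vrn HV 4) Vx)[].
Qed.

End LattesReduction.

(** * Transfer of non-singularity from the semistable model to the given one *)

Section LattesStability.
Variables (F : closedFieldType) (V : set F).
Hypothesis HV : valring V.
Local Notation M := (vmax V).
Implicit Types (A B p q g : {poly F}) (k : kummer F) (x y z s t u r c : F).

Lemma lattes_shift k A B r : lattes k A B ->
  lattes (kshift r k) ((A - r *: B) \Po ('X + r%:P)) (B \Po ('X + r%:P)).
Proof.
move=> lat x y s t xy kk; rewrite !horner_comp !horner_subZ !hornerE.
have := lat (x + r) (y + r) (s + r) (t + r).
rewrite (inj_eq (addIr r)) -(kum_shift r) !addrK => /(_ xy kk) h b1 b2 b3 b4.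
have e w : B.[w + r] != 0 ->
    (A.[w + r] - r * B.[w + r]) / B.[w + r] = A.[w + r] / B.[w + r] - r.
  by move=> b0; field.
by rewrite !e //; apply/kum_shift; apply: h.
Qed.

Lemma lattes_scale k A B u : u != 0 -> lattes k A B ->
  lattes (kscale u k) (A \Po (u ^+ 2 *: 'X)) (u ^+ 2 *: (B \Po (u ^+ 2 *: 'X))).
Proof.
move=> u0 lat x y s t xy kk; have u2 : u ^+ 2 != 0 by rewrite expf_neq0.
rewrite !hornerZ !horner_comp !hornerE.
have cE w : u ^+ 2 * w / u ^+ 2 = w by field.
have := lat (u ^+ 2 * x) (u ^+ 2 * y) (u ^+ 2 * s) (u ^+ 2 * t).
rewrite (inj_eq (mulfI u2)) -(kum_scale _ _ _ _ _ u0) !cE => /(_ xy kk) h.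
rewrite !(mulf_eq0 (u ^+ 2)) !(negPf u2) /= => b1 b2 b3 b4.
have e w : B.[w] != 0 -> A.[w] / (u ^+ 2 * B.[w]) = A.[w] / B.[w] / u ^+ 2.
  by move=> b0; field; apply/andP.
by rewrite !e //; apply/(kum_scale _ _ _ _ _ u0); apply: h.
Qed.

Lemma lattes_const k A B c : c != 0 -> lattes k A B -> lattes k (c *: A) (c *: B).
Proof.
move=> c0 lat x y s t xy kk; rewrite !hornerZ !mulf_eq0 (negPf c0) /= => b1 b2 b3 b4.
have e w : B.[w] != 0 -> c * A.[w] / (c * B.[w]) = A.[w] / B.[w].
  by move=> b0; field; apply/andP.
by rewrite !e //; apply: lat.
Qed.

(** The first conclusion says that near O the map does not shrink x. It is needed when the given
    model is obtained from the semistable one by a non-unit scaling, since then non-singular points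
    may lie near O on the semistable model. *)
Lemma semistable_lattes k A B : kwf k -> kint V k -> semistable V k ->
  lattes k A B -> (size B < size A)%N -> (forall x, A.[x] = 0 -> B.[x] != 0) ->
  [/\ forall y, ~ V y -> A.[y] != 0 /\ V (y * (B.[y] / A.[y])) &
      forall y, ~ sing V k y -> B.[y] != 0 -> ~ sing V k (A.[y] / B.[y])].
Proof.
move=> wf ki ss lat sBA cop.
have A0 : A != 0 by rewrite -size_poly_gt0; apply: leq_ltn_trans sBA.
have [|c [c0 VA VB nM]] := @scale_pair _ _ HV A B; first by left.
have ci0 : c^-1 != 0 by rewrite invr_eq0.
have lat' := lattes_const ci0 lat.
have nc : nonconst V (c^-1 *: A) (c^-1 *: B).
  have [MB|pB] := polyM_or_prim VB.
    move=> z Vz Mz; apply: nM; split=> //.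
    rewrite -(subrK (z *: (c^-1 *: B)) (c^-1 *: A)); apply: polyMD => //.
    by rewrite -mul_polyC mulrC; apply: polyMM => //; apply: polyV_const.
  apply: (semistable_nonconst HV wf ki ss lat' VA pB) => z.
  apply/eqP => e; move: sBA; rewrite ltnNge => /negP; apply.
  have -> : A = z *: B.
    by apply: (scalerI ci0); rewrite e !scalerA mulrC.
  exact: size_scale_leq.
have eR w : (c^-1 *: A).[w] / (c^-1 *: B).[w] = A.[w] / B.[w].
  have [b0|b0] := eqVneq B.[w] 0; first by rewrite !hornerZ b0 mulr0 !invr0 !mulr0.
  by rewrite !hornerZ; field; apply/andP.
have eB w : ((c^-1 *: B).[w] != 0) = (B.[w] != 0).
  by rewrite hornerZ mulf_eq0 (negPf ci0).
have pole y : ~ V y -> B.[y] != 0 -> ~ V (A.[y] / B.[y]).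
  by rewrite -eR -eB; apply: (lattes_pole HV wf ki lat' VA VB nc).
split; first exact: lattes_expand.
move=> y ny By sR; have [VR _ _] := sR.
have [Vy|nVy] := pselect (V y); last exact: (pole y).
move: By sR; rewrite -eB -eR.
exact: (lattes_nonsing_integral HV wf ki lat' VA VB nc Vy ny).
Qed.

Theorem lattes_nonsing k A B : kwf k -> kint V k -> kdisc k != 0 ->
  lattes k A B -> (size B < size A)%N -> (forall x, A.[x] = 0 -> B.[x] != 0) ->
  forall y, ~ sing V k y -> B.[y] != 0 -> ~ sing V k (A.[y] / B.[y]).
Proof.
move=> wf ki d0 lat sBA cop y.
have [r [u [Vr Vu u0 ki' ss]]] := semistable_model HV wf ki d0.
have u2 : u ^+ 2 != 0 by rewrite expf_neq0.
have ki1 := kint_shift HV Vr ki; have wf1 := kwf_shift r wf.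
rewrite -(sing_shift HV _ ki Vr) => ny By; rewrite -(sing_shift HV _ ki Vr).
have lat1 := lattes_shift (r := r) lat.
set A1 := _ \Po _ in lat1; set B1 := _ \Po _ in lat1.
have hB1 w : B1.[w] = B.[w + r] by rewrite /B1 horner_comp !hornerE.
have hA1 w : A1.[w] = A.[w + r] - r * B.[w + r].
  by rewrite /A1 horner_comp horner_subZ !hornerE.
have sBA1 : (size B1 < size A1)%N.
  have s2 : size ('X + r%:P) = 2 by rewrite size_XaddC.
  rewrite !size_comp_poly2 // size_polyDl // size_polyN.
  exact: leq_ltn_trans (size_scale_leq _ _) sBA.
have cop1 w : A1.[w] = 0 -> B1.[w] != 0.
  rewrite hA1 hB1 => e; have [b0|//] := eqVneq B.[w + r] 0.
  by move: e; rewrite b0 mulr0 subr0 => /cop; rewrite b0 eqxx.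
have By1 : B1.[y - r] != 0 by rewrite hB1 subrK.
have -> : A.[y] / B.[y] - r = A1.[y - r] / B1.[y - r].
  by rewrite hB1 hA1 subrK; field.
clearbody A1 B1.
move: (kshift r k) (y - r) ki' ss ki1 wf1 lat1 ny By1.
move=> {wf ki d0 lat sBA cop By hA1 hB1 A B y} {}k y ki' ss ki wf lat ny By.
move: A1 B1 lat By sBA1 cop1 => A B lat By sBA cop.
have lat2 := lattes_scale u0 lat.
set A1 := _ \Po _ in lat2; set B1 := u ^+ 2 *: _ in lat2.
have hB1 w : B1.[w] = u ^+ 2 * B.[u ^+ 2 * w].
  by rewrite /B1 hornerZ horner_comp hornerZ hornerX.
have hA1 w : A1.[w] = A.[u ^+ 2 * w].
  by rewrite /A1 horner_comp hornerZ hornerX.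
have sBA1 : (size B1 < size A1)%N.
  have s2 : size (u ^+ 2 *: 'X : {poly F}) = 2 by rewrite size_scale // size_polyX.
  rewrite /B1 size_scale // !size_comp_poly2 //.
have cop1 w : A1.[w] = 0 -> B1.[w] != 0.
  by rewrite hA1 hB1 mulf_eq0 (negPf u2) => /cop.
have [ex ns] := semistable_lattes (kwf_scale u0 wf) ki' ss lat2 sBA1 cop1.
have yE : u ^+ 2 * (y / u ^+ 2) = y by field.
have By1 : B1.[y / u ^+ 2] != 0 by rewrite hB1 yE mulf_eq0 (negPf u2).
have RE : A1.[y / u ^+ 2] / B1.[y / u ^+ 2] = A.[y] / B.[y] / u ^+ 2.
  by rewrite hA1 hB1 yE; field; apply/andP.
(* A unit u changes neither integrality nor [M], so both models have the same singular points. *)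
have [Mu|nu] := pselect (M u); last first.
  have sE w : sing V (kscale u k) (w / u ^+ 2) <-> sing V k w.
    have [_ Vi] := vunit Vu nu.
    rewrite /sing psi2_scale // phi2_scale //; split=> -[h1 h2 h3]; split.
    - by rewrite -(divfK u2 w); apply: vrM => //; apply: vrX.
    - by rewrite -(divfK (expf_neq0 6 u0) (psi2 k w)); apply: vmaxMr => //; apply: vrX.
    - by rewrite -(divfK (expf_neq0 8 u0) (phi2 k w)); apply: vmaxMr => //; apply: vrX.
    - by rewrite -exprVn; apply: vrM => //; apply: vrX.
    - by rewrite -exprVn; apply: vmaxMr => //; apply: vrX.
    - by rewrite -exprVn; apply: vmaxMr => //; apply: vrX.
  by rewrite -sE -RE; apply: ns => //; rewrite sE.
have [V2 V4 V6 V8] := ki'.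
have m4 : M (c4 k).
  have -> : c4 k = c4 (kscale u k) * u ^+ 4 by rewrite /=; field.
  by apply: vmaxMl => //; apply: vmaxX.
have m6 : M (c6 k).
  have -> : c6 k = c6 (kscale u k) * u ^+ 6 by rewrite /=; field.
  by apply: vmaxMl => //; apply: vmaxX.
have m8 : M (c8 k).
  have -> : c8 k = c8 (kscale u k) * u ^+ 8 by rewrite /=; field.
  by apply: vmaxMl => //; apply: vmaxX.
(* For u in [M] the given model has a cusp at the origin, and singular means lying in [M]. If y /
   u^2 is integral, y is singular. Otherwise the growth estimate bounds y by its image, so an image
   in [M] forces y into [M]. *)
move: ny; rewrite !sing_center // => ny MR; apply: ny.
have [Vy'|nVy'] := pselect (V (y / u ^+ 2)).
  by rewrite -yE; apply: vmaxMr => //; apply: vmaxX.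
have [Ay0] := ex _ nVy'; rewrite -(invf_div A1.[_]) RE => VyR.
have A0 : A.[y] != 0 by rewrite -yE -hA1.
have -> : y = y / u ^+ 2 * (A.[y] / B.[y] / u ^+ 2)^-1 * (A.[y] / B.[y]).
  by field; apply/and3P.
exact: vmaxMl.
Qed.

End LattesStability.

(** * Valuation rings dominating a local ring *)

Section Chevalley.
Variables (F : fieldType) (R0 P : set F).
Hypotheses (R01 : R0 1) (R0B : forall x y, R0 x -> R0 y -> R0 (x - y))
  (R0M : forall x y, R0 x -> R0 y -> R0 (x * y)).
Hypotheses (PR0 : P `<=` R0) (P0 : P 0) (PD : forall x y, P x -> P y -> P (x + y))
  (PM : forall x y, P x -> R0 y -> P (x * y)) (P1 : ~ P 1).

(** The ideal P A of A generated by P. The inductive form lets sums of products be handled one term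
    at a time. *)
Inductive extension (A : set F) : F -> Prop :=
| extension0 : extension A 0
| extensionS p a x : P p -> A a -> extension A x -> extension A (p * a + x).

Definition is_subring (A : set F) : Prop :=
  [/\ A 1, forall x y, A x -> A y -> A (x - y) & forall x y, A x -> A y -> A (x * y)].

Definition dominates (A : set F) : Prop :=
  [/\ R0 `<=` A, is_subring A & ~ extension A 1].

Lemma extension_mono A B x : A `<=` B -> extension A x -> extension B x.
Proof.
move=> AB; elim=> [|p a y Pp Aa _ IH]; first exact: extension0.
by apply: extensionS => //; apply: AB.
Qed.

Lemma extensionD A x y : extension A x -> extension A y -> extension A (x + y).
Proof.
elim=> [|p a z Pp Aa _ IH] ey; first by rewrite add0r.
by rewrite -addrA; apply: extensionS => //; apply: IH.
Qed.

Lemma extensionM A x y : is_subring A -> extension A x -> A y -> extension A (x * y).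
Proof.
move=> [A1 AB AM] + Ay; elim=> [|p a z Pp Aa _ IH].
  by rewrite mul0r; exact: extension0.
by rewrite mulrDl -mulrA; apply: extensionS => //; apply: AM.
Qed.

Lemma subring0 A : is_subring A -> A 0.
Proof. by move=> [A1 AB _]; rewrite -(subrr 1); apply: AB. Qed.

Lemma subringN A x : is_subring A -> A x -> A (- x).
Proof. by move=> sA Ax; rewrite -sub0r; have [_ AB _] := sA; apply: AB => //; apply: subring0. Qed.

Lemma subringD A x y : is_subring A -> A x -> A y -> A (x + y).
Proof.
move=> sA Ax Ay; rewrite -(opprK y); have [_ AB _] := sA; apply: AB => //.
exact: subringN.
Qed.

Lemma subringX A x n : is_subring A -> A x -> A (x ^+ n).
Proof.
move=> sA Ax; have [A1 _ AM] := sA; elim: n => [|n IH]; first by rewrite expr0.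
by rewrite exprS; apply: AM.
Qed.

Lemma subring_sum A (I : Type) (r : seq I) (Q : pred I) (f : I -> F) :
  is_subring A -> (forall i, Q i -> A (f i)) -> A (\sum_(i <- r | Q i) f i).
Proof.
move=> sA Af; elim/big_ind: _ => //; [exact: subring0 | by move=> *; apply: subringD].
Qed.

Lemma extension_sum A (I : Type) (r : seq I) (Q : pred I) (f : I -> F) :
  (forall i, Q i -> extension A (f i)) -> extension A (\sum_(i <- r | Q i) f i).
Proof.
move=> Af; elim/big_ind: _ => //; [exact: extension0 | by move=> *; apply: extensionD].
Qed.

Lemma dominates_base : dominates R0.
Proof.
split=> // e1; apply: P1; elim: e1 => // p a x Pp Ra _ Px.
by apply: PD => //; apply: PM.
Qed.

(** Zorn's lemma: a relation that puts 1 in the extended ideal has finitely many terms, so in the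
    union of a chain it already occurs in one member. *)
Lemma maximal_dominates : exists A, dominates A /\
  forall B, A `<=` B -> dominates B -> B `<=` A.
Proof.
have [F0 F0P totF|A [PA Amax]] := @Zorn_bigcup F (fun A => A = set0 \/ dominates A).
  have [[X0 FX0 dX0]|nd] := pselect (exists2 X, F0 X & dominates X); last first.
    left; apply/seteqP; split=> // x [X FX Xx]; case: (F0P X FX) => [X0|dX].
      by move: Xx; rewrite X0.
    by case: nd; exists X.
  right; have dX X x : F0 X -> X x -> dominates X.
    by move=> /F0P[->|].
  have two x y : (\bigcup_(X in F0) X) x -> (\bigcup_(X in F0) X) y ->
      exists X, [/\ F0 X, X x & X y].
    move=> [X FX Xx] [Y FY Yy]; case: (totF X Y FX FY) => XY.
      by exists Y; split=> //; apply: XY.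
    by exists X; split=> //; apply: XY.
  have [R0X [X1 _ _] _] := dX0.
  split.
  - by move=> x /R0X Xx; exists X0.
  - split; first by exists X0.
      move=> x y /two/[apply] -[X [FX Xx Xy]].
      by have [_ [_ XB _] _] := dX X x FX Xx; exists X => //; apply: XB.
    move=> x y /two/[apply] -[X [FX Xx Xy]].
    by have [_ [_ _ XM] _] := dX X x FX Xx; exists X => //; apply: XM.
  move=> e1; have [X FX eX] : exists2 X, F0 X & extension X 1.
    elim: e1 => [|p a x Pp [Y FY Ya] _ [X FX eX]].
      by exists X0 => //; exact: extension0.
    case: (totF X Y FX FY) => XY.
      by exists Y => //; apply: extensionS => //; apply: extension_mono eX.
    by exists X => //; apply: extensionS => //; apply: XY.
  case: (F0P X FX) => [XE|[_ _]]; last exact.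
  move: eX; rewrite XE => eX; case: dX0 => _ _; apply.
  by apply: extension_mono eX.
have dA : dominates A.
  case: PA => // A0; exfalso; apply: (Amax R0); last by right; exact: dominates_base.
  by rewrite A0; split=> // /(_ 1 R01).
exists A; split=> // B AB dB; apply: contrapT => nBA.
by apply: (Amax B); [split | right].
Qed.

Definition adjoin (A : set F) (x : F) : set F :=
  [set y | exists2 f : {poly F}, forall i, A f`_i & y = f.[x]].

Lemma adjoin_subring A x : is_subring A -> is_subring (adjoin A x).
Proof.
move=> sA; have [A1 AB AM] := sA; split.
- exists 1; last by rewrite hornerC.
  by move=> i; rewrite coefC; case: ifP => // _; exact: subring0.
- move=> _ _ [f Af ->] [g Ag ->]; exists (f - g); last by rewrite hornerD hornerN.
  by move=> i; rewrite coefB; apply: AB.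
- move=> _ _ [f Af ->] [g Ag ->]; exists (f * g); last by rewrite hornerM.
  by move=> i; rewrite coefM; apply: subring_sum => // j _; apply: AM.
Qed.

Lemma extension_adjoin A x y : extension (adjoin A x) y ->
  exists2 f : {poly F}, forall i, extension A f`_i & f.[x] = y.
Proof.
elim=> [|p _ z Pp [f Af ->] _ [g eg <-]].
  by exists 0; [move=> i; rewrite coef0; exact: extension0 | rewrite horner0].
exists (p *: f + g); last by rewrite hornerD hornerZ.
move=> i; rewrite coefD coefZ; apply: extensionD => //.
by rewrite -(addr0 (p * _)); apply: extensionS => //; exact: extension0.
Qed.

(** By maximality A[x] does not dominate, so 1 lies in P A[x], which consists of the values at x of
    polynomials over P A. *)
Lemma maximal_adjoin A : dominates A ->
  (forall B, A `<=` B -> dominates B -> B `<=` A) ->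
  forall x, ~ A x -> exists2 f : {poly F}, forall i, extension A f`_i & f.[x] = 1.
Proof.
move=> [R0A sA nA1] Amax x nAx; have [A1 _ _] := sA.
apply: extension_adjoin; apply: contrapT => ne; apply: nAx.
have AA : A `<=` adjoin A x.
  move=> a Aa; exists a%:P; last by rewrite hornerC.
  by move=> i; rewrite coefC; case: ifP => // _; exact: subring0.
apply: (Amax _ AA).
  by split=> //; [move=> a /R0A/AA | exact: adjoin_subring].
exists 'X; last by rewrite hornerX.
by move=> i; rewrite coefX; case: eqP => _ //; exact: subring0.
Qed.

(* The minimal-degree argument: a relation 1 = f(x) of degree n >= m can be
   shortened by a relation 1 = g(1/x) of degree m. *)
Theorem valring_dominating : exists V : set F,
  [/\ valring V, R0 `<=` V & P `<=` vmax V].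
Proof.
have [A [dA Amax]] := maximal_dominates; exists A.
have [R0A sA nA1] := dA; have [A1 AB AM] := sA; have A0 := subring0 sA.
have eA c : extension A c -> A c.
  elim=> // p a x Pp Aa _ Ax; apply: subringD => //; apply: AM => //.
  exact/R0A/PR0.
(* A is local: if the inverse of d = 1 - c were missing, a relation 1 = f(1 / d) over P A,
   multiplied by a power of d, would put that power in P A. But every power of d is 1 modulo P A. *)
have unitA c : extension A c -> 1 - c != 0 /\ A (1 - c)^-1.
  move=> ec; set d := 1 - c; have Ad : A d by apply: AB => //; apply: eA.
  have pw n : extension A (1 - d ^+ n).
    elim: n => [|n IH]; first by rewrite expr0 subrr; exact: extension0.
    have -> : 1 - d ^+ n.+1 = (1 - d ^+ n) * d + c by rewrite exprS /d; ring.
    by apply: extensionD => //; apply: extensionM.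
  have nd n : ~ extension A (d ^+ n).
    by move=> e; apply: nA1; rewrite -(subrK (d ^+ n) 1); apply: extensionD.
  have d0 : d != 0.
    by apply/eqP => e; apply: (nd 1%N); rewrite e expr1; exact: extension0.
  split=> //; apply: contrapT => nAd; have [f ef f1] := maximal_adjoin dA Amax nAd.
  apply: (nd (size f)); rewrite -[_ ^+ _]mul1r -f1 horner_coef mulr_suml.
  apply: extension_sum => i _; rewrite -mulrA; apply: extensionM => //.
  have -> : d ^+ size f = d ^+ i * d ^+ (size f - i) by rewrite -exprD subnKC // ltnW.
  by rewrite mulrA -exprMn mulVf // expr1n mul1r; apply: subringX.
pose rel x n := exists f : {poly F},
  [/\ (size f <= n.+1)%N, forall i, extension A f`_i & f.[x] = 1].
have red x n m : x != 0 -> (m <= n)%N -> rel x n -> rel x^-1 m ->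
    exists2 n', (n' < n)%N & rel x n'.
  move=> x0 mn [f [sf ef f1]] [g [sg eg g1]].
  have [b0 Ab] := unitA _ (eg 0%N).
  have gs : \sum_(j < m) (1 - g`_0)^-1 * g`_j.+1 * x^-1 ^+ j.+1 = 1.
    have e : 1 - g`_0 = \sum_(j < m) g`_j.+1 * x^-1 ^+ j.+1.
      apply/eqP; rewrite subr_eq addrC; apply/eqP.
      by rewrite -[LHS]g1 (horner_coef_wide _ sg) big_ord_recl expr0 mulr1.
    apply: (mulfI b0); rewrite mulr1 mulr_sumr [RHS]e.
    by apply: eq_bigr => j _; rewrite !mulrA mulfV // mul1r.
  case: n mn sf => [|n] mn sf.
    move: mn sg; rewrite leqn0 => /eqP -> /size1_polyC eg0; exfalso.
    by apply: nA1; rewrite -g1 eg0 hornerC.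
  exists n => //; pose c j := f`_n.+1 * ((1 - g`_0)^-1 * g`_j.+1).
  exists (\poly_(i < n.+1) f`_i + \sum_(j < m) c j *: 'X^(n - j)); split.
  - rewrite (leq_trans (size_polyD _ _)) // geq_max size_poly /=.
    apply: (leq_trans (size_sum _ _ _)); apply/bigmax_leqP => j _.
    by rewrite (leq_trans (size_scale_leq _ _)) // size_polyXn ltnS leq_subr.
  - move=> i; rewrite coefD; apply: extensionD.
      by rewrite coef_poly; case: ifP => // _; exact: extension0.
    rewrite coef_sum; apply: extension_sum => j _; rewrite coefZ coefXn.
    apply: extensionM => //; last by case: eqP.
    by apply: extensionM => //; apply: AM => //; apply: eA.
  - rewrite -[RHS]f1 (horner_coef_wide _ sf) big_ord_recr hornerD horner_poly /=.
    congr (_ + _); rewrite horner_sum -[RHS]mulr1 -gs mulr_sumr.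
    apply: eq_bigr => j _; rewrite hornerZ hornerXn /c.
    have <- : x ^+ n.+1 * x^-1 ^+ j.+1 = x ^+ (n - j).
      have -> : x ^+ n.+1 = x ^+ (n - j) * x ^+ j.+1.
        by rewrite -exprD addnS subnK // -ltnS (leq_trans (ltn_ord j)) // ltnW.
      by rewrite -mulrA -exprMn mulfV // expr1n mulr1.
    by move: (1 - g`_0)^-1 (x^-1 ^+ j.+1) => u w; ring.
have nrel x : x != 0 -> forall n m, rel x n -> rel x^-1 m -> False.
  move=> x0 n m; move: {2}(n + m)%N (leqnn (n + m)) => N.
  elim: N x x0 n m => [|N IH] x x0 n m sN rn rm.
    move: sN; rewrite leqn0 addn_eq0 => /andP[/eqP n0 /eqP m0].
    by have [|n'] := red x n m x0 _ rn rm; rewrite n0 ?m0.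
  have [mn|nm] := leqP m n.
    have [n' n'n rn'] := red x n m x0 mn rn rm.
    by apply: (IH x x0 n' m) => //; lia.
  have xi0 : x^-1 != 0 by rewrite invr_eq0.
  have rn' : rel x^-1^-1 n by rewrite (invrK x).
  have [m' m'm rm'] := red x^-1 m n xi0 (ltnW nm) rm rn'.
  by apply: (IH x x0 n m') => //; lia.
split=> //; last first.
  move=> p Pp; have [->|p0] := eqVneq p 0; first by left.
  right => Ap; apply: nA1; rewrite -(mulfV p0) -(addr0 (_ * _)).
  by apply: extensionS => //; exact: extension0.
split=> //.
- by move=> x y; apply: subringD.
- by move=> x; apply: subringN.
- move=> x; apply: contrapT => /not_orP[nx nxi].
  have x0 : x != 0 by apply/eqP => e; apply: nx; rewrite e.
  have [f ef f1] := maximal_adjoin dA Amax nx.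
  have [g eg g1] := maximal_adjoin dA Amax nxi.
  by apply: (nrel x x0 (size f) (size g)); [exists f | exists g].
Qed.

End Chevalley.

(** * Rings of integers *)

Section RingOfIntegers.
Variable K : fieldExtType rat.
Implicit Types (x y z w : K).
Local Notation OK := (@ringOfIntegers K).

Lemma OK1 : OK 1. Proof. exact: integral1. Qed.
Lemma OK0 : OK 0. Proof. exact: integral0. Qed.
Lemma OKD x y : OK x -> OK y -> OK (x + y). Proof. exact: integral_add. Qed.
Lemma OKB x y : OK x -> OK y -> OK (x - y). Proof. exact: integral_sub. Qed.
Lemma OKN x : OK x -> OK (- x). Proof. exact: integral_opp. Qed.
Lemma OKM x y : OK x -> OK y -> OK (x * y). Proof. exact: integral_mul. Qed.
Lemma OKn n : OK n%:R. Proof. exact: integral_nat. Qed.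
Lemma OKz (n : int) : OK n%:~R. Proof. exact: integral_id. Qed.

Lemma OKX x n : OK x -> OK (x ^+ n).
Proof.
move=> Ox; elim: n => [|n IH]; first by rewrite expr0; exact: OK1.
by rewrite exprS; apply: OKM.
Qed.

Lemma OK_sum (I : Type) (r : seq I) (P : pred I) (f : I -> K) :
  (forall i, P i -> OK (f i)) -> OK (\sum_(i <- r | P i) f i).
Proof. by move=> Af; elim/big_ind: _ => //; [exact: OK0 | exact: OKD]. Qed.

Lemma natK_neq0 n : (0 < n)%N -> n%:R != 0 :> K.
Proof.
move=> n0; rewrite -(rmorph_nat (in_alg K)) fmorph_eq0 pnatr_eq0.
by case: n n0.
Qed.

Lemma intK_eq0 (n : int) : (n%:~R == 0 :> K) = (n == 0).
Proof.
rewrite -(rmorph_int (in_alg K)) fmorph_eq0; exact: intr_eq0.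
Qed.

Lemma int_dependent (n : nat) (v : nat -> K) : (\dim {:K} < n)%N ->
  exists2 c : nat -> int, \sum_(i < n) (c i)%:~R * v i = 0 &
    exists2 i, (i < n)%N & c i != 0.
Proof.
move=> dn; have : ~~ free [tuple v i | i < n].
  apply: contraL dn; rewrite /free size_tuple => /eqP <-.
  by rewrite -leqNgt dimvS // subvf.
move=> nf; have [k [ek [i ki]]] : exists k : 'I_n -> rat,
    \sum_i k i *: v i = 0 /\ exists i, k i != 0.
  apply: contrapT => nk; case/negP: nf; apply/freeP => k ek i.
  apply: contrapT => /eqP ki; apply: nk; exists k; split; last by exists i.
  by rewrite -[RHS]ek; apply: eq_bigr => j _; rewrite -tnth_nth tnth_mktuple.
pose D : int := \prod_j denq (k j).
pose c (j : 'I_n) : int := numq (k j) * \prod_(l | l != j) denq (k l).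
have ec j : (c j)%:~R = k j * D%:~R.
  by rewrite /c /D [in RHS](bigD1 j) //= !intrM numqE mulrA.
have D0 : D != 0 by apply/prodf_neq0 => j _; exact: denq_neq0.
exists (fun j => if insub j is Some j then c j else 0).
  rewrite -[RHS](scaler0 _ (D%:~R : rat)) -[in RHS]ek scaler_sumr; apply: eq_bigr => j _.
  by rewrite valK mulrzl -(scaler_int _ (v j)) ec scalerA mulrC.
exists i => //; rewrite valK -(intr_eq0 rat) ec mulf_eq0 negb_or ki intr_eq0.
exact: D0.
Qed.

(** The powers of x satisfy an integer relation, and multiplying x by its leading coefficient l
    makes the relation monic. *)
Lemma OK_scale x : exists2 n : nat, (0 < n)%N & OK (n%:R * x).
Proof.
have [c ec [i0 i0n ci0]] := @int_dependent (\dim {:K}).+1 (GRing.exp x) (leqnn _).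
pose f : {poly K} := \poly_(i < (\dim {:K}).+1) (c i)%:~R.
have fx : f.[x] = 0 by rewrite horner_poly.
have f0 : f != 0.
  apply/eqP => e; move/(congr1 (fun p : {poly K} => p`_i0)): e.
  by rewrite coef_poly i0n coef0 => /eqP; rewrite intK_eq0 (negPf ci0).
have zf j : exists z : int, f`_j = z%:~R.
  by rewrite coef_poly; case: ifP => _; [exists (c j) | exists 0].
have [l el] := zf (size f).-1; rewrite -lead_coefE in el.
have l0 : (l%:~R != 0 :> K) by rewrite -el lead_coef_eq0.
have OKl : OK (l%:~R * x).
  case sf : (size f) => [|[|n]].
  - by move: f0; rewrite -size_poly_eq0 sf.
  - move/eqP: sf => /size_poly1P[a a0 ef]; move: fx a0.
    by rewrite ef hornerC => ->; rewrite eqxx.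
  (* This is l^n f(X / l), where f has degree n + 1 and leading coefficient l. *)
  pose g : {poly K} := 'X^(n.+1) + \poly_(i < n.+1) (f`_i * l%:~R ^+ (n - i)).
  have gm : g \is monic.
    apply/monicP; rewrite lead_coefDl ?lead_coefXn // size_polyXn ltnS.
    exact: size_poly.
  apply: (integral_root_monic gm).
    apply/rootP; rewrite hornerD hornerXn horner_poly.
    apply: (mulIf l0); rewrite mul0r -[RHS](mul0r (l%:~R ^+ n.+1)) -[in RHS]fx.
    rewrite horner_coef sf [in RHS]big_ord_recr /= mulrDl [RHS]mulrDl [RHS]addrC.
    congr (_ + _).
      have -> : f`_n.+1 = l%:~R by rewrite -el lead_coefE sf.
      by rewrite exprMn; ring.
    rewrite !mulr_suml; apply: eq_bigr => j _; rewrite exprMn.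
    have -> : l%:~R ^+ n.+1 = l%:~R ^+ (n - j) * l%:~R ^+ j * l%:~R :> K.
      by rewrite -exprD subnK ?exprSr // -ltnS.
    by ring.
  apply/integral_poly => j; rewrite /g coefD coefXn coef_poly.
  apply: integral_add; first exact: integral_nat.
  case: ifP => _; last exact: integral0.
  have [z ->] := zf j; apply: integral_mul; first exact: integral_id.
  by rewrite -rmorphXn; exact: integral_id.
exists `|l|%N; first by rewrite absz_gt0 -intK_eq0.
rewrite -[`|l|%:R]/((`|l|%N : int)%:~R) abszE.
have [lp|ln] := lerP 0 l; first by rewrite ger0_norm.
by rewrite ltr0_norm // rmorphN mulNr; apply: OKN.
Qed.

Lemma OK_inv_scale x : x != 0 -> OK x ->
  exists2 n : nat, (0 < n)%N & exists2 y, OK y & n%:R = x * y.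
Proof.
move=> x0 Ox; have [n n0 On] := OK_scale x^-1; exists n => //.
by exists (n%:R * x^-1) => //; rewrite mulrCA mulfV // mulr1.
Qed.

(* Independence of v_0, ..., v_{k-1} in OK / l OK over the prime field. *)
Definition indep (l k : nat) (v : nat -> K) := forall c : nat -> int,
  (exists2 w, OK w & \sum_(i < k) (c i)%:~R * v i = l%:R * w) ->
  forall i, (i < k)%N -> (l%:Z %| c i)%Z.

(** Descent: too many elements satisfy an integer relation, independence modulo l makes all its
    coefficients divisible by l, and dividing by l gives a smaller relation. *)
Lemma indep_bound l k v : prime l -> indep l k v -> (k <= \dim {:K})%N.
Proof.
move=> pl ind; rewrite leqNgt; apply/negP => dk.
have l0 := natK_neq0 (prime_gt0 pl).
have [c ec [i ik ci]] := int_dependent v dk.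
have [N] : exists N, (`|c i| <= N)%N by exists `|c i|%N.
elim: N c ec ci => [|N IH] c ec ci cN.
  by move: ci; rewrite -absz_eq0 -leqn0 cN.
have dv : forall j, (j < k)%N -> (l%:Z %| c j)%Z.
  by apply: ind; exists 0; [exact: OK0 | rewrite ec mulr0].
have ci' : (c i %/ l)%Z != 0.
  by apply: contra_neq ci => e; rewrite -(divzK (dv i ik)) e mul0r.
apply: (IH (fun j => (c j %/ l)%Z)) => //.
  apply: (mulfI l0); rewrite mulr0 -[RHS]ec mulr_sumr; apply: eq_bigr => j _.
  by rewrite -[in RHS](divzK (dv j (ltn_ord j))) intrM mulrA [l%:R * _]mulrC.
rewrite -ltnS (leq_trans _ cN) // -{2}(divzK (dv i ik)) abszM ltn_Pmulr //.
  exact: prime_gt1.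
by rewrite absz_gt0.
Qed.

Lemma indep_max l : prime l -> exists k v, [/\ forall i, OK (v i), indep l k v &
  forall y, OK y -> ~ indep l k.+1 (fun i => if i == k then y else v i)].
Proof.
move=> pl; suff main m : forall k v, (\dim {:K} - k <= m)%N ->
    (forall i, OK (v i)) -> indep l k v ->
    exists k v, [/\ forall i, OK (v i), indep l k v &
      forall y, OK y -> ~ indep l k.+1 (fun i => if i == k then y else v i)].
  apply: (main _ 0%N (fun=> 0) (leqnn _)); first by move=> _; exact: OK0.
  by move=> c _ i.
elim: m => [|m IH] k v dk Ov ind.
  exists k, v; split=> // y Oy /(indep_bound pl); rewrite leqNgt => /negP; apply.
  by rewrite ltnS -subn_eq0 -leqn0.
have [[y Oy iy]|nex] := pselect (exists2 y, OK y &
   indep l k.+1 (fun i => if i == k then y else v i)).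
  apply: (IH k.+1 _ _ _ iy); first by rewrite subnS; move: dk; lia.
  by move=> i; case: ifP.
by exists k, v; split=> // y Oy iy; apply: nex; exists y.
Qed.

(** Finiteness of OK / l OK without an integral basis. A maximal independent family generates the
    quotient: a relation involving y has a coefficient of y prime to l, so it can be solved for y
    modulo l, and coefficients between 0 and l - 1 suffice. *)
Lemma cover_prime l : prime l -> exists s : seq K, (forall r, r \in s -> OK r) /\
  forall y, OK y -> exists2 r, r \in s & exists2 w, OK w & y = r + l%:R * w.
Proof.
move=> pl; have [k [v [Ov ind mx]]] := indep_max pl.
have l0 := prime_gt0 pl.
pose comb (d : {ffun 'I_k -> 'I_l}) : K := \sum_i (d i)%:R * v i.
exists [seq comb d | d : {ffun 'I_k -> 'I_l}]; split.
  move=> _ /fintype.imageP[d _ ->]; apply: OK_sum => i _; apply: OKM => //; exact: OKn.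
move=> y Oy; have ny := mx y Oy.
have [c [w Ow ec] nc] : exists2 c : nat -> int,
    exists2 w, OK w & \sum_(i < k) (c i)%:~R * v i + (c k)%:~R * y = l%:R * w &
    ~~ (l%:Z %| c k)%Z.
  apply: contrapT => nex; apply: ny => c [w Ow ec].
  move: ec; rewrite big_ord_recr /= eqxx.
  have -> : \sum_(i < k) (c i)%:~R * (if i == k :> nat then y else v i) =
      \sum_(i < k) (c i)%:~R * v i.
    by apply: eq_bigr => i _; rewrite ltn_eqF.
  move=> ec.
  have [lk|nk] := boolP (l%:Z %| c k)%Z; last by case: nex; exists c => //; exists w.
  have lc : forall i, (i < k)%N -> (l%:Z %| c i)%Z.
    apply: ind; exists (w - (c k %/ l)%Z%:~R * y).
      by apply: OKB => //; apply: OKM => //; exact: OKz.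
    rewrite mulrBr -ec mulrA -[l%:R]/((l%:Z)%:~R) -rmorphM /= [_ * (_ %/ _)%Z]mulrC.
    by rewrite divzK // addrK.
  by move=> i; rewrite ltnS leq_eqVlt => /orP[/eqP->|/lc].
have /coprimezP[[a b] /= ab] : coprimez (c k) l%:Z.
  by rewrite coprimez_sym coprimezE /= prime_coprime //.
pose e (i : nat) : int := - (a * c i).
pose d := [ffun i : 'I_k => inord (`|(e i %% l)%Z|%N) : 'I_l.-1.+1].
have dl (i : 'I_k) : (`|(e i %% l)%Z| < l.-1.+1)%N.
  rewrite prednK // -ltz_nat abszE ger0_norm ?modz_ge0 ?ltz_pmod //.
  by rewrite -lt0n.
pose d' := [ffun i : 'I_k => cast_ord (prednK l0) (d i)].
exists (comb d'); first by apply/fintype.imageP; exists d'.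
exists (b%:~R * y + a%:~R * w + \sum_(i < k) (e i %/ l)%Z%:~R * v i).
  apply: OKD; first apply: OKD; try (apply: OKM => //; exact: OKz).
  by apply: OK_sum => i _; apply: OKM => //; exact: OKz.
have -> : comb d' = \sum_(i < k) (e i)%:~R * v i -
   l%:R * \sum_(i < k) (e i %/ l)%Z%:~R * v i.
  rewrite mulr_sumr -sumrB; apply: eq_bigr => i _.
  have e1 : (e i)%:~R = (e i %/ l)%Z%:~R * l%:R + (e i %% l)%Z%:~R :> K.
    by rewrite {1}(divz_eq (e i) l) intrD intrM.
  have e2 : (`|(e i %% l)%Z|%N)%:R = (e i %% l)%Z%:~R :> K.
    rewrite -[_%:R]/((`|(e i %% l)%Z|%N%:Z)%:~R) abszE ger0_norm // modz_ge0 //.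
    by rewrite -lt0n.
  by rewrite /d' /d !ffunE /= inordK // e2 e1; ring.
have y1 : y = (a * c k + b * l)%:~R * y by rewrite ab mul1r.
rewrite [LHS]y1 intrD !intrM mulrDr.
have -> : \sum_(i < k) (e i)%:~R * v i = - (a%:~R * (\sum_(i < k) (c i)%:~R * v i)).
  rewrite mulr_sumr -sumrN; apply: eq_bigr => i _.
  by rewrite /e rmorphN rmorphM /=; ring.
have -> : \sum_(i < k) (c i)%:~R * v i = l%:R * w - (c k)%:~R * y.
  by rewrite -ec addrK.
by rewrite -[l%:R]/((l%:Z)%:~R); ring.
Qed.

Lemma cover n : (0 < n)%N -> exists s : seq K, (forall r, r \in s -> OK r) /\
  forall y, OK y -> exists2 r, r \in s & exists2 w, OK w & y = r + n%:R * w.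
Proof.
have [m] := ubnP n; elim: m n => // m IH n nm n0.
have [n1|n1] := leqP n 1.
  have -> : n = 1%N by apply/eqP; rewrite eqn_leq n1.
  exists [:: 0]; split; first by move=> r; rewrite inE => /eqP ->; exact: OK0.
  move=> y Oy; exists 0; rewrite ?inE //; exists y => //.
  by rewrite add0r mul1r.
have pl := pdiv_prime n1; set l := pdiv n in pl.
have ne : n = (l * (n %/ l))%N by rewrite mulnC divnK // pdiv_dvd.
have q0 : (0 < n %/ l)%N by rewrite divn_gt0 ?prime_gt0 // dvdn_leq // pdiv_dvd.
have [s1 [O1 c1]] := cover_prime pl.
have [|s2 [O2 c2]] := IH (n %/ l)%N _ q0.
  by rewrite (leq_trans _ (_ : n <= m)%N) // ltn_Pdiv // prime_gt1.
exists [seq r1 + l%:R * r2 | r1 <- s1, r2 <- s2]; split.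
  move=> _ /allpairsP[[r1 r2] /= [m1 m2 ->]]; apply: OKD; first exact: O1.
  by apply: OKM; [exact: OKn | exact: O2].
move=> y /c1[r1 m1 [w1 Ow1 ->]]; have [r2 m2 [w2 Ow2 ->]] := c2 w1 Ow1.
exists (r1 + l%:R * r2); first by apply/allpairsP; exists (r1, r2).
have en : n%:R = l%:R * (n %/ l)%:R :> K by rewrite -natrM -ne.
by exists w2 => //; rewrite en mulrDr mulrA addrA.
Qed.

End RingOfIntegers.

(** * Multiplication of OK-submodules of K *)

Section Ideals.
Variable K : fieldExtType rat.
Implicit Types (x y z w : K) (I J L p q : set K).
Local Notation OK := (@ringOfIntegers K).

Definition is_mod I : Prop :=
  [/\ I 0, forall x y, I x -> I y -> I (x + y) & forall x y, OK x -> I y -> I (x * y)].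

Lemma ideal_mod I : is_ideal OK I -> is_mod I.
Proof. by case. Qed.

Lemma mod_OK : is_mod OK.
Proof. by split; [exact: OK0 | exact: OKD | exact: OKM]. Qed.

Lemma modN I x : is_mod I -> I x -> I (- x).
Proof.
by move=> [_ _ IM] Ix; rewrite -mulN1r; apply: IM => //; apply/OKN/OK1.
Qed.

Lemma modB I x y : is_mod I -> I x -> I y -> I (x - y).
Proof. by move=> mI Ix Iy; have [_ ID _] := mI; apply: ID => //; apply: modN. Qed.

Lemma mod_principal x : is_mod (principal_ideal OK x).
Proof.
split; first by exists 0; [exact: OK0 | rewrite mul0r].
  by move=> _ _ [y Oy <-] [z Oz <-]; exists (y + z); [exact: OKD | rewrite mulrDl].
by move=> y _ Oy [z Oz <-]; exists (y * z); [exact: OKM | rewrite mulrA].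
Qed.

Lemma ideal_mulP I J (Q : K -> Prop) : Q 0 -> (forall x y, Q x -> Q y -> Q (x + y)) ->
  (forall u v, I u -> J v -> Q (u * v)) -> forall x, ideal_mul I J x -> Q x.
Proof.
by move=> Q0 QD QM _ [n [u [v [Iu Jv ->]]]]; elim/big_ind: _ => // i _; apply: QM.
Qed.

Lemma ideal_mul_in I J u v : I u -> J v -> ideal_mul I J (u * v).
Proof.
move=> Iu Jv; exists 1%N, (fun=> u), (fun=> v); split=> //.
by rewrite big_ord1.
Qed.

Lemma ideal_mulD I J x y : ideal_mul I J x -> ideal_mul I J y -> ideal_mul I J (x + y).
Proof.
move=> [n [u [v [Iu Jv ->]]]] [m [u' [v' [Iu' Jv' ->]]]].
exists (n + m)%N, (fun i => match split i with inl j => u j | inr j => u' j end),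
  (fun i => match split i with inl j => v j | inr j => v' j end).
split; try by move=> i; case: (split i).
rewrite big_split_ord /=; congr (_ + _); apply: eq_bigr => i _.
  by rewrite -[lshift _ _]/(unsplit (inl i)) unsplitK.
by rewrite -[rshift _ _]/(unsplit (inr i)) unsplitK.
Qed.

Lemma ideal_mul0 I J : ideal_mul I J 0.
Proof.
by exists 0%N, (fun=> 0), (fun=> 0); split; [case | case | rewrite big_ord0].
Qed.

Lemma mod_mul I J : is_mod I -> is_mod (ideal_mul I J).
Proof.
move=> [_ _ IM]; split; [exact: ideal_mul0 | exact: ideal_mulD |].
move=> x y Ox; elim/ideal_mulP: y / => [|y z|u v Iu Jv].
- by rewrite mulr0; exact: ideal_mul0.
- by rewrite mulrDr; exact: ideal_mulD.
- by rewrite mulrA; apply: ideal_mul_in => //; apply: IM.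
Qed.

Lemma ideal_mul_sub I J L : is_mod L -> (forall u v, I u -> J v -> L (u * v)) ->
  ideal_mul I J `<=` L.
Proof. by move=> [L0 LD _] h x; apply: ideal_mulP. Qed.

Lemma ideal_mulC I J : ideal_mul I J = ideal_mul J I.
Proof.
apply/seteqP; split=> x; apply: ideal_mulP => [|*|u v Iu Jv].
- exact: ideal_mul0.
- exact: ideal_mulD.
- by rewrite mulrC; apply: ideal_mul_in.
- exact: ideal_mul0.
- exact: ideal_mulD.
- by rewrite mulrC; apply: ideal_mul_in.
Qed.

Lemma ideal_mulA_sub I J L :
  ideal_mul I (ideal_mul J L) `<=` ideal_mul (ideal_mul I J) L.
Proof.
move=> x; apply: ideal_mulP => [|*|u v Iu]; [exact: ideal_mul0 | exact: ideal_mulD |].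
elim/ideal_mulP: v / => [|v w|v w Jv Lw].
- by rewrite mulr0; exact: ideal_mul0.
- by rewrite mulrDr; exact: ideal_mulD.
- by rewrite mulrA; apply: ideal_mul_in => //; apply: ideal_mul_in.
Qed.

Lemma ideal_mulA I J L : ideal_mul I (ideal_mul J L) = ideal_mul (ideal_mul I J) L.
Proof.
apply/seteqP; split; first exact: ideal_mulA_sub.
rewrite (ideal_mulC _ L) (ideal_mulC I J) (ideal_mulC I) (ideal_mulC J L).
exact: ideal_mulA_sub.
Qed.

Lemma ideal_mul_OK I : is_mod I -> ideal_mul OK I = I.
Proof.
move=> mI; have [I0 ID IM] := mI; apply/seteqP; split; first exact: ideal_mul_sub.
by move=> x Ix; rewrite -(mul1r x); apply: ideal_mul_in => //; exact: OK1.
Qed.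

Lemma mod_inv I : is_mod (ideal_inv I).
Proof.
split.
- by move=> y _; rewrite mul0r; exact: OK0.
- by move=> x y hx hy z Iz; rewrite mulrDl; apply: OKD; [exact: hx | exact: hy].
- by move=> x y Ox hy z Iz; rewrite -mulrA; apply: OKM => //; exact: hy.
Qed.

(** * Noetherian induction *)

Definition nonzero I := exists2 x, I x & x != 0.

Lemma ideal_nat I : is_ideal OK I -> nonzero I -> exists2 n : nat, (0 < n)%N & I n%:R.
Proof.
move=> [IO _ _ IM] [x Ix x0]; have [n n0 [y Oy e]] := OK_inv_scale x0 (IO x Ix).
by exists n => //; rewrite e mulrC; apply: IM.
Qed.

(** All ideals above I contain a positive integer n, so they are unions of classes modulo n. By
    [cover] there are finitely many classes, and a strictly larger ideal contains strictly more of
    the chosen representatives. *)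
Lemma ideal_noether (Q : set K -> Prop) :
  (forall I, is_ideal OK I -> nonzero I ->
     (forall J, is_ideal OK J -> I `<=` J -> ~ J `<=` I -> Q J) -> Q I) ->
  forall I, is_ideal OK I -> nonzero I -> Q I.
Proof.
move=> step I iI nI; have [n n0 In] := ideal_nat iI nI.
have [s [Os cs]] := cover K n0.
pose c J := count (fun r => `[< J r >]) s.
have [m cm] : exists m, (size s - c I < m)%N by exists (size s - c I).+1.
have main : forall k J, (size s - c J < k)%N -> is_ideal OK J -> J n%:R -> Q J.
  elim=> // k IH J cJ iJ Jn; apply: step => //.
    by exists n%:R => //; apply: natK_neq0.
  move=> L iL JL nLJ; have Ln := JL _ Jn; apply: IH => //.
  suff : (c J < c L)%N by move: cJ (count_size (fun r => `[< L r >]) s); rewrite -/(c L); lia.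
  have [x Lx nJx] : exists2 x, L x & ~ J x.
    by apply: contrapT => ne; apply: nLJ => x Lx; apply: contrapT => nJ; apply: ne; exists x.
  have [LO _ LD LM] := iL; have [JO _ JD JM] := iJ.
  have [r rs [w Ow ex]] := cs x (LO x Lx).
  have Lr : L r.
    have -> : r = x - w * n%:R by rewrite ex; ring.
    by apply: modB => //; [exact: ideal_mod | apply: LM].
  have nJr : ~ J r.
    by move=> Jr; apply: nJx; rewrite ex; apply: JD => //; rewrite mulrC; apply: JM.
  rewrite /c.
  have -> : count (fun r => `[< L r >]) s = (count (fun r => `[< J r >]) s +
      count (fun r => `[< L r >] && ~~ `[< J r >]) s)%N.
    rewrite -count_predUI addnC.
    rewrite [X in (X + _)%N](_ : _ = 0%N) ?add0n.
      apply: eq_count => z /=; apply/idP/idP => [Lz|/orP[/asboolP Jz|/andP[]//]].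
        by rewrite Lz /=; case: asboolP.
      exact/asboolP/JL.
    rewrite (@eq_count _ _ pred0) ?count_pred0 // => z /=.
    by case: asboolP => //=; rewrite andbF.
  rewrite -[X in (X < _)%N]addn0 ltn_add2l -has_count; apply/hasP; exists r => //.
  by apply/andP; split; [apply/asboolP | apply/asboolPn].
exact: (main m).
Qed.

End Ideals.

(** * Maximality and invertibility of primes *)

Section Primes.
Variable K : fieldExtType rat.
Implicit Types (x y z w r s : K) (I J L p q : set K).
Local Notation OK := (@ringOfIntegers K).

Lemma prime_nonzero p : is_prime p -> nonzero p.
Proof.
move=> [[_ p0 _ _] pn0 _ _]; apply: contrapT => np; move/eqP: pn0; apply.
apply/seteqP; split=> x /=; last by move=> ->.
by move=> px; apply: contrapT => /eqP x0; apply: np; exists x.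
Qed.

(** A finite domain is a field: two powers of s agree modulo some n in p, and cancelling the smaller
    one makes a power of s equal to 1 modulo p. *)
Lemma prime_maximal p s : is_prime p -> OK s -> ~ p s ->
  exists2 r, OK r & p (r * s - 1).
Proof.
move=> pp Os ns; have [[pO p0 pD pM] _ _ prm] := pp.
have [n n0 pn] := ideal_nat (let: And4 h _ _ _ := pp in h) (prime_nonzero pp).
have [l [Ol cl]] := cover K n0.
have /choice[f hf] : forall i, exists j, (j < size l)%N /\
    exists2 w, OK w & s ^+ i = l`_j + n%:R * w.
  move=> i.
  have [r rl [w Ow e]] := cl _ (OKX i Os).
  by exists (index r l); rewrite index_mem nth_index //; split=> //; exists w.
pose g (i : 'I_(size l).+1) := Ordinal (proj1 (hf i)).
have /injectivePn[i [j ij gij]] : ~~ injectiveb g.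
  by apply/negP => /injectiveP/leq_card; rewrite !card_ord ltnn.
wlog {ij}ij : i j gij / (i < j)%N.
  move=> H; have [?|?|e] := ltngtP i j; [exact: (H i j) | exact: (H j i) |].
  by case/eqP: ij; apply: val_inj.
have [_ [w1 O1 e1]] := hf i; have [_ [w2 O2 e2]] := hf j.
have ff : f i = f j by have := congr1 val gij.
have pij : p (s ^+ i * (s ^+ (j - i) - 1)).
  have -> : s ^+ i * (s ^+ (j - i) - 1) = (w2 - w1) * n%:R.
    rewrite mulrBr mulr1 -exprD subnKC ?(ltnW ij) // e1 e2 ff; ring.
  by apply: pM => //; apply: OKB.
exists (s ^+ (j - i).-1); first exact: OKX.
rewrite -exprSr prednK ?subn_gt0 //.
case: (prm _ _ (OKX i Os) (OKB (OKX (j - i) Os) (OK1 K)) pij) => //.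
move=> psi; exfalso; elim: (nat_of_ord i) psi => [|k IH].
  by rewrite expr0 => p1; case: pp.
by rewrite exprS => /(prm _ _ Os (OKX k Os))[/ns|/IH].
Qed.

Lemma prime_sub_eq p q : is_prime p -> is_prime q -> q `<=` p -> q = p.
Proof.
move=> pp pq qp; apply/seteqP; split=> // x px; apply: contrapT => nqx.
have [[pO _ pD pM] _ n1 _] := pp.
have [r Or qr] := prime_maximal pq (pO x px) nqx; apply: n1.
have -> : 1 = r * x - (r * x - 1) by ring.
by apply: modB; [split=> //; case: pp => -[] | apply: pM | exact: qp].
Qed.

Definition ideal_adjoin I a : set K := [set x | exists i r, [/\ I i, OK r & x = i + r * a]].

Lemma ideal_adjoinP I a : is_ideal OK I -> OK a ->
  [/\ is_ideal OK (ideal_adjoin I a), I `<=` ideal_adjoin I a & ideal_adjoin I a a].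
Proof.
move=> [IO I0 ID IM] Oa; split.
- split.
  + move=> _ [i [r [Ii Or ->]]]; apply: OKD; [exact: IO | exact: OKM].
  + by exists 0, 0; rewrite mul0r addr0; split=> //; exact: OK0.
  + move=> _ _ [i [r [Ii Or ->]]] [j [s [Ij Os ->]]]; exists (i + j), (r + s).
    by split; [exact: ID | exact: OKD | ring].
  + move=> x _ Ox [i [r [Ii Or ->]]]; exists (x * i), (x * r).
    by split; [exact: IM | exact: OKM | ring].
- by move=> x Ix; exists x, 0; rewrite mul0r addr0; split=> //; exact: OK0.
- by exists 0, 1; rewrite mul1r add0r; split=> //; exact: OK1.
Qed.

Lemma nonzero_sub I J : nonzero I -> I `<=` J -> nonzero J.
Proof. by move=> [x Ix x0] IJ; exists x => //; apply: IJ. Qed.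

Lemma ideal_one I : is_ideal OK I -> I 1 -> I = OK.
Proof.
move=> [IO _ _ IM] I1; apply/seteqP; split=> // x Ox.
by rewrite -(mulr1 x); apply: IM.
Qed.

Lemma nonprime I : is_ideal OK I -> nonzero I -> ~ I 1 -> ~ is_prime I ->
  exists a b, [/\ OK a, OK b, ~ I a, ~ I b & I (a * b)].
Proof.
move=> iI [x Ix x0] n1 np; apply: contrapT => ne; apply: np; split=> //.
  by apply/eqP => e; move: Ix x0; rewrite e => /= ->; rewrite eqxx.
move=> a b Oa Ob Iab; apply: contrapT => /not_orP[na nb]; apply: ne.
by exists a, b.
Qed.

Lemma ideal_in_prime I : is_ideal OK I -> nonzero I -> ~ I 1 ->
  exists2 p, is_prime p & I `<=` p.
Proof.
move: I; apply: ideal_noether => I iI nI IH n1.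
have [pI|npI] := pselect (is_prime I); first by exists I.
have [a [b [Oa Ob na nb Iab]]] := nonprime iI nI n1 npI.
have [iJ IJ Ja] := ideal_adjoinP iI Oa.
have nJ1 : ~ ideal_adjoin I a 1.
  move=> [i [r [Ii Or e1]]]; apply: nb; have [_ _ ID IM] := iI.
  have -> : b = b * i + r * (a * b) by rewrite -{1}(mulr1 b) e1; ring.
  by apply: ID; apply: IM.
have [p pp Jp] := IH _ iJ IJ (fun h => na (h a Ja)) nJ1.
by exists p => // x /IJ/Jp.
Qed.

Lemma ideal_acc (f : nat -> set K) : (forall k, is_ideal OK (f k)) ->
  nonzero (f 0%N) -> (forall k, f k `<=` f k.+1) -> exists k, f k.+1 `<=` f k.
Proof.
move=> idf nf ch; suff main I : is_ideal OK I -> nonzero I -> forall f : nat -> set K,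
    f 0%N = I -> (forall k, is_ideal OK (f k)) -> (forall k, f k `<=` f k.+1) ->
    exists k, f k.+1 `<=` f k by exact: (main (f 0%N)).
move: {f idf nf ch} I; apply: ideal_noether => I iI nI IH f e0 idf ch.
have [f10|nf10] := pselect (f 1%N `<=` f 0%N); first by exists 0%N.
have I1 : I `<=` f 1%N by rewrite -e0.
have n1 : ~ f 1%N `<=` I by rewrite -e0.
have [k hk] := IH _ (idf 1%N) I1 n1 (fun k => f k.+1) erefl
  (fun k => idf k.+1) (fun k => ch k.+1).
by exists k.+1.
Qed.

(** The ideals a (OK + OK x + ... + OK x^k) all lie in I, so the ascending chain stops, and the
    first repetition is a monic equation for x. No determinants are needed. *)
Lemma stable_integral I x : is_ideal OK I -> nonzero I ->
  (forall y, I y -> I (x * y)) -> OK x.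
Proof.
move=> [IO I0 ID IM] [a Ia a0] Ix.
have Ixn k y : I y -> I (x ^+ k * y).
  move=> Iy; elim: k => [|k IH]; first by rewrite expr0 mul1r.
  by rewrite exprS -mulrA; apply: Ix.
pose J k : set K := [set y | exists2 r : nat -> K, forall i, OK (r i) &
  y = a * \sum_(i < k.+1) r i * x ^+ i].
have [|||k hk] := @ideal_acc J.
- move=> k; split.
  + move=> _ [r Or ->]; rewrite mulr_sumr; apply: OK_sum => i _; apply: IO.
    by rewrite mulrCA; apply: IM => //; rewrite mulrC; apply: Ixn.
  + exists (fun=> 0); first by move=> _; exact: OK0.
    by rewrite big1 ?mulr0 // => i _; rewrite mul0r.
  + move=> _ _ [r Or ->] [s Os ->]; exists (fun i => r i + s i).
      by move=> i; apply: OKD.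
    by rewrite -mulrDr -big_split /=; congr (_ * _); apply: eq_bigr => i _; rewrite mulrDl.
  + move=> z _ Oz [r Or ->]; exists (fun i => z * r i); first by move=> i; apply: OKM.
    rewrite mulrCA mulr_sumr; congr (_ * _); apply: eq_bigr => i _.
    by rewrite mulrA.
- exists a => //; exists (fun=> 1); first by move=> _; exact: OK1.
  by rewrite big_ord1 expr0 !mulr1.
- move=> k _ [r Or ->]; exists (fun i => if (i < k.+1)%N then r i else 0).
    by move=> i; case: ifP => // _; exact: OK0.
  rewrite [in RHS]big_ord_recr /= ltnn mul0r addr0; congr (_ * _).
  by apply: eq_bigr => i _; rewrite ltn_ord.
have [|r Or] := hk (a * x ^+ k.+1).
  exists (fun i => (i == k.+1)%:R); first by move=> i; exact: OKn.
  rewrite big_ord_recr /= eqxx mul1r big1 ?add0r // => i _.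
  by rewrite ltn_eqF // mul0r.
move=> /(mulfI a0) e.
pose f : {poly K} := 'X^(k.+1) - \poly_(i < k.+1) r i.
apply: (@integral_root_monic _ _ _ _ f).
- apply/monicP; rewrite lead_coefDl ?lead_coefXn // size_polyN size_polyXn ltnS.
  exact: size_poly.
- by apply/rootP; rewrite hornerD hornerN hornerXn horner_poly e subrr.
- apply/integral_poly => i; rewrite coefB coefXn coef_poly.
  apply: integral_sub; first exact: integral_nat.
  by case: ifP => _; [exact: Or | exact: integral0].
Qed.

Definition ideal_prod (l : seq (set K)) : set K := foldr (@ideal_mul K) OK l.

Lemma mod_ideal_prod l : (forall q, q \in l -> is_prime q) -> is_mod (ideal_prod l).
Proof.
case: l => [|q l] pl; first exact: mod_OK.
by apply/mod_mul/ideal_mod; case: (pl q); rewrite ?inE ?eqxx.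
Qed.

Lemma contains_prime_prod I : is_ideal OK I -> nonzero I ->
  exists2 l, forall q, q \in l -> is_prime q & ideal_prod l `<=` I.
Proof.
move: I; apply: ideal_noether => I iI nI IH.
have [I1|n1] := pselect (I 1); first by exists [::] => //=; rewrite (ideal_one iI).
have [pI|npI] := pselect (is_prime I).
  exists [:: I] => [q|]; first by rewrite inE => /eqP ->.
  by rewrite /= ideal_mulC ideal_mul_OK //; exact: ideal_mod.
have [a [b [Oa Ob na nb Iab]]] := nonprime iI nI n1 npI.
have [iJ IJ Ja] := ideal_adjoinP iI Oa; have [iL IL Lb] := ideal_adjoinP iI Ob.
have [l1 p1 s1] := IH _ iJ IJ (fun h => na (h a Ja)).
have [l2 p2 s2] := IH _ iL IL (fun h => nb (h b Lb)).
exists (l1 ++ l2) => [q|]; first by rewrite mem_cat => /orP[/p1|/p2].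
have -> : ideal_prod (l1 ++ l2) = ideal_mul (ideal_prod l1) (ideal_prod l2).
  elim: (l1) => [|q l IHl] /=; first by rewrite ideal_mul_OK //; exact: mod_ideal_prod.
  by rewrite IHl ideal_mulA.
apply: ideal_mul_sub; first exact: ideal_mod.
move=> u v /s1[i [r [Ii Or ->]]] /s2[j [s [Ij Os ->]]].
have [IO _ ID IM] := iI.
have -> : (i + r * a) * (j + s * b) = (j + s * b) * i + (r * a) * j + (r * s) * (a * b).
  by ring.
apply: (ID); last by apply: IM => //; apply: OKM.
apply: (ID); apply: IM => //; last exact: OKM.
by apply: OKD; [exact: IO | exact: OKM].
Qed.

Lemma prime_mul p I J : is_prime p -> is_mod I -> I `<=` OK -> J `<=` OK ->
  ideal_mul I J `<=` p -> ~ I `<=` p -> J `<=` p.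
Proof.
move=> [_ _ _ prm] mI IO JO IJp nIp v Jv; apply: contrapT => nv; apply: nIp => u Iu.
by case: (prm u v (IO _ Iu) (JO _ Jv)) => //; apply: IJp; apply: ideal_mul_in.
Qed.

Lemma ideal_prod_sub l : (forall q, q \in l -> is_prime q) -> ideal_prod l `<=` OK.
Proof.
elim: l => [|q l IH] pl; first exact: subset_refl.
apply: ideal_mul_sub; first exact: mod_OK.
move=> u v qu lv; apply: OKM.
  by have [[qO _ _ _] _ _ _] := pl q (mem_head _ _); exact: (qO u).
by apply: (IH _ v lv) => q' ql; apply: pl; rewrite inE ql orbT.
Qed.

Lemma prime_prod p l : is_prime p -> (forall q, q \in l -> is_prime q) ->
  ideal_prod l `<=` p -> p \in l.
Proof.
move=> pp; elim: l => [|q l IH] pl /= lp.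
  by have [_ _ n1 _] := pp; case: n1; apply: lp; exact: OK1.
have pq := pl q (mem_head _ _); rewrite inE.
have [qp|nqp] := pselect (q `<=` p).
  by rewrite (prime_sub_eq pp pq qp) eqxx.
have pl' q' : q' \in l -> is_prime q' by move=> ql; apply: pl; rewrite inE ql orbT.
apply/orP; right; apply: IH => //.
have [qO _ _ _] := let: And4 h _ _ _ := pq in h.
apply: (prime_mul pp (ideal_mod (let: And4 h _ _ _ := pq in h)) qO _ lp nqp).
exact: ideal_prod_sub.
Qed.

Lemma ideal_prod_rem p l : p \in l -> (forall q, q \in l -> is_prime q) ->
  ideal_prod l = ideal_mul p (ideal_prod (rem p l)).
Proof.
elim: l => //= q l IH; rewrite inE => /predU1P[->|pl] hl; first by rewrite eqxx.
have hl' q' : q' \in l -> is_prime q' by move=> ql; apply: hl; rewrite inE ql orbT.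
case: eqP => [->//|_] /=; rewrite IH // !ideal_mulA; congr (ideal_mul _ _).
exact: ideal_mulC.
Qed.

(** Take a in p and a product of primes inside (a) that cannot be shortened by removing p. One
    factor is p; an element b of the product of the others that is not in (a) gives b / a. *)
Lemma prime_inv_extra p : is_prime p -> exists2 x, ideal_inv p x & ~ OK x.
Proof.
move=> pp; have [a pa a0] := prime_nonzero pp; have [[pO p0 pD pM] _ _ _] := pp.
have Oa := pO a pa.
have iA : is_ideal OK (principal_ideal OK a).
  have [? ? ?] := mod_principal a; split=> // _ [y Oy <-]; exact: OKM.
have [l pl la] : exists2 l, forall q, q \in l -> is_prime q &
    ideal_prod l `<=` principal_ideal OK a.
  apply: contains_prime_prod => //; exists a => //; exists 1; rewrite ?mul1r //.
  exact: OK1.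
have [m] := ubnP (size l); elim: m l pl la => // m IH l pl la sl.
have Ap : principal_ideal OK a `<=` p by move=> _ [y Oy <-]; apply: pM.
have pinl : p \in l by apply: prime_prod => // x /la/Ap.
have pr q : q \in rem p l -> is_prime q by move=> /mem_rem/pl.
have [ra|nra] := pselect (ideal_prod (rem p l) `<=` principal_ideal OK a).
  apply: (IH (rem p l)) => //; rewrite size_rem //.
  by case: (l) pinl sl.
have [b lb nb] : exists2 b, ideal_prod (rem p l) b & ~ principal_ideal OK a b.
  by apply: contrapT => ne; apply: nra => x lx; apply: contrapT => nx; apply: ne; exists x.
exists (b / a).
  move=> y py; have [] := la (y * b).
    by rewrite (ideal_prod_rem pinl pl); apply: ideal_mul_in.
  move=> z Oz e; have -> : b / a * y = z; last by [].
  by apply: (mulIf a0); rewrite mulrAC divfK // mulrC.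
by move=> Oba; apply: nb; exists (b / a) => //; rewrite divfK.
Qed.

(** Let x be an element of the inverse that is not integral. If x p were inside p, then x would be
    integral by [stable_integral]. So some x y lies outside p, is invertible modulo p, and yields
    1. *)
Lemma prime_mul_inv p : is_prime p -> ideal_mul p (ideal_inv p) = OK.
Proof.
move=> pp; have [ip _ n1 _] := pp; have [pO p0 pD pM] := ip.
have [x ix nx] := prime_inv_extra pp.
have iJ : is_ideal OK (ideal_mul p (ideal_inv p)).
  have [? ? ?] := mod_mul (ideal_inv p) (ideal_mod ip); split=> //.
  apply: ideal_mul_sub; first exact: mod_OK.
  by move=> u v pu iv; rewrite mulrC; apply: iv.
apply: ideal_one => //; apply: contrapT => nJ1.
apply: nx; apply: (stable_integral ip (prime_nonzero pp)) => y py.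
apply: contrapT => npxy; apply: nJ1.
have Oxy : OK (x * y) by apply: ix.
have [r Or pr] := prime_maximal pp Oxy npxy.
have [_ _ JD JM] := iJ.
have -> : 1 = r * (y * x) - (r * (x * y) - 1) * 1 by ring.
apply: modB; first exact: ideal_mod.
  by apply: JM => //; apply: ideal_mul_in.
by apply: ideal_mul_in => // z pz; rewrite mul1r; apply: pO.
Qed.

End Primes.

(** * Localization at a prime *)

Section Localization.
Variable K : fieldExtType rat.
Implicit Types (x y z w : K) (I J L p q : set K).
Local Notation OK := (@ringOfIntegers K).

(** The multiplier y expresses that u is not in p^2: it makes u y an integer outside p, so y serves
    as a local inverse of u. *)
Definition unif p : set K := [set u | p u /\ exists2 y, ideal_inv p y & ~ p (u * y)].
Definition uniformizer p : K := xget 0 (unif p).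

Definition locI p I : set K := [set x | exists s, [/\ OK s, ~ p s & I (s * x)]].
Definition loc p : set K := locI p OK.

(* The localization of I at p is generated by the e-th power of a uniformizer. *)
Definition hasval p I (e : int) : Prop := forall x, locI p I x <-> loc p (x * uniformizer p ^ (- e)).

Section OnePrime.
Variable p : set K.
Hypothesis pp : is_prime p.

Let ip : is_ideal OK p. Proof. by case: pp. Qed.

(** Since p is invertible, p differs from p^2. If u in p \ p^2 had all its multiples by the inverse
    of p inside p, then u would lie in u p p^-1, which is contained in p^2. *)
Lemma uniformizerP : unif p (uniformizer p).
Proof.
have [pO p0 pD pM] := ip; apply: xgetPex.
have [u pu npu] : exists2 u, p u & ~ ideal_mul p p u.
  apply: contrapT => ne; have pp2 : p `<=` ideal_mul p p.
    by move=> u pu; apply: contrapT => nu; apply: ne; exists u.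
  have [_ _ n1 _] := pp; apply: n1.
  have : ideal_mul (ideal_mul p p) (ideal_inv p) 1.
    have : ideal_mul p (ideal_inv p) 1 by rewrite prime_mul_inv //; exact: OK1.
    apply: ideal_mulP => [|*|u v pu iv]; [exact: ideal_mul0 | exact: ideal_mulD |].
    by apply: ideal_mul_in => //; apply: pp2.
  by rewrite -ideal_mulA prime_mul_inv // ideal_mulC ideal_mul_OK //; exact: ideal_mod.
exists u; split=> //; apply: contrapT => ne; apply: npu.
suff key v : ideal_mul p (ideal_inv p) v -> ideal_mul p p (u * v).
  by rewrite -(mulr1 u); apply: key; rewrite prime_mul_inv //; exact: OK1.
elim/ideal_mulP: v / => [|v w hv hw|v w pv iw].
- by rewrite mulr0; exact: ideal_mul0.
- by rewrite mulrDr; exact: ideal_mulD.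
- have -> : u * (v * w) = v * (u * w) by ring.
  by apply: ideal_mul_in => //; apply: contrapT => nuw; apply: ne; exists w.
Qed.

Local Notation u := (uniformizer p).

Lemma unif_neq0 : u != 0.
Proof.
have [pu [y _ nuy]] := uniformizerP; apply/eqP => u0; apply: nuy.
by rewrite u0 mul0r; case: ip.
Qed.

Lemma nprimeM s t : OK s -> OK t -> ~ p s -> ~ p t -> ~ p (s * t).
Proof. by have [_ _ _ prm] := pp => Os Ot ns nt /(prm _ _ Os Ot)[]. Qed.

Lemma nprime1 : ~ p 1. Proof. by case: pp. Qed.

Lemma loc_OK x : OK x -> loc p x.
Proof. by move=> Ox; exists 1; rewrite mul1r; split=> //; [exact: OK1 | exact: nprime1]. Qed.

Lemma locD x y : loc p x -> loc p y -> loc p (x + y).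
Proof.
move=> [s [Os ns Osx]] [t [Ot nt Oty]]; exists (s * t); split.
- exact: OKM.
- exact: nprimeM.
- have -> : s * t * (x + y) = t * (s * x) + s * (t * y) by ring.
  by apply: OKD; apply: OKM.
Qed.

Lemma locM x y : loc p x -> loc p y -> loc p (x * y).
Proof.
move=> [s [Os ns Osx]] [t [Ot nt Oty]]; exists (s * t); split.
- exact: OKM.
- exact: nprimeM.
- by rewrite mulrACA; apply: OKM.
Qed.

Lemma locN x : loc p x -> loc p (- x).
Proof. by move=> [s [Os ns Osx]]; exists s; split=> //; rewrite mulrN; apply: OKN. Qed.

Lemma loc_inv s : OK s -> ~ p s -> loc p s^-1.
Proof.
move=> Os ns; exists s; split=> //; rewrite mulfV; first exact: OK1.
by apply/eqP => s0; apply: ns; rewrite s0; case: ip.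
Qed.

Lemma loc_prime x : loc p (x * u^-1) <-> exists s, [/\ OK s, ~ p s & p (s * x)].
Proof.
have u0 := unif_neq0; have [pu [y iy nuy]] := uniformizerP; have [pO p0 pD pM] := ip.
split=> [[s [Os ns Oxu]]|[s [Os ns psx]]].
  exists s; split=> //; have -> : s * x = (s * (x * u^-1)) * u by rewrite mulrA divfK.
  exact: pM.
have Ouy : OK (u * y) by rewrite mulrC; apply: iy.
exists (s * (u * y)); split; [exact: OKM | exact: nprimeM |].
have -> : s * (u * y) * (x * u^-1) = y * (s * x) by field.
exact: iy.
Qed.

Lemma nloc_inv_unif : ~ loc p u^-1.
Proof.
rewrite -(mul1r u^-1) loc_prime => -[s [Os ns]]; rewrite mulr1; exact: ns.
Qed.

Lemma loc_unif : loc p u.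
Proof. by apply: loc_OK; have [pu _] := uniformizerP; have [pO _ _ _] := ip; apply: pO. Qed.

Lemma loc_exp e : loc p (u ^ e) <-> 0 <= e.
Proof.
case: e => n.
  split=> // _; rewrite -exprnP; elim: n => [|n IH].
    by rewrite expr0; apply/loc_OK/OK1.
  by rewrite exprS; apply: locM => //; exact: loc_unif.
split=> //; rewrite NegzE -exprnN => l; exfalso; apply: nloc_inv_unif.
have -> : u^-1 = u ^- n.+1 * u ^+ n.
  by rewrite exprS invfM -mulrA mulVf ?mulr1 // expf_neq0 // unif_neq0.
apply: locM => //; elim: (n) => [|k IH]; first by rewrite expr0; apply/loc_OK/OK1.
by rewrite exprS; apply: locM => //; exact: loc_unif.
Qed.

Lemma unif_expD e f : u ^ (e + f) = u ^ e * u ^ f.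
Proof. exact/expfzDr/unif_neq0. Qed.

Lemma unif_expN e : u ^ e * u ^ (- e) = 1.
Proof. by rewrite -unif_expD subrr expr0z. Qed.

Lemma unif_exp_neq0 e : u ^ e != 0.
Proof. exact/expfz_neq0/unif_neq0. Qed.

Lemma hasval_uniq I e f : hasval p I e -> hasval p I f -> e = f.
Proof.
have key e' f' : hasval p I e' -> hasval p I f' -> f' <= e'.
  move=> h1 h2; have /h1/h2 : loc p (u ^ e' * u ^ (- e')).
    by rewrite unif_expN; apply/loc_OK/OK1.
  by rewrite -unif_expD loc_exp subr_ge0.
by move=> h1 h2; apply/le_anti/andP; split; apply: key.
Qed.

Lemma hasval_OK : hasval p OK 0.
Proof. by move=> x; rewrite oppr0 expr0z mulr1. Qed.

Lemma hasval_mul I J e f : hasval p I e -> hasval p J f ->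
  hasval p (ideal_mul I J) (e + f).
Proof.
move=> hI hJ x; split=> [[s [Os ns]]|lx].
  have key : forall y, ideal_mul I J y -> loc p (y * u ^ (- (e + f))).
    apply: ideal_mulP => [|y z ly lz|v w Iv Jw].
    - by rewrite mul0r; apply/loc_OK/OK0.
    - by rewrite mulrDl; apply: locD.
    - rewrite opprD unif_expD mulrACA; apply: locM.
        by apply/hI; exists 1; rewrite mul1r; split=> //; [exact: OK1 | exact: nprime1].
      by apply/hJ; exists 1; rewrite mul1r; split=> //; [exact: OK1 | exact: nprime1].
  move=> /key l; have -> : x * u ^ (- (e + f)) = s^-1 * (s * x * u ^ (- (e + f))).
    rewrite !mulrA mulVf ?mul1r //; apply/eqP => s0; apply: ns.
    by rewrite s0; case: ip.
  by apply: locM => //; apply: loc_inv.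
have /hI[s [Os ns Is]] : loc p (u ^ e * u ^ (- e)).
  by rewrite unif_expN; apply/loc_OK/OK1.
have /hJ[t [Ot nt Jt]] : loc p (x * u ^ (- e) * u ^ (- f)).
  by rewrite -mulrA -unif_expD -opprD.
exists (s * t); split; [exact: OKM | exact: nprimeM |].
have -> : s * t * x = (s * u ^ e) * (t * (x * u ^ (- e))).
  by rewrite -{1}(mulr1 x) -(unif_expN e); ring.
exact: ideal_mul_in.
Qed.

Lemma hasval_prime : hasval p p 1.
Proof. by move=> x; split=> [h|/(loc_prime x) h]; [apply/(loc_prime x)|]. Qed.

Lemma hasval_inv_prime : hasval p (ideal_inv p) (- 1).
Proof.
have [pu [y iy nuy]] := uniformizerP; have [pO p0 pD pM] := ip.
have Ouy : OK (u * y) by rewrite mulrC; apply: iy.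
move=> x; rewrite opprK expr1z; split=> -[s [Os ns]].
  by move=> isx; exists s; split=> //; rewrite mulrA; apply: isx.
move=> Osx; exists (s * (u * y)); split; [exact: OKM | exact: nprimeM |].
have -> : s * (u * y) * x = (s * (x * u)) * y by ring.
by have [_ _ M] := mod_inv p; apply: M.
Qed.

Lemma hasval_other q : is_prime q -> q != p -> hasval p q 0.
Proof.
move=> pq qp; have [[qO q0 qD qM] _ _ _] := pq.
have [t qt npt] : exists2 t, q t & ~ p t.
  apply: contrapT => ne; move/eqP: qp; apply; apply: prime_sub_eq => //.
  by move=> t qt; apply: contrapT => nt; apply: ne; exists t.
move=> x; rewrite oppr0 expr0z mulr1; split=> -[s [Os ns h]].
  by exists s; split=> //; apply: qO.
exists (t * s); split; [by apply: OKM => //; apply: qO | |].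
  by apply: nprimeM => //; apply: qO.
by rewrite -mulrA mulrC; apply: qM.
Qed.

Lemma hasval_inv_other q : is_prime q -> q != p -> hasval p (ideal_inv q) 0.
Proof.
move=> pq qp; have [[qO q0 qD qM] _ _ _] := pq.
have [t qt npt] : exists2 t, q t & ~ p t.
  apply: contrapT => ne; move/eqP: qp; apply; apply: prime_sub_eq => //.
  by move=> t qt; apply: contrapT => nt; apply: ne; exists t.
move=> x; rewrite oppr0 expr0z mulr1; split=> -[s [Os ns h]].
  exists (s * t); split; [by apply: OKM => //; apply: qO | |].
    by apply: nprimeM => //; apply: qO.
  by rewrite mulrAC; apply: h.
by exists s; split=> // z qz; apply: OKM => //; apply: qO.
Qed.

Lemma hasval_principal x e : x != 0 ->
  hasval p (principal_ideal OK x) e <-> loc p (x * u ^ (- e)) /\ loc p (x^-1 * u ^ e).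
Proof.
move=> x0; split=> [h|[l1 l2] y].
  split.
    apply/h; exists 1; split; [exact: OK1 | exact: nprime1 |].
    by exists 1; rewrite ?mul1r //; exact: OK1.
  have /h[s [Os ns [a Oa ea]]] : loc p (u ^ e * u ^ (- e)).
    by rewrite unif_expN; apply/loc_OK/OK1.
  by exists s; split=> //; rewrite mulrCA -ea mulrC mulfK.
split=> [[s [Os ns [a Oa ea]]]|ly].
  have s0 : s != 0 by apply/eqP => s0; apply: ns; rewrite s0; case: ip.
  have -> : y = s^-1 * a * x by rewrite -mulrA ea mulKf.
  rewrite -[_ * u ^ _]mulrA; apply: locM => //; apply: locM; [exact: loc_inv | exact: loc_OK].
have : loc p ((y * u ^ (- e)) * (x^-1 * u ^ e)) by apply: locM.
have -> : (y * u ^ (- e)) * (x^-1 * u ^ e) = y / x * (u ^ e * u ^ (- e)) by ring.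
rewrite unif_expN mulr1 => -[s [Os ns Osy]]; exists s; split=> //.
by exists (s * (y / x)) => //; rewrite -mulrA divfK.
Qed.

End OnePrime.

(** * Factorization *)

Definition Val I (e : set K -> int) : Prop :=
  is_mod I /\ forall p, is_prime p -> hasval p I (e p).

(* x belongs to I as soon as it does so locally: the ideal of all s with
   s x in I lies in no prime. *)
Lemma local_global I x : is_mod I -> (forall p, is_prime p -> locI p I x) ->
  (exists p : set K, is_prime p) -> I x.
Proof.
move=> [I0 ID IM] hx [p0 pp0].
pose J : set K := [set s | OK s /\ I (s * x)].
have iJ : is_ideal OK J.
  split.
  - by move=> s [].
  - by split; [exact: OK0 | rewrite mul0r].
  - by move=> s t [Os h1] [Ot h2]; split; [exact: OKD | rewrite mulrDl; apply: ID].
  - by move=> s t Os [Ot h2]; split; [exact: OKM | rewrite -mulrA; apply: IM].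
have nJ : nonzero J.
  have [s [Os ns Isx]] := hx p0 pp0; exists s => //.
  by apply/eqP => s0; apply: ns; rewrite s0; case: pp0 => -[].
have [J1|nJ1] := pselect (J 1); first by case: J1; rewrite mul1r.
have [p pp Jp] := ideal_in_prime iJ nJ nJ1.
by have [s [Os ns Isx]] := hx p pp; case: ns; apply: Jp.
Qed.

Lemma Val_eq I J e : (exists p : set K, is_prime p) -> Val I e -> Val J e -> I = J.
Proof.
move=> ex [mI hI] [mJ hJ]; apply/seteqP; split=> x Hx.
  apply: local_global => // p pp; apply/(hJ p pp)/(hI p pp).
  by exists 1; rewrite mul1r; split=> //; [exact: OK1 | exact: nprime1].
apply: local_global => // p pp; apply/(hI p pp)/(hJ p pp).
by exists 1; rewrite mul1r; split=> //; [exact: OK1 | exact: nprime1].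
Qed.

Lemma Val_ext I e f : Val I e -> (forall p, is_prime p -> e p = f p) -> Val I f.
Proof. by move=> [mI h] ef; split=> // p pp; rewrite -ef //; apply: h. Qed.

Lemma Val_OK : Val OK (fun=> 0).
Proof. by split=> [|p pp]; [exact: mod_OK | exact: hasval_OK]. Qed.

Lemma Val_mul I J e f : Val I e -> Val J f -> Val (ideal_mul I J) (fun p => e p + f p).
Proof.
move=> [mI hI] [mJ hJ]; split; first exact: mod_mul.
by move=> p pp; apply: hasval_mul => //; [apply: hI | apply: hJ].
Qed.

Lemma Val_prime q : is_prime q -> Val q (fun p => (q == p)%:R).
Proof.
move=> pq; split=> [|p pp]; first by apply: ideal_mod; case: pq.
by case: eqP => [->|/eqP qp]; [exact: hasval_prime | exact: hasval_other].
Qed.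

Lemma Val_inv_prime q : is_prime q -> Val (ideal_inv q) (fun p => - (q == p)%:R).
Proof.
move=> pq; split=> [|p pp]; first exact: mod_inv.
case: eqP => [->|/eqP qp]; first exact: hasval_inv_prime.
by rewrite oppr0; exact: hasval_inv_other.
Qed.

Lemma Val_exp I e n : Val I e -> Val (ideal_inv I) (fun p => - e p) ->
  Val (ideal_exp I n) (fun p => n * e p).
Proof.
move=> VI VJ; have main (J : set K) f m : Val J f ->
    Val (iter m (ideal_mul J) OK) (fun p => f p *+ m).
  move=> VJ'; elim: m => [|m IH] /=; first exact: Val_OK.
  by apply: Val_ext (Val_mul VJ' IH) _ => p _; rewrite mulrS.
case: n => m /=.
  by apply: Val_ext (main _ _ m VI) _ => p _; rewrite -mulr_natl natz.
apply: Val_ext (main _ _ m.+1 VJ) _ => p _.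
by rewrite NegzE -mulr_natl natz mulrN mulNr.
Qed.

Lemma Val_big (s : seq (set K)) (e : set K -> int) : uniq s ->
  (forall q, q \in s -> is_prime q) ->
  Val (\big[@ideal_mul K/OK]_(q <- s) ideal_exp q (e q))
    (fun p => if p \in s then e p else 0).
Proof.
elim: s => [|q s IH] /=; first by rewrite big_nil => _ _; exact: Val_OK.
move=> /andP[nqs us] ps; rewrite big_cons.
have pq := ps q (mem_head _ _).
have ps' q' : q' \in s -> is_prime q' by move=> h; apply: ps; rewrite inE h orbT.
apply: Val_ext (Val_mul (Val_exp (e q) (Val_prime pq) (Val_inv_prime pq)) (IH us ps')) _.
move=> p pp; rewrite inE [p == q]eq_sym; case: eqP => [<-|_] /=.
  by rewrite (negPf nqs) mulr1 addr0.
by rewrite mulr0 add0r.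
Qed.

(** Local exponents alone do not record that almost all of them vanish; the list s does, and it
    allows a product over the primes to be formed. *)
Definition factors I (e : set K -> int) : Prop := Val I e /\
  exists s, [/\ uniq s, forall q, q \in s -> is_prime q &
                forall q, is_prime q -> q \notin s -> e q = 0].

Lemma factors_exists (s : seq (set K)) (e : set K -> int) : uniq s ->
  (forall q, q \in s -> is_prime q) -> (forall q, is_prime q -> q \notin s -> e q = 0) ->
  exists I, factors I e.
Proof.
move=> us ps h; exists (\big[@ideal_mul K/OK]_(q <- s) ideal_exp q (e q)).
split; last by exists s.
apply: Val_ext (Val_big e us ps) _ => p pp.
by case: ifP => // /negbT /(h p pp) ->.
Qed.

Lemma factors_mul I J e f : factors I e -> factors J f ->
  factors (ideal_mul I J) (fun p => e p + f p).
Proof.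
move=> [VI [s [us ps hs]]] [VJ [t [ut pt ht]]]; split; first exact: Val_mul.
exists (undup (s ++ t)); split; first exact: undup_uniq.
  by move=> q; rewrite mem_undup mem_cat => /orP[/ps|/pt].
by move=> q pq; rewrite mem_undup mem_cat negb_or => /andP[/(hs q pq)-> /(ht q pq)->].
Qed.

(** The exponent in any factorisation is read off locally, where it is unique; this makes [dp] well
    defined. *)
Lemma is_exponent_hasval p I e : is_prime p -> is_exponent p I e -> hasval p I e.
Proof.
move=> pp [n [q [f [qi qp -> [i qip <-]]]]].
have aux (P : pred 'I_n) : Val (\big[@ideal_mul K/OK]_(j | P j) ideal_exp (q j) (f j))
    (fun p => \sum_(j | P j) f j * (q j == p)%:R).
  rewrite -[index_enum _]/(index_enum _); elim: (index_enum _) => [|j s IH].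
    by rewrite big_nil; apply: Val_ext Val_OK _ => p' _; rewrite big_nil.
  rewrite big_cons; case: ifP => Pj; last first.
    by apply: Val_ext IH _ => p' _; rewrite big_cons Pj.
  apply: Val_ext (Val_mul (Val_exp (f j) (Val_prime (qp j)) (Val_inv_prime (qp j))) IH) _.
  by move=> p' _; rewrite big_cons Pj.
have [_ /(_ p pp)] := aux xpredT.
rewrite (bigD1 i) //= big1 ?addr0 => [|j ji]; first by rewrite qip eqxx mulr1.
by rewrite -qip (inj_eq qi) (negPf ji) mulr0.
Qed.

Lemma dpE p I e : is_prime p -> factors I e -> dp p I = e p.
Proof.
move=> pp [VI [s [us ps hs]]]; apply: xget_unique => [|f /(is_exponent_hasval pp) hf].
  (* [is_exponent] requires p to occur among the factors, so p is added with exponent 0 when it is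
     absent. *)
  have [t [ut pt pint ht]] : exists t, [/\ uniq t, forall q, q \in t -> is_prime q,
      p \in t & forall q, is_prime q -> q \notin t -> e q = 0].
    have [pint|npt] := boolP (p \in s); first by exists s.
    exists (p :: s); rewrite /= npt us mem_head; split=> //.
      by move=> q; rewrite inE => /predU1P[->|/ps].
    by move=> q pq; rewrite inE negb_or => /andP[_]; apply: hs.
  have -> : I = \big[@ideal_mul K/OK]_(q <- t) ideal_exp q (e q).
    apply: Val_eq (Val_ext (Val_big e ut pt) _); [by exists p | exact: VI |].
    by move=> q pq; case: ifP => // /negbT /(ht q pq) ->.
  exists (size t), (fun i => nth p t i), (fun i => e (nth p t i)); split.
  - by move=> i j /eqP; rewrite nth_uniq // => /eqP /val_inj.
  - by move=> i; apply: pt; apply: mem_nth.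
  - by rewrite (big_nth p) big_mkord.
  - have ip : (index p t < size t)%N by rewrite index_mem.
    by exists (Ordinal ip) => /=; rewrite nth_index.
by apply: (hasval_uniq pp hf); case: VI => _; apply.
Qed.

(** Noetherian induction passes from I to I p^-1 for a prime p containing I. This is strictly
    larger, for otherwise a non-integral element of p^-1 would stabilise I. *)
Lemma factors_ideal I : (exists p : set K, is_prime p) -> is_ideal OK I -> nonzero I ->
  exists e, factors I e.
Proof.
move=> ex; move: I; apply: ideal_noether => I iI nI IH.
have [I1|n1] := pselect (I 1).
  by exists (fun=> 0); rewrite (ideal_one iI I1); split; [exact: Val_OK | exists [::]].
have [p pp Ip] := ideal_in_prime iI nI n1.
have [IO I0 ID IM] := iI; have mI := ideal_mod iI; have [iP _ _ _] := pp.
pose J := ideal_mul I (ideal_inv p).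
have iJ : is_ideal OK J.
  have [? ? ?] := mod_mul (ideal_inv p) mI; split=> //.
  apply: ideal_mul_sub; first exact: mod_OK.
  by move=> u v Iu iv; rewrite mulrC; apply: iv; apply: Ip.
have O1 : ideal_inv p 1 by move=> z pz; rewrite mul1r; have [pO _ _ _] := iP; apply: pO.
have IJ : I `<=` J by move=> x Ix; rewrite -(mulr1 x); apply: ideal_mul_in.
have nJI : ~ J `<=` I.
  move=> JI; have [x ix nx] := prime_inv_extra pp; apply: nx.
  apply: (stable_integral iI nI) => y Iy; apply: JI; rewrite mulrC.
  exact: ideal_mul_in.
have [e [VJ [s [us ps hs]]]] := IH J iJ IJ nJI.
have FJ : factors J e by split=> //; exists s.
have Fp : factors p (fun q => (p == q)%:R).
  split; first exact: Val_prime.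
  exists [:: p]; split=> //; first by move=> q; rewrite inE => /eqP ->.
  by move=> q _; rewrite inE eq_sym => /negPf ->.
exists (fun q => e q + (p == q)%:R).
have -> : I = ideal_mul J p.
  rewrite /J -ideal_mulA (ideal_mulC _ p) prime_mul_inv // ideal_mulC.
  by rewrite ideal_mul_OK.
exact: factors_mul.
Qed.

(** The ideal J with opposite exponents satisfies I J = OK because ideals are determined by their
    local exponents, and then J is the inverse. *)
Lemma factors_inv I e : (exists p : set K, is_prime p) -> factors I e ->
  factors (ideal_inv I) (fun p => - e p).
Proof.
move=> ex FI; have [VI [s [us ps hs]]] := FI.
have [|J FJ] := @factors_exists s (fun p => - e p) us ps.
  by move=> q pq qs; rewrite hs ?oppr0.
have IJ : ideal_mul I J = OK.
  have [V _] := factors_mul FI FJ; apply: (Val_eq ex) Val_OK.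
  by apply: Val_ext V _ => p _; rewrite subrr.
suff -> : ideal_inv I = J by [].
apply/seteqP; split=> x; last first.
  by move=> Jx y Iy; rewrite mulrC -IJ; apply: ideal_mul_in.
move=> ix; have [[mJ _] _] := FJ; have [J0 JD JM] := mJ.
suff key v : ideal_mul I J v -> J (x * v).
  by rewrite -(mulr1 x); apply: key; rewrite IJ; exact: OK1.
elim/ideal_mulP: v / => [|v w hv hw|v w Iv Jw].
- by rewrite mulr0.
- by rewrite mulrDr; apply: JD.
- by rewrite mulrA; apply: JM => //; apply: ix.
Qed.

Lemma factors_exp I e n : (exists p : set K, is_prime p) -> factors I e ->
  factors (ideal_exp I n) (fun p => n * e p).
Proof.
move=> ex FI; have [VJ _] := factors_inv ex FI; have [VI [s [us ps hs]]] := FI.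
split; first exact: Val_exp.
by exists s; split=> // q pq qs; rewrite hs ?mulr0.
Qed.

(** Write x as a quotient of the integers n x and n of K. *)
Lemma factors_principal x : (exists p : set K, is_prime p) -> x != 0 ->
  exists e, factors (principal_ideal OK x) e.
Proof.
move=> ex x0; have [n n0 Onx] := OK_scale x.
have nK := natK_neq0 K n0.
have idl a : OK a -> a != 0 -> exists e, factors (principal_ideal OK a) e.
  move=> Oa a0; apply: factors_ideal => //.
    have [? ? ?] := mod_principal a; split=> // _ [y Oy <-]; exact: OKM.
  by exists a => //; exists 1; rewrite ?mul1r //; exact: OK1.
have [e Fe] := idl _ Onx (mulf_neq0 nK x0).
have [f Ff] := idl _ (OKn K n) nK.
exists (fun p => e p - f p); split; last first.
  by have [_ [s hs]] := factors_mul Fe (factors_inv ex Ff); exists s.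
split; first exact: mod_principal.
move=> p pp; apply/(hasval_principal pp _ x0).
have [[_ hFe] _] := Fe; have [[_ hFf] _] := Ff.
have [e1 e2] := (hasval_principal pp _ (mulf_neq0 nK x0)).1 (hFe p pp).
have [f1 f2] := (hasval_principal pp _ nK).1 (hFf p pp).
have := unif_expD pp; set u := uniformizer p => uD.
split.
  have -> : x * u ^ (- (e p - f p)) =
      (n%:R * x * u ^ (- e p)) * ((n%:R)^-1 * u ^ (f p)).
    by rewrite opprB addrC uD; field.
  exact: locM.
have -> : x^-1 * u ^ (e p - f p) =
    ((n%:R * x)^-1 * u ^ (e p)) * (n%:R * u ^ (- f p)).
  by rewrite uD; field; apply/andP.
exact: locM.
Qed.

End Localization.

(** * The valuation of a prime *)

Section Valuation.
Variable K : fieldExtType rat.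
Implicit Types (x y z w : K) (I J L p q : set K).
Local Notation OK := (@ringOfIntegers K).

Definition vK p x : int := dp p (principal_ideal OK x).

Section OnePrime.
Variable p : set K.
Hypothesis pp : is_prime p.
Local Notation u := (uniformizer p).
Local Notation v := (vK p).

Lemma vK_spec x : x != 0 -> loc p (x * u ^ (- v x)) /\ loc p (x^-1 * u ^ v x).
Proof.
move=> x0; have [|e Fe] := factors_principal _ x0; first by exists p.
rewrite /vK (dpE pp Fe); apply/(hasval_principal pp _ x0).
by have [[_ h] _] := Fe; apply: h.
Qed.

Lemma vK_uniq x e : x != 0 -> loc p (x * u ^ (- e)) -> loc p (x^-1 * u ^ e) -> v x = e.
Proof.
move=> x0 l1 l2; apply: (@hasval_uniq _ _ pp (principal_ideal OK x)).
  by apply/(hasval_principal pp _ x0); apply: vK_spec.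
exact/(hasval_principal pp _ x0).
Qed.

Lemma loc_vK x : x != 0 -> loc p x <-> 0 <= v x.
Proof.
move=> x0; have [l1 l2] := vK_spec x0; rewrite -(loc_exp pp); split=> h.
  by rewrite -(mulKf x0 (u ^ _)) mulrCA; apply: (locM pp) => //; rewrite mulrC.
have -> : x = x * u ^ (- v x) * u ^ v x.
  by rewrite -mulrA [X in _ * X]mulrC unif_expN // mulr1.
exact: locM.
Qed.

Lemma vKM x y : x != 0 -> y != 0 -> v (x * y) = v x + v y.
Proof.
move=> x0 y0; have [l1 l2] := vK_spec x0; have [m1 m2] := vK_spec y0.
apply: vK_uniq; first exact: mulf_neq0.
  by rewrite opprD unif_expD // mulrACA; apply: locM.
by rewrite invfM unif_expD // mulrACA; apply: locM.
Qed.

Lemma vK1 : v 1 = 0.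
Proof.
by apply: vK_uniq; rewrite ?oner_eq0 ?invr1 ?oppr0 ?mul1r ?expr0z //;
   apply: (loc_OK pp); exact: OK1.
Qed.

Lemma vKV x : x != 0 -> v x^-1 = - v x.
Proof.
move=> x0; have xi0 : x^-1 != 0 by rewrite invr_eq0.
have := vKM x0 xi0; rewrite mulfV // vK1 => /esym/eqP.
by rewrite addrC addr_eq0 => /eqP.
Qed.

Lemma vKX x n : x != 0 -> v (x ^+ n) = v x *+ n.
Proof.
move=> x0; elim: n => [|n IH]; first by rewrite expr0 vK1.
by rewrite exprS vKM ?expf_neq0 // IH mulrS.
Qed.

Lemma vKN x : x != 0 -> v (- x) = v x.
Proof.
move=> x0; rewrite -mulN1r vKM ?oppr_eq0 ?oner_eq0 //.
suff -> : v (-1) = 0 by rewrite add0r.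
have n1 : (-1 : K) != 0 by rewrite oppr_eq0 oner_eq0.
have e1 : (-1) ^+ 2 = 1 :> K by rewrite sqrrN expr1n.
have v1 : v ((-1) ^+ 2) = 0 by rewrite e1; exact: vK1.
by move: v1; rewrite vKX // => /eqP; rewrite mulrn_eq0 /= => /eqP.
Qed.

Lemma loc_valring : valring (loc p).
Proof.
split; [by apply: (loc_OK pp); exact: OK1 | exact: (locD pp) | exact: locN | exact: (locM pp) |].
move=> x; have [->|x0] := eqVneq x 0; first by left; apply: (loc_OK pp); exact: OK0.
rewrite !loc_vK ?invr_eq0 // vKV // oppr_ge0; have [?|/ltW ?] := lerP 0 (v x); by [left|right].
Qed.

Lemma vmax_vK x : x != 0 -> vmax (loc p) x <-> 0 < v x.
Proof.
move=> x0; rewrite /vmax /= loc_vK ?invr_eq0 // vKV // oppr_ge0; split.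
  by case=> [e|/negP]; [rewrite e eqxx in x0 | rewrite -ltNge].
by move=> h; right; apply/negP; rewrite -ltNge.
Qed.

Lemma unit_vK x : x != 0 -> (loc p x /\ ~ vmax (loc p) x) <-> v x = 0.
Proof.
move=> x0; rewrite vmax_vK // loc_vK //; split=> [[h /negP]|->].
  by rewrite -leNgt => h'; apply/le_anti/andP.
by rewrite ltxx.
Qed.

Lemma vmax_locP x : vmax (loc p) x -> exists s, [/\ OK s, ~ p s & p (s * x)].
Proof.
have [->|x0] := eqVneq x 0.
  move=> _; exists 1; rewrite mulr0; split; [exact: OK1 | exact: nprime1 |].
  by case: pp => -[].
rewrite vmax_vK // => h; apply/(loc_prime pp x).
have u0 := unif_neq0 pp.
have [l1 l2] := vK_spec x0; have -> : x * u^-1 = x * u ^ (- v x) * u ^ (v x - 1).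
  rewrite unif_expD // !mulrA -[_ * u ^ v x]mulrA [u ^ _ * u ^ v x]mulrC.
  by rewrite unif_expN // mulr1.
by apply: locM => //; apply/(loc_exp pp); lia.
Qed.

Lemma nuE x : nu p x = if x == 0 then +oo%E else ((v x)%:E)%E.
Proof. by []. Qed.

End OnePrime.

(** * Denominators *)

Lemma Val_ge0_sub I e : (exists p : set K, is_prime p) -> Val I e ->
  (forall p, is_prime p -> 0 <= e p) -> I `<=` OK.
Proof.
move=> ex [mI h] e0 x Ix; apply: local_global => //; first exact: mod_OK.
move=> p pp; have : locI p I x.
  by exists 1; rewrite mul1r; split=> //; [exact: OK1 | exact: nprime1].
move=> /(h p pp) l; have -> : x = x * uniformizer p ^ (- e p) * uniformizer p ^ e p.
  by rewrite -mulrA [X in _ * X]mulrC unif_expN // mulr1.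
by apply: (locM pp) => //; apply/(loc_exp pp)/e0.
Qed.

Lemma hasval_nonzero p I e : is_prime p -> hasval p I e ->
  exists s, [/\ OK s, ~ p s & I (s * uniformizer p ^ e)].
Proof.
move=> pp h; apply/(h (uniformizer p ^ e)); rewrite unif_expN //.
by apply: (loc_OK pp); exact: OK1.
Qed.

Lemma hasval_sub_prime p I e : is_prime p -> hasval p I e -> I `<=` p -> 1 <= e.
Proof.
move=> pp h Ip; have [s [Os ns Is]] := hasval_nonzero pp h.
rewrite -subr_ge0 -(loc_exp pp) unif_expD //; apply/(loc_prime pp).
by exists s; split=> //; apply: Ip.
Qed.

Lemma hasval_ge1_sub p I e : is_prime p -> hasval p I e -> I `<=` OK -> 1 <= e ->
  I `<=` p.
Proof.
move=> pp h IO e1 x Ix; have /(h x) l : locI p I x.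
  by exists 1; rewrite mul1r; split=> //; [exact: OK1 | exact: nprime1].
have : loc p (x * (uniformizer p)^-1).
  have -> : x * (uniformizer p)^-1 = x * uniformizer p ^ (- e) * uniformizer p ^ (e - 1).
    rewrite unif_expD // !mulrA -[_ * uniformizer p ^ e]mulrA.
    by rewrite [uniformizer p ^ _ * uniformizer p ^ e]mulrC unif_expN // mulr1.
  by apply: (locM pp) => //; apply/(loc_exp pp); lia.
move=> /(loc_prime pp)[s [Os ns psx]]; have [_ _ _ prm] := pp.
by case: (prm s x Os (IO x Ix) psx).
Qed.

Lemma hasval_ge0 p I e : is_prime p -> hasval p I e -> I `<=` OK -> 0 <= e.
Proof.
move=> pp h IO; have [s [Os ns Is]] := hasval_nonzero pp h.
rewrite -(loc_exp pp); exists s; split=> //; exact: IO.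
Qed.

(** Let f be the exponent of x at p and e that of D. The exponents f + 2 e of A and e of D are both
    non-negative, and coprimality makes one of them 0. *)
Lemma is_denominator_vK p x D : is_prime p -> x != 0 -> is_denominator x D ->
  exists e, factors D e /\ 2 * e p = Order.max 0 (- vK p x).
Proof.
move=> pp x0 [A [iA iD D0 AD eA]]; have ex : exists q : set K, is_prime q by exists p.
have nD : nonzero D.
  apply: contrapT => nn; move/eqP: D0; apply; have [_ D0 _ _] := iD.
  apply/seteqP; split=> y /=; last by move=> ->.
  by move=> Dy; apply: contrapT => /eqP y0; apply: nn; exists y.
have [e Fe] := factors_ideal ex iD nD; exists e; split=> //.
have [f Ff] := factors_principal ex x0.
have ef : vK p x = f p by rewrite /vK (dpE pp Ff).
have [[_ hA] _] := factors_mul Ff (factors_exp 2 ex Fe); rewrite eA in hA.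
have {}hA := hA p pp; have [[_ hD] _] := Fe; have {}hD := hD p pp.
have [AO _ _ _] := iA; have [DO _ _ _] := iD.
have a0 := hasval_ge0 pp hA AO; have d0 := hasval_ge0 pp hD DO.
have [iP _ n1 _] := pp.
have : ~ (1 <= f p + 2 * e p /\ 1 <= e p).
  move=> [a1 d1]; apply: n1.
  have [a [d [Aa Dd ->]]] : ideal_add A D 1 by rewrite AD; exact: OK1.
  have [_ _ pD _] := iP; apply: pD.
    exact: (hasval_ge1_sub pp hA AO a1).
  exact: (hasval_ge1_sub pp hD DO d1).
rewrite ef; lia.
Qed.

(** Negative exponents of x have to be even for the denominator to be a square; for points of the
    curve the Weierstrass equation guarantees it. *)
Lemma denominator_exists x : (exists p : set K, is_prime p) ->
  (x != 0 -> forall p, is_prime p -> vK p x < 0 -> exists d, vK p x = - (2 * d)) ->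
  exists D, is_denominator x D.
Proof.
move=> ex ev; have [x0|x0] := eqVneq x 0.
  exists OK, [set 0]; split.
  - split=> // [y /= ->|y z /= -> ->|y z Oy /= ->]; rewrite ?addr0 ?mulr0 //.
    exact: OK0.
  - by split=> //; [exact: OK0 | exact: OKD | exact: OKM].
  - apply/eqP => e; have : [set 0] (1 : K) by rewrite -e; exact: OK1.
    by move=> /= /eqP; rewrite oner_eq0.
  - apply/seteqP; split=> [_ [y [z [/= -> Oz ->]]]|y Oy]; first by rewrite add0r.
    by exists 0, y; rewrite add0r.
  - apply/seteqP; split=> [y|y /= ->]; last exact: ideal_mul0.
    apply: (@ideal_mulP _ _ _ (fun z => z = 0)) => //= [a b -> ->|a b [c _ <-] _]; first by rewrite addr0.
    by rewrite x0 mulr0 mul0r.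
have {}ev := ev x0; have [f Ff] := factors_principal ex x0.
have ef p : is_prime p -> vK p x = f p by move=> pp; rewrite /vK (dpE pp Ff).
pose d p : int := if f p < 0 then ((- f p) %/ 2)%Z else 0.
pose a p : int := if f p < 0 then 0 else f p.
have ad p : is_prime p -> f p + 2 * d p = a p /\ 0 <= d p.
  move=> pp; rewrite /d /a; case: ifP => [fp|]; last by rewrite mulr0 addr0.
  have := ev p pp; rewrite ef // => /(_ fp)[c ec].
  have -> : ((- f p) %/ 2)%Z = c by rewrite ec opprK mulKz.
  lia.
have [_ [s [us ps hs]]] := Ff.
have [|D FD] := @factors_exists _ s d us ps.
  by move=> q pq qs; rewrite /d hs.
have [|A FA] := @factors_exists _ s a us ps.
  by move=> q pq qs; rewrite /a hs.
have [VD _] := FD; have [VA _] := FA.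
have AO : A `<=` OK.
  by apply: (Val_ge0_sub ex VA) => p pp; rewrite /a; case: ltrP.
have DO : D `<=` OK by apply: (Val_ge0_sub ex VD) => p /ad[].
have iA : is_ideal OK A by have [[? ? ?] _] := VA.
have iD : is_ideal OK D by have [[? ? ?] _] := VD.
have [p0 pp0] := ex.
have nzD : nonzero D.
  have [t [Ot nt Dt]] := hasval_nonzero pp0 (VD.2 p0 pp0); exists (t * uniformizer p0 ^ d p0) => //.
  rewrite mulf_neq0 ?unif_exp_neq0 //; apply/eqP => t0; apply: nt.
  by rewrite t0; case: pp0 => -[].
exists D, A; split=> //.
- by apply/eqP => e; case: nzD => y; rewrite e => /= ->; rewrite eqxx.
- have iS : is_ideal OK (ideal_add A D).
    have [_ A0 AD AM] := iA; have [_ D0 DD DM] := iD; split.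
    + by move=> _ [y [z [/AO Oy /DO Oz ->]]]; apply: OKD.
    + by exists 0, 0; rewrite addr0.
    + move=> _ _ [y [z [Ay Dz ->]]] [y' [z' [Ay' Dz' ->]]]; exists (y + y'), (z + z').
      by split; [exact: AD | exact: DD | ring].
    + move=> t _ Ot [y [z [Ay Dz ->]]]; exists (t * y), (t * z).
      by split; [exact: AM | exact: DM | ring].
  have subD : D `<=` ideal_add A D.
    by move=> y Dy; exists 0, y; rewrite add0r; split=> //; case: iA.
  have subA : A `<=` ideal_add A D.
    by move=> y Dy; exists y, 0; rewrite addr0; split=> //; case: iD.
  apply: ideal_one => //; apply: contrapT => n1.
  have [p pp Sp] := ideal_in_prime iS (nonzero_sub nzD subD) n1.
  have a1 := hasval_sub_prime pp (VA.2 p pp) (subset_trans subA Sp).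
  have d1 := hasval_sub_prime pp (VD.2 p pp) (subset_trans subD Sp).
  by move: a1 d1; rewrite /a /d; case: ifP.
- apply: (Val_eq ex) VA; have [V _] := factors_mul Ff (factors_exp 2 ex FD).
  by apply: Val_ext V _ => p /ad[].
Qed.

Lemma denominator_vK p x : is_prime p ->
  (x != 0 -> forall q, is_prime q -> vK q x < 0 -> exists d, vK q x = - (2 * d)) ->
  exists e, factors (denominator x) e /\
    2 * e p = if x == 0 then 0 else Order.max 0 (- vK p x).
Proof.
move=> pp ev; have ex : exists q : set K, is_prime q by exists p.
have /(xgetPex OK) : exists D, is_denominator x D by exact: denominator_exists.
rewrite -/(denominator x); have [x0|x0] := eqVneq x 0; last exact: is_denominator_vK.
move=> [A [iA iD D0 AD eA]]; exists (fun=> 0); split; last by rewrite mulr0.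
suff -> : denominator x = OK by split; [exact: Val_OK | exists [::]].
rewrite -AD -eA; have [DO Z DD DM] := iD; apply/seteqP; split=> y.
  move=> Dy; exists 0, y; rewrite add0r; split=> //; exact: ideal_mul0.
move=> [a [d [Aa Dd ->]]]; suff -> : a = 0 by rewrite add0r.
move: Aa; apply: (@ideal_mulP _ _ _ (fun z => z = 0)) => //= [b c -> ->|b c [e _ <-] _]; first by rewrite addr0.
by rewrite x0 mulr0 mul0r.
Qed.

End Valuation.

(** * The Kummer relation on a Weierstrass curve *)

Section CurveKummer.
Variable L : fieldType.
Implicit Types (E : weierstrass L) (x y z s t : L).

Definition kum_of E := Kummer (a1 E ^+ 2 + 4 * a2 E) (2 * a4 E + a1 E * a3 E)
  (a3 E ^+ 2 + 4 * a6 E)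
  (a1 E ^+ 2 * a6 E + 4 * a2 E * a6 E - a1 E * a3 E * a4 E + a2 E * a3 E ^+ 2
   - a4 E ^+ 2).

Lemma kwf_of E : kwf (kum_of E).
Proof. by rewrite /kwf /=; ring. Qed.

Definition wneg E (P : wpoint L) : wpoint L :=
  if P is Some (x, y) then Some (x, - y - a1 E * x - a3 E) else None.

Lemma on_curveE E x y : on_curve E (Some (x, y)) ->
  y ^+ 2 = x ^+ 3 + a2 E * x ^+ 2 + a4 E * x + a6 E - a1 E * x * y - a3 E * y.
Proof. by move=> /= /eqP <-; ring. Qed.

Lemma padd_neg E P Q : padd E P Q = None -> Q = wneg E P.
Proof.
case: P Q => [[x1 y1]|] [[x2 y2]|] //=.
case: eqP => //= <-; case: eqP => // e _; congr (Some (_, _)).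
have -> : y2 = (y1 + y2 + a1 E * x1 + a3 E) - y1 - a1 E * x1 - a3 E by ring.
by rewrite e sub0r.
Qed.

Lemma padd_wneg E P : padd E P (wneg E P) = None.
Proof.
case: P => [[x y]|] //=; rewrite eqxx /=.
by case: eqP => // h; case: h; ring.
Qed.

(** Gives [0]P = O from 0 + 0 = 0 alone. *)
Lemma padd_idem E P : padd E P P = P -> P = None.
Proof.
case: P => // -[x y] /=; rewrite eqxx /=; case: eqP => // /eqP nz [].
set l := _ / _ => -> e; case/eqP: nz.
have : y - (- (l + a1 E) * x - (y - l * x) - a3 E) = 0 by rewrite e subrr.
by move=> <-; ring.
Qed.

(** Passing from T to - T replaces y2 by its conjugate, so the sum and product of the two
    x-coordinates are symmetric in the conjugates, and the curve equations eliminate y1 and y2. *)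
Lemma padd_kum E x1 y1 x2 y2 s s' t t' :
  on_curve E (Some (x1, y1)) -> on_curve E (Some (x2, y2)) -> x1 != x2 ->
  padd E (Some (x1, y1)) (Some (x2, y2)) = Some (s, s') ->
  padd E (Some (x1, y1)) (wneg E (Some (x2, y2))) = Some (t, t') ->
  kum (kum_of E) x1 x2 s t.
Proof.
move=> /on_curveE e1 /on_curveE e2 x12 /=; rewrite x12 => -[<- _] [<- _].
have d0 : x2 - x1 != 0 by rewrite subr_eq0 eq_sym.
split.
  set l := (y2 - y1) / (x2 - x1); set l' := (_ - _ - _ - _) / _.
  have el : (x1 - x2) ^+ 2 * (l ^+ 2 + a1 E * l - a2 E - x1 - x2) =
    (y2 - y1) ^+ 2 + a1 E * (y2 - y1) * (x2 - x1) - (a2 E + x1 + x2) * (x1 - x2) ^+ 2.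
    by rewrite /l; field.
  have el' : (x1 - x2) ^+ 2 * (l' ^+ 2 + a1 E * l' - a2 E - x1 - x2) =
    (- y2 - a1 E * x2 - a3 E - y1) ^+ 2 +
    a1 E * (- y2 - a1 E * x2 - a3 E - y1) * (x2 - x1) - (a2 E + x1 + x2) * (x1 - x2) ^+ 2.
    by rewrite /l'; field.
  have D0 : (x1 - x2) ^+ 2 != 0 by rewrite expf_neq0 // subr_eq0.
  apply: (mulfI D0); rewrite [LHS](_ : _ =
    ((x1 - x2) ^+ 2 * (l ^+ 2 + a1 E * l - a2 E - x1 - x2)) *
    ((x1 - x2) ^+ 2 * (l' ^+ 2 + a1 E * l' - a2 E - x1 - x2))); last by ring.
  rewrite el el' /kV /=; ring: e1 e2.
rewrite [LHS](_ : _ = (y2 - y1) ^+ 2 + a1 E * (y2 - y1) * (x2 - x1) +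
    (- y2 - a1 E * x2 - a3 E - y1) ^+ 2 +
    a1 E * (- y2 - a1 E * x2 - a3 E - y1) * (x2 - x1)
    - 2 * (a2 E + x1 + x2) * (x1 - x2) ^+ 2); last by field.
rewrite /kU /=; ring: e1 e2.
Qed.

Lemma same_x E x y y' : on_curve E (Some (x, y)) -> on_curve E (Some (x, y')) ->
  Some (x, y) = Some (x, y') \/ Some (x, y) = wneg E (Some (x, y')).
Proof.
move=> /on_curveE e1 /on_curveE e2.
have : (y - y') * (y + y' + a1 E * x + a3 E) = 0.
  have -> : (y - y') * (y + y' + a1 E * x + a3 E) =
    y ^+ 2 + a1 E * x * y + a3 E * y - (y' ^+ 2 + a1 E * x * y' + a3 E * y') by ring.
  by rewrite e1 e2; ring.
move/eqP; rewrite mulf_eq0 subr_eq0 => /orP[/eqP ->|/eqP e]; [by left | right].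
congr (Some (_, _)); apply/eqP; rewrite -subr_eq0 -e; apply/eqP; ring.
Qed.

End CurveKummer.

Lemma map_padd (k L : fieldType) (f : {rmorphism k -> L}) (E : weierstrass k) P Q :
  map_point f (padd E P Q) = padd (map_curve f E) (map_point f P) (map_point f Q).
Proof.
have n4 n : f n%:R = n%:R by rewrite rmorph_nat.
case: P Q => [[x1 y1]|] [[x2 y2]|] //=.
rewrite (inj_eq (fmorph_inj f)); case: eqP => //= _.
  rewrite -!(rmorphM, rmorphD) fmorph_eq0; case: eqP => //= _.
  by congr (Some (_, _)); rewrite /= !(n4, fmorphV, rmorphXn, rmorphM, rmorphN, rmorphD).
by congr (Some (_, _)); rewrite /= !(n4, fmorphV, rmorphXn, rmorphM, rmorphN, rmorphD).
Qed.

Lemma map_point_inj (k L : fieldType) (f : {rmorphism k -> L}) :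
  injective (map_point f : wpoint k -> wpoint L).
Proof.
by move=> [[x y]|] [[x' y']|] //= [/fmorph_inj -> /fmorph_inj ->].
Qed.

Lemma map_on_curve (k L : fieldType) (f : {rmorphism k -> L}) (E : weierstrass k) P :
  on_curve (map_curve f E) (map_point f P) = on_curve E P.
Proof.
case: P => [[x y]|] //=.
by rewrite -!(rmorphXn, rmorphM, rmorphD) (inj_eq (fmorph_inj f)).
Qed.

(** * Points [z]P of a curve with complex multiplication *)

Section CMPoints.
Variables (K : fieldExtType rat) (iota : {rmorphism K -> algC}).
Variables (E : weierstrass K) (omega : K) (m : K -> wpoint algC -> wpoint algC).
Variable P : wpoint K.
Hypotheses (omega_quadratic : imaginary_quadratic_integer omega)
  (E_cm : complex_multiplication iota E omega m)
  (P_on : on_curve E P) (P_nontorsion : nontorsion E P).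
Implicit Types (z w : K).
Local Notation Zw := (Zomega omega).
Local Notation Ebar := (map_curve iota E).

Lemma Zw_int (n : int) : Zw n%:~R.
Proof. by exists n, 0; rewrite mul0r addr0. Qed.

Lemma Zw0 : Zw 0. Proof. exact: (Zw_int 0). Qed.
Lemma Zw1 : Zw 1. Proof. exact: (Zw_int 1). Qed.
Lemma Zw_omega : Zw omega. Proof. by exists 0, 1; rewrite add0r mul1r. Qed.

Lemma ZwD z w : Zw z -> Zw w -> Zw (z + w).
Proof.
by move=> [a [b ->]] [c [d ->]]; exists (a + c), (b + d); rewrite !intrD; ring.
Qed.

Lemma ZwN z : Zw z -> Zw (- z).
Proof. by move=> [a [b ->]]; exists (- a), (- b); rewrite !rmorphN; ring. Qed.

Lemma ZwB z w : Zw z -> Zw w -> Zw (z - w).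
Proof. by move=> hz hw; apply: ZwD => //; apply: ZwN. Qed.

Lemma ZwM z w : Zw z -> Zw w -> Zw (z * w).
Proof.
have [t [n [e _]]] := omega_quadratic; have e2 : omega ^+ 2 = t%:~R * omega - n%:~R.
  by apply/eqP; rewrite -subr_eq0 -e; apply/eqP; ring.
move=> [a [b ->]] [c [d ->]]; exists (a * c - b * d * n), (a * d + b * c + b * d * t).
rewrite !(intrD, intrM, rmorphN); ring: e2.
Qed.

(* z times its conjugate is the norm of z. *)
Lemma Zw_norm z : Zw z -> z != 0 ->
  exists2 w, Zw w & exists2 n : nat, (0 < n)%N & w * z = n%:R.
Proof.
have [t [n [e tn]]] := omega_quadratic; have e2 : omega ^+ 2 = t%:~R * omega - n%:~R.
  by apply/eqP; rewrite -subr_eq0 -e; apply/eqP; ring.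
move=> [a [b ez]] z0; exists ((a + b * t)%:~R + (- b)%:~R * omega).
  by exists (a + b * t), (- b).
have N0 : 0 < a ^+ 2 + a * b * t + b ^+ 2 * n.
  have h : 4 * (a ^+ 2 + a * b * t + b ^+ 2 * n) =
    (2 * a + b * t) ^+ 2 + b ^+ 2 * (4 * n - t ^+ 2) by ring.
  rewrite -(pmulr_rgt0 _ (isT : 0 < 4 :> int)) h.
  have [b0|b0] := eqVneq b 0.
    rewrite b0 !mul0r !addr0 exprn_even_gt0 //= mulf_neq0 //.
    by apply: contra_neq z0 => a0; rewrite ez a0 b0 mul0r addr0.
  apply: ltr_wpDl; first exact: sqr_ge0.
  by rewrite mulr_gt0 ?subr_gt0 // exprn_even_gt0.
pose N : int := a ^+ 2 + a * b * t + b ^+ 2 * n; rewrite -/N in N0.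
exists `|N|%N; first by rewrite absz_gt0 gt_eqF.
rewrite -[_%:R]/((`|N|%N%:Z)%:~R) abszE gtr0_norm // /N.
rewrite ez !(intrD, intrM, rmorphN, rmorphXn); ring: e2.
Qed.

Lemma same_proj_affine (L : fieldType) (Q : wpoint L) (f : 'I_3 -> L) :
  same_proj (proj Q) f -> f (inord 2) != 0 ->
  Q = Some (f (inord 0) / f (inord 2), f (inord 1) / f (inord 2)).
Proof.
have e0 : inord 0 = 0 :> 'I_3 by apply: val_inj; rewrite /= inordK.
have e1 : inord 1 = 1 :> 'I_3 by apply: val_inj; rewrite /= inordK.
have e2 : inord 2 = 2 :> 'I_3 by apply: val_inj; rewrite /= inordK.
rewrite e0 e1 e2.
case: Q => [[x y]|] [c c0 h]; rewrite !h /proj !(tnth_nth 0) /= ?mulr1 ?mulr0 ?eqxx //.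
by move=> _; rewrite ![c * _]mulrC !mulfK.
Qed.

Lemma same_proj_O (L : fieldType) (Q : wpoint L) (f : 'I_3 -> L) :
  same_proj (proj Q) f -> f (inord 2) = 0 -> Q = None.
Proof.
have e2 : inord 2 = 2 :> 'I_3 by apply: val_inj; rewrite /= inordK.
rewrite e2; case: Q => [[x y]|] // [c c0 h].
by rewrite h /proj (tnth_nth 0) /= mulr1 => e; rewrite e eqxx in c0.
Qed.

Lemma mmap_proj (Q : wpoint K) (F : {mpoly K[3]}) :
  mmap iota (proj (map_point iota Q)) F = iota (mmap idfun (proj Q) F).
Proof.
have e i : proj (map_point iota Q) i = iota (proj Q i).
  by case: Q => [[x y]|]; rewrite /proj /= !(tnth_nth 0);
    case: i => [[|[|[|i]]] hi] //=; rewrite ?rmorph0 ?rmorph1.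
rewrite /mmap rmorph_sum; apply: eq_bigr => mm _; rewrite rmorphM; congr (_ * _).
by rewrite /mmap1 rmorph_prod; apply: eq_bigr => i _; rewrite rmorphXn e.
Qed.

(** The forms that describe the endomorphism have coefficients in K, so at a K-rational point the
    affine coordinates of the image are quotients of elements of K. *)
Lemma cm_rational z (Q : wpoint K) : Zw z -> on_curve E Q ->
  exists Q', on_curve E Q' /\ map_point iota Q' = m z (map_point iota Q).
Proof.
move=> Zz oQ; have [[hc hF] _] := cm_endo E_cm Zz.
have oQ' : on_curve Ebar (map_point iota Q) by rewrite map_on_curve.
have [d [F [_ Fn FE]]] := hF _ oQ'.
have := FE _ oQ' Fn; set Q' := m z _ => h.
suff [R eR] : exists R, map_point iota R = Q'.
  by exists R; split=> //; rewrite -(map_on_curve iota) eR; apply: hc.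
have [e2|n2] := eqVneq (mmap iota (proj (map_point iota Q)) (F (inord 2))) 0.
  by exists None; rewrite (same_proj_O h e2).
rewrite (same_proj_affine h n2) !mmap_proj.
set f := fun i => mmap idfun (proj Q) (F i).
exists (Some (f (inord 0) / f (inord 2), f (inord 1) / f (inord 2))).
by rewrite /= /f !fmorph_div.
Qed.

Definition pt z : wpoint K := cm_act iota E m z P.

Lemma ptP z : Zw z ->
  on_curve E (pt z) /\ map_point iota (pt z) = m z (map_point iota P).
Proof.
move=> Zz; have [Q hQ] := cm_rational Zz P_on.
rewrite /pt /cm_act; apply: (@xgetPex _ None
  [set Q | on_curve E Q /\ map_point iota Q = m z (map_point iota P)]).
by exists Q.
Qed.

Lemma ptE z Q : Zw z -> map_point iota Q = m z (map_point iota P) -> pt z = Q.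
Proof.
by move=> Zz e; apply: (@map_point_inj _ _ iota); rewrite e; case: (ptP Zz).
Qed.

Lemma P_on' : on_curve Ebar (map_point iota P).
Proof. by rewrite map_on_curve. Qed.

Lemma pt1 : pt 1 = P.
Proof. by apply: ptE; [exact: Zw1 | rewrite (cm_one E_cm P_on')]. Qed.

Lemma ptD z w : Zw z -> Zw w -> pt (z + w) = padd E (pt z) (pt w).
Proof.
move=> Zz Zw'; apply: ptE; first exact: ZwD.
have [_ ez] := ptP Zz; have [_ ew] := ptP Zw'.
by rewrite map_padd ez ew (cm_add E_cm Zz Zw' P_on').
Qed.

Lemma pt0 : pt 0 = None.
Proof. by apply: (@padd_idem _ E); rewrite -ptD ?addr0 //; exact: Zw0. Qed.

Lemma pt_nat n : pt n%:R = iter n (padd E P) None.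
Proof.
elim: n => [|n IH]; first exact: pt0.
rewrite -addn1 addnC natrD ptD; [|exact: Zw1 | exact: (Zw_int n)].
by rewrite pt1 IH.
Qed.

Lemma ptM z w : Zw z -> Zw w -> map_point iota (pt (z * w)) = m z (map_point iota (pt w)).
Proof.
move=> Zz Zw'; have [_ ->] := ptP (ZwM Zz Zw'); have [_ ->] := ptP Zw'.
by rewrite (cm_mul E_cm Zz Zw' P_on').
Qed.

(** Multiplying by the conjugate turns [z]P = O into [n]P = O with n a positive integer. *)
Lemma pt_neq0 z : Zw z -> z != 0 -> pt z <> None.
Proof.
move=> Zz z0 e; have [w Zw' [n n0 en]] := Zw_norm Zz z0.
have := P_nontorsion n0; rewrite -pt_nat -en => /eqP; apply.
apply: (@map_point_inj _ _ iota); rewrite ptM // e /=.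
by have [] := cm_endo E_cm Zw'.
Qed.

Lemma ptN z : Zw z -> pt (- z) = wneg E (pt z).
Proof.
move=> Zz; apply: padd_neg; rewrite -ptD //; last exact: ZwN.
by rewrite subrr pt0.
Qed.

Lemma pt_inj z w : Zw z -> Zw w -> pt z = pt w -> z = w.
Proof.
move=> Zz Zw' e; apply/eqP; rewrite -subr_eq0; apply/eqP.
apply: contrapT => /eqP n0; apply: (pt_neq0 (ZwB Zz Zw') n0).
by rewrite ptD //; [rewrite ptN // e padd_wneg | exact: ZwN].
Qed.

Definition xP z : K := xcoord (pt z).
Lemma xPE z : xP z = xcoord (pt z). Proof. by []. Qed.

Definition yP z : K := (affine (pt z)).2.

Lemma pt_affine z : Zw z -> z != 0 -> pt z = Some (xP z, yP z).
Proof.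
by move=> Zz z0; have := pt_neq0 Zz z0; rewrite /xP /yP /xcoord; case: (pt z) => // -[].
Qed.

Lemma pt_on z : Zw z -> z != 0 -> on_curve E (Some (xP z, yP z)).
Proof. by move=> Zz z0; rewrite -pt_affine //; case: (ptP Zz). Qed.

Lemma xPN z : Zw z -> xP (- z) = xP z.
Proof. by move=> Zz; rewrite /xP ptN //; case: (pt z) => // -[]. Qed.

Lemma xP_inj z w : Zw z -> Zw w -> z != 0 -> w != 0 -> xP z = xP w ->
  z = w \/ z = - w.
Proof.
move=> Zz Zw' z0 w0 e; have := pt_on Zz z0; rewrite e => oz.
have [h|h] := same_x oz (pt_on Zw' w0); [left | right]; apply: pt_inj => //.
- by rewrite !pt_affine // e h.
- exact: ZwN.
- by rewrite ptN // !pt_affine // e h.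
Qed.

Lemma xP_kum z w : Zw z -> Zw w -> z != 0 -> w != 0 -> z + w != 0 -> z - w != 0 ->
  kum (kum_of E) (xP z) (xP w) (xP (z + w)) (xP (z - w)).
Proof.
move=> Zz Zw' z0 w0 zw1 zw2; have Zp := ZwD Zz Zw'; have Zm := ZwB Zz Zw'.
apply: (@padd_kum _ E _ (yP z) _ (yP w) _ (yP (z + w)) _ (yP (z - w))).
- exact: pt_on.
- exact: pt_on.
- apply/eqP => /(xP_inj Zz Zw' z0 w0)[e|e]; first by rewrite e subrr eqxx in zw2.
  by rewrite e addNr eqxx in zw1.
- by rewrite -!pt_affine // ptD.
- by rewrite -!pt_affine // -ptN // ptD //; exact: ZwN.
Qed.

End CMPoints.

(** * Polynomial identities from vanishing on infinite sets *)

Section Polynomials.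
Variable L : closedFieldType.
Implicit Types (p q : {poly L}) (x y s t : L).

Lemma avoid_roots p (xs : nat -> L) : p != 0 -> injective xs ->
  exists n0, forall n, (n0 <= n)%N -> p.[xs n] != 0.
Proof.
move=> p0 xi; have [r er] := closed_field_poly_normal p.
have [n0 h] : exists n0, forall n, (n0 <= n)%N -> xs n \notin r.
  elim: (r) => [|a l [n0 IH]]; first by exists 0%N.
  have [[k ek]|nk] := pselect (exists k, xs k = a); last first.
    exists n0 => n nn; rewrite inE negb_or IH // andbT.
    by apply/eqP => e; apply: nk; exists n.
  exists (maxn n0 k.+1) => n; rewrite geq_max => /andP[nn kn].
  rewrite inE negb_or IH // andbT -ek (inj_eq xi).
  by rewrite gtn_eqF.
exists n0 => n /h nr; rewrite er hornerZ mulf_neq0 ?lead_coef_eq0 //.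
rewrite horner_prod.
rewrite big_seq; elim/big_ind: _ => //; first exact: oner_neq0.
  by move=> *; apply: mulf_neq0.
by move=> z zr; rewrite hornerXsubC subr_eq0; apply: contraNneq nr => ->.
Qed.

Lemma infinite_roots p (xs : nat -> L) (n0 : nat) : injective xs ->
  (forall n, (n0 <= n)%N -> p.[xs n] = 0) -> p = 0.
Proof.
move=> xi h; apply/eqP; apply: contrapT => /negP p0.
have [n1 h1] := avoid_roots p0 xi.
by move: (h1 (maxn n0 n1) (leq_maxr _ _)); rewrite h ?eqxx // leq_maxl.
Qed.

(** Polynomial functions of two variables. As a closure predicate it spares writing the bivariate
    polynomials down, since only their existence matters for [poly2_zero]. *)
Definition poly2 (f : L -> L -> L) : Prop :=
  exists P : {poly {poly L}}, forall x y, f x y = P.[y%:P].[x].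

Lemma poly2_const c : poly2 (fun _ _ => c).
Proof. by exists (c%:P%:P) => x y; rewrite !hornerC. Qed.

Lemma poly2_fst : poly2 (fun x _ => x).
Proof. by exists ('X%:P) => x y; rewrite hornerC hornerX. Qed.

Lemma poly2_snd : poly2 (fun _ y => y).
Proof. by exists 'X => x y; rewrite hornerX hornerC. Qed.

Lemma poly2_add f g : poly2 f -> poly2 g -> poly2 (fun x y => f x y + g x y).
Proof. by move=> [P hP] [Q hQ]; exists (P + Q) => x y; rewrite !hornerD hP hQ. Qed.

Lemma poly2_mul f g : poly2 f -> poly2 g -> poly2 (fun x y => f x y * g x y).
Proof. by move=> [P hP] [Q hQ]; exists (P * Q) => x y; rewrite !hornerM hP hQ. Qed.

Lemma poly2_opp f : poly2 f -> poly2 (fun x y => - f x y).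
Proof. by move=> [P hP]; exists (- P) => x y; rewrite !hornerN hP. Qed.

Lemma poly2_exp f n : poly2 f -> poly2 (fun x y => f x y ^+ n).
Proof. by move=> [P hP]; exists (P ^+ n) => x y; rewrite !horner_exp hP. Qed.

Lemma poly2_sum n (f : 'I_n -> L -> L -> L) : (forall i, poly2 (f i)) ->
  poly2 (fun x y => \sum_i f i x y).
Proof.
move=> /choice[P hP]; exists (\sum_i P i) => x y.
by rewrite !horner_sum; apply: eq_bigr => i _; rewrite hP.
Qed.

Lemma poly2_horner p f : poly2 f -> poly2 (fun x y => p.[f x y]).
Proof.
move=> pf; have [P hP] : poly2 (fun x y => \sum_(i < size p) p`_i * f x y ^+ i).
  by apply: poly2_sum => i; apply: poly2_mul; [exact: poly2_const | exact: poly2_exp].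
by exists P => x y; rewrite horner_coef hP.
Qed.

(** Vanishing on the staircase b < a suffices, for each b still meets infinitely many a. The Kummer
    relation along an orbit is available only there, since it involves the index a - b. *)
Lemma poly2_zero f (xs ys : nat -> L) : poly2 f -> injective xs -> injective ys ->
  (forall b a, (b < a)%N -> f (xs a) (ys b) = 0) -> forall x y, f x y = 0.
Proof.
move=> [P hP] xi yi h; have Pb b : P.[(ys b)%:P] = 0.
  by apply: (@infinite_roots _ xs b.+1 xi) => a ab; rewrite -hP h.
suff P0 : P = 0 by move=> x y; rewrite hP P0 !horner0.
apply/eqP; apply: contrapT => /negP P0.
have := @max_poly_roots _ P [seq (ys b)%:P | b <- iota 0 (size P)] P0.
rewrite size_map size_iota ltnn => H; suff : false by []; apply: H.
  by apply/allP => _ /mapP[b _ ->]; apply/rootP.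
by rewrite map_inj_uniq ?iota_uniq // => b b' /polyC_inj/yi.
Qed.

(* Symmetric polynomials in s, t with D (s + t) = U and D s t = V, cleared of
   denominators. *)
Lemma poly2_power_sum (D U V : L -> L -> L) n : poly2 D -> poly2 U -> poly2 V ->
  exists2 f, poly2 f & forall x y s t, D x y * (s * t) = V x y ->
    D x y * (s + t) = U x y -> D x y ^+ n * (s ^+ n + t ^+ n) = f x y.
Proof.
move=> pD pU pV; suff [f [g [pf pg hfg]]] : exists f g, [/\ poly2 f, poly2 g &
    forall x y s t, D x y * (s * t) = V x y -> D x y * (s + t) = U x y ->
    D x y ^+ n * (s ^+ n + t ^+ n) = f x y /\
    D x y ^+ n.+1 * (s ^+ n.+1 + t ^+ n.+1) = g x y].
  by exists f => // x y s t h1 h2; case: (hfg x y s t h1 h2).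
elim: n => [|n [f [g [pf pg hfg]]]].
  exists (fun _ _ => 2), U; split=> //; first exact: poly2_const.
  by move=> x y s t _ <-; rewrite !expr0 !expr1; split=> //; ring.
exists g, (fun x y => U x y * g x y - V x y * D x y * f x y); split=> //.
  apply: poly2_add; first exact: poly2_mul.
  by apply: poly2_opp; apply: poly2_mul => //; apply: poly2_mul.
move=> x y s t h1 h2; have [<- <-] := hfg x y s t h1 h2.
by rewrite -h1 -h2; split=> //; rewrite !exprS; ring.
Qed.

(** Each monomial s^i t^j + t^i s^j is a power of s t times a power sum; the exponent N + N of D
    clears all denominators at once. *)
Lemma poly2_sym (D U V : L -> L -> L) p q N : poly2 D -> poly2 U -> poly2 V ->
  (size p <= N.+1)%N -> (size q <= N.+1)%N ->
  exists2 f, poly2 f & forall x y s t, D x y * (s * t) = V x y ->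
    D x y * (s + t) = U x y ->
    D x y ^+ (N + N) * (p.[s] * q.[t] + p.[t] * q.[s]) = f x y.
Proof.
move=> pD pU pV sp sq.
have mono i j : (i <= N)%N -> (j <= N)%N -> exists2 f, poly2 f & forall x y s t,
    D x y * (s * t) = V x y -> D x y * (s + t) = U x y ->
    D x y ^+ (N + N) * (s ^+ i * t ^+ j + t ^+ i * s ^+ j) = f x y.
  wlog ij : i j / (i <= j)%N.
    move=> H iN jN; have [ij|/ltnW ji] := leqP i j; first exact: H.
    have [f pf hf] := H j i ji jN iN; exists f => // x y s t h1 h2.
    by rewrite -(hf x y s t h1 h2); ring.
  move=> iN jN; have [f pf hf] := poly2_power_sum (j - i) pD pU pV.
  exists (fun x y => V x y ^+ i * f x y * D x y ^+ (N + N - (i + (j - i)))).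
    by apply: poly2_mul; [apply: poly2_mul => // |]; exact: poly2_exp.
  move=> x y s t h1 h2; rewrite -h1 -(hf x y s t h1 h2).
  have -> : (N + N = (i + (j - i)) + (N + N - (i + (j - i))))%N by lia.
  rewrite exprD [D x y ^+ (i + _)]exprD addKn !exprMn.
  have -> : t ^+ j = t ^+ i * t ^+ (j - i) by rewrite -exprD subnKC.
  have -> : s ^+ j = s ^+ i * s ^+ (j - i) by rewrite -exprD subnKC.
  ring.
have /choice[f hf] : forall ij : 'I_N.+1 * 'I_N.+1, exists f : L -> L -> L, poly2 f /\
    forall x y s t, D x y * (s * t) = V x y -> D x y * (s + t) = U x y ->
    D x y ^+ (N + N) * (s ^+ ij.1 * t ^+ ij.2 + t ^+ ij.1 * s ^+ ij.2) = f x y.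
  move=> [i j] /=; have [] := mono i j; first by rewrite -ltnS.
    by rewrite -ltnS.
  by move=> f pf hf; exists f.
exists (fun x y => \sum_(i < N.+1) \sum_(j < N.+1) p`_i * q`_j * f (i, j) x y).
  apply: poly2_sum => i; apply: poly2_sum => j; apply: poly2_mul.
    exact: poly2_const.
  by case: (hf (i, j)).
move=> x y s t h1 h2; rewrite !(horner_coef_wide _ sp) !(horner_coef_wide _ sq).
rewrite !mulr_suml -big_split mulr_sumr; apply: eq_bigr => i _ /=.
rewrite !mulr_sumr -big_split mulr_sumr; apply: eq_bigr => j _ /=.
have [_ h] := hf (i, j); rewrite -(h x y s t h1 h2) /=; ring.
Qed.

End Polynomials.

(** * The action of omega on x-coordinates *)

Section RegularFunctions.
Variable L : closedFieldType.
Variable E : weierstrass L.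
Implicit Types (p q : {poly L}) (x y : L) (f g : L -> L -> L).

Definition cubic : {poly L} := 'X^3 + (a2 E *: 'X^2 + a4 E *: 'X + (a6 E)%:P).
Definition lin_part : {poly L} := a1 E *: 'X + (a3 E)%:P.
(** The norm of p + y q: the conjugates of y have sum - [lin_part] and product - [cubic]. *)
Definition curve_norm p q := p ^+ 2 - lin_part * p * q - cubic * q ^+ 2.

Lemma cubic_horner x : cubic.[x] = x ^+ 3 + a2 E * x ^+ 2 + a4 E * x + a6 E.
Proof. by rewrite /cubic !(hornerD, hornerZ, hornerXn, hornerX, hornerC); ring. Qed.

Lemma lin_part_horner x : lin_part.[x] = a1 E * x + a3 E.
Proof. by rewrite /lin_part !(hornerD, hornerZ, hornerX, hornerC). Qed.

Lemma on_curve_sq x y : on_curve E (Some (x, y)) ->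
  y ^+ 2 = cubic.[x] - lin_part.[x] * y.
Proof. by move=> /on_curveE ->; rewrite cubic_horner lin_part_horner; ring. Qed.

Lemma size_cubic : size cubic = 4%N.
Proof.
rewrite /cubic size_polyDl size_polyXn //.
rewrite ltnS; apply/leq_sizeP => j j3.
by rewrite !coefD !coefZ !coefXn coefX coefC; case: j j3 => [|[|[|j]]] //= _; ring.
Qed.

Lemma size_lin_part : (size lin_part <= 2)%N.
Proof.
apply/leq_sizeP => j j3.
by rewrite !coefD !coefZ coefX coefC; case: j j3 => [|[|j]] //= _; ring.
Qed.

(* The parities of the degrees of p^2 and cubic q^2 differ. *)
Lemma curve_norm_eq0 p q : curve_norm p q = 0 -> p = 0 /\ q = 0.
Proof.
have [->|q0] := eqVneq q 0.
  rewrite /curve_norm mulr0 expr0n mulr0 !subr0 => /eqP.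
  by rewrite sqrf_eq0 => /eqP ->.
rewrite /curve_norm => e; exfalso.
have c0 : cubic != 0 by rewrite -size_poly_eq0 size_cubic.
have scq : size (cubic * q ^+ 2) = (size q + size q + 2)%N.
  rewrite expr2 !size_mul ?mulf_neq0 // size_cubic.
  by have : (0 < size q)%N by [rewrite size_poly_gt0]; move: (size q); lia.
have slpq : (size (lin_part * p * q)%R <= size p + size q)%N.
  apply: (leq_trans (size_polyMleq _ _)).
  have := size_polyMleq lin_part p; have := size_lin_part.
  by move: (size lin_part) (size (lin_part * p)%R) (size p) (size q); lia.
have q1 : (0 < size q)%N by rewrite size_poly_gt0.
have sp2 : (size (p ^+ 2)%R <= (size p + size p).-1)%N by rewrite expr2 size_polyMleq.
have [sp|sp] := leqP (size p) (size q).+1.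
  have e2 : cubic * q ^+ 2 = p ^+ 2 - lin_part * p * q.
    by apply/esym/eqP; rewrite -subr_eq0 e.
  have : (size (cubic * q ^+ 2)%R <= (size q + size q).+1)%N.
    rewrite e2 (leq_trans (size_polyD _ _)) // geq_max size_polyN.
    apply/andP; split; [apply: (leq_trans sp2) | apply: (leq_trans slpq)]; lia.
  by rewrite scq; lia.
have p0 : p != 0 by rewrite -size_poly_gt0; lia.
have e2 : p ^+ 2 = lin_part * p * q + cubic * q ^+ 2.
  by apply/eqP; rewrite -subr_eq0 opprD addrA e.
have : (size (p ^+ 2)%R < (size p + size p).-1)%N.
  rewrite e2; apply: (leq_ltn_trans (size_polyD _ _)).
  by rewrite gtn_max scq; apply/andP; split; [apply: (leq_ltn_trans slpq) |]; lia.
by rewrite expr2 size_mul // ltnn.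
Qed.

Definition regular f : Prop := exists p q, forall x y, on_curve E (Some (x, y)) ->
  f x y = p.[x] + y * q.[x].

Lemma regular_poly p : regular (fun x _ => p.[x]).
Proof. by exists p, 0 => x y _; rewrite horner0 mulr0 addr0. Qed.

Lemma regular_const c : regular (fun _ _ => c).
Proof. by exists c%:P, 0 => x y _; rewrite hornerC horner0 mulr0 addr0. Qed.

Lemma regular_x : regular (fun x _ => x).
Proof. by exists 'X, 0 => x y _; rewrite hornerX horner0 mulr0 addr0. Qed.

Lemma regular_y : regular (fun _ y => y).
Proof. by exists 0, 1 => x y _; rewrite horner0 hornerC mulr1 add0r. Qed.

Lemma regularD f g : regular f -> regular g -> regular (fun x y => f x y + g x y).
Proof.
move=> [p [q h]] [p' [q' h']]; exists (p + p'), (q + q') => x y o.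
by rewrite h // h' // !hornerD; ring.
Qed.

Lemma regularM f g : regular f -> regular g -> regular (fun x y => f x y * g x y).
Proof.
move=> [p [q h]] [p' [q' h']].
exists (p * p' + cubic * q * q'), (p * q' + q * p' - lin_part * q * q') => x y o.
rewrite h // h' //; have := on_curve_sq o; move: cubic lin_part => c l e.
rewrite !(hornerD, hornerN, hornerM); ring: e.
Qed.

Lemma regularX f n : regular f -> regular (fun x y => f x y ^+ n).
Proof.
move=> rf; elim: n => [|n [p [q h]]].
  by exists 1, 0 => x y _; rewrite expr0 hornerC horner0 mulr0 addr0.
have [p' [q' h']] : regular (fun x y => f x y * f x y ^+ n).
  by apply: regularM => //; exists p, q.
by exists p', q' => x y o; rewrite exprS h'.
Qed.

Lemma regular_sum (I : Type) (r : seq I) (f : I -> L -> L -> L) :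
  (forall i, regular (f i)) -> regular (fun x y => \sum_(i <- r) f i x y).
Proof.
move=> rf; elim: r => [|i r [p [q h]]].
  by exists 0, 0 => x y _; rewrite big_nil !horner0 mulr0 addr0.
have [p' [q' h']] := regularD (rf i) (ex_intro _ p (ex_intro _ q h)).
by exists p', q' => x y o; rewrite big_cons h'.
Qed.

Lemma regular_norm f p q x y :
  (forall x y, on_curve E (Some (x, y)) -> f x y = p.[x] + y * q.[x]) ->
  on_curve E (Some (x, y)) -> f x y = 0 -> (curve_norm p q).[x] = 0.
Proof.
move=> h o; rewrite h // => e.
have -> : (curve_norm p q).[x] = (p.[x] + y * q.[x]) * (p.[x] - lin_part.[x] * q.[x] - y * q.[x]).
  rewrite /curve_norm; have := on_curve_sq o; move: cubic lin_part => c l e'.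
  rewrite !(hornerD, hornerN, hornerM, horner_exp); ring: e'.
by rewrite e mul0r.
Qed.

Lemma regular_zero f (xs ys : nat -> L) (n0 : nat) : regular f -> injective xs ->
  (forall n, (n0 <= n)%N -> on_curve E (Some (xs n, ys n)) /\ f (xs n) (ys n) = 0) ->
  forall x y, on_curve E (Some (x, y)) -> f x y = 0.
Proof.
move=> [p [q h]] xi z x y o.
have [|p0 q0] := @curve_norm_eq0 p q; last first.
  by rewrite h // p0 q0 !horner0 mulr0 addr0.
apply: (@infinite_roots _ _ xs n0 xi) => n /z[o' e].
exact: (regular_norm h o' e).
Qed.

End RegularFunctions.

Ltac poly2_solve := repeat first [ exact: poly2_const | exact: poly2_fst
  | exact: poly2_snd | apply: poly2_add | apply: poly2_opp | apply: poly2_mul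
  | apply: poly2_exp | apply: poly2_horner | assumption ].

(** * Lattes maps recognised on a single orbit *)

Section Orbit.
Variables (L : closedFieldType) (k : kummer L) (A B : {poly L}) (X Y : nat -> L).
Hypotheses (two : (2 : L) != 0).
Hypotheses (X_inj : forall a b, (0 < a)%N -> (0 < b)%N -> X a = X b -> a = b)
  (Y_inj : forall a b, (0 < a)%N -> (0 < b)%N -> Y a = Y b -> a = b)
  (X_kum : forall a b, (0 < b < a)%N -> kum k (X a) (X b) (X (a + b)%N) (X (a - b)%N))
  (Y_kum : forall a b, (0 < b < a)%N -> kum k (Y a) (Y b) (Y (a + b)%N) (Y (a - b)%N))
  (AB : forall a, (0 < a)%N -> B.[X a] != 0 /\ A.[X a] = Y a * B.[X a]).

Let N := (maxn (size A) (size B)).-1.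

(* The polynomial p, of degree at most N, homogenized and evaluated at (1 : w). *)
Let hom (p : {poly L}) (w : L) := \sum_(i < N.+1) p`_i * w ^+ (N - i).

Let sA : (size A <= N.+1)%N.
Proof. by rewrite /N; move: (size A) (size B); lia. Qed.

Let sB : (size B <= N.+1)%N.
Proof. by rewrite /N; move: (size A) (size B); lia. Qed.

Let homE (p : {poly L}) (w : L) : (size p <= N.+1)%N -> w != 0 -> hom p w = w ^+ N * p.[w^-1].
Proof.
move=> sp w0; rewrite (horner_coef_wide _ sp) mulr_sumr; apply: eq_bigr => i _.
rewrite mulrCA; congr (_ * _).
have -> : w ^+ N = w ^+ (N - i) * w ^+ i by rewrite -exprD subnK // -ltnS.
by rewrite -mulrA -exprMn mulfV // expr1n mulr1.
Qed.

Let hom0 (p : {poly L}) : hom p 0 = p`_N.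
Proof.
rewrite /hom big_ord_recr /= subnn expr0 mulr1 big1 ?add0r // => i _.
by rewrite expr0n subn_eq0 leqNgt ltn_ord /= mulr0.
Qed.

(** The Kummer relation in w = 1 / x, cleared of denominators. It remains meaningful at w = 0, where
    S becomes O; this value is what controls the degrees of A and B. *)
Let D (w y : L) := (1 - y * w) ^+ 2.
Let U (w y : L) := 2 * y * (1 + y * w) + c2 k * y * w + c4 k * (1 + y * w) * w
  + c6 k * w ^+ 2.
Let V (w y : L) := y ^+ 2 - c4 k * y * w - c6 k * (1 + y * w) * w - c8 k * w ^+ 2.

(** The same forms made bihomogeneous in (a : b) and (c : d), so that they apply to A / B without
    dividing. *)
Let Dh (a b c d : L) := (a * d - c * b) ^+ 2.
Let Uh (a b c d : L) := 2 * a * c * (a * d + c * b) + c2 k * a * b * c * d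
  + c4 k * (a * d + c * b) * b * d + c6 k * b ^+ 2 * d ^+ 2.
Let Vh (a b c d : L) := a ^+ 2 * c ^+ 2 - c4 k * a * b * c * d
  - c6 k * (a * d + c * b) * b * d - c8 k * b ^+ 2 * d ^+ 2.

Let kumw x y s t : x != 0 -> kum k x y s t <->
  D x^-1 y * (s * t) = V x^-1 y /\ D x^-1 y * (s + t) = U x^-1 y.
Proof.
move=> x0; have x2 : x ^+ 2 != 0 by rewrite expf_neq0.
have eD : x ^+ 2 * D x^-1 y = (x - y) ^+ 2 by rewrite /D; field.
have eU : x ^+ 2 * U x^-1 y = kU k x y by rewrite /U /kU; field.
have eV : x ^+ 2 * V x^-1 y = kV k x y by rewrite /V /kV; field.
rewrite /kum; split=> -[h1 h2].
  split; apply: (mulfI x2); rewrite [LHS]mulrA eD; first by rewrite h1 eV.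
  by rewrite h2 eU.
by split; rewrite -eD -[LHS]mulrA ?h1 ?h2 ?eV ?eU.
Qed.

(** Symmetrised in s and t, both equations become polynomial identities in w and y. They hold at w =
    1 / X a, y = X b with b < a, hence everywhere. The symmetrisation doubles each term, which is
    why 2 has to be invertible. *)
Let identity : forall w y s t, D w y != 0 -> D w y * (s * t) = V w y ->
  D w y * (s + t) = U w y ->
  Dh (hom A w) (hom B w) A.[y] B.[y] * (A.[s] * A.[t]) =
    Vh (hom A w) (hom B w) A.[y] B.[y] * (B.[s] * B.[t]) /\
  Dh (hom A w) (hom B w) A.[y] B.[y] * (A.[s] * B.[t] + A.[t] * B.[s]) =
    Uh (hom A w) (hom B w) A.[y] B.[y] * (B.[s] * B.[t]).
Proof.
have pD : poly2 D by rewrite /D; poly2_solve.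
have pU : poly2 U by rewrite /U; poly2_solve.
have pV : poly2 V by rewrite /V; poly2_solve.
have phom p : poly2 (fun w _ : L => hom p w).
  by apply: poly2_sum => i; poly2_solve.
have phA := phom A; have phB := phom B.
have [faa paa eaa] := poly2_sym pD pU pV sA sA.
have [fab pab eab] := poly2_sym pD pU pV sA sB.
have [fbb pbb ebb] := poly2_sym pD pU pV sB sB.
pose h1 w y := Dh (hom A w) (hom B w) A.[y] B.[y] * faa w y -
  Vh (hom A w) (hom B w) A.[y] B.[y] * fbb w y.
pose h2 w y := 2 * Dh (hom A w) (hom B w) A.[y] B.[y] * fab w y -
  Uh (hom A w) (hom B w) A.[y] B.[y] * fbb w y.
have ph1 : poly2 h1 by rewrite /h1 /Dh /Vh; poly2_solve.
have ph2 : poly2 h2 by rewrite /h2 /Dh /Uh; poly2_solve.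
have [n0 n00 Xn0] : exists2 n0, (0 < n0)%N & forall n, (n0 <= n)%N -> X n != 0.
  have [[a [a0 Xa]]|na] := pselect (exists a, (0 < a)%N /\ X a = 0).
    exists a.+1 => // n an; apply/eqP => Xn.
    have n0 : (0 < n)%N by apply: leq_trans an.
    have := X_inj n0 a0; rewrite Xn Xa => /(_ erefl) e.
    by move: an; rewrite e ltnn.
  by exists 1%N => // n n0; apply/eqP => Xn; apply: na; exists n.
have grid w a b : (0 < b < a)%N -> X a != 0 -> w = (X a)^-1 ->
    h1 w (X b) = 0 /\ h2 w (X b) = 0.
  move=> ab xa ->; have /andP[b0 ba] := ab; have a0 : (0 < a)%N by apply: leq_ltn_trans ba.
  have [d1 d2] := (kumw _ _ _ xa).1 (X_kum ab).
  have [e1 e2] := Y_kum ab.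
  have w0 : (X a)^-1 != 0 by rewrite invr_eq0.
  rewrite /h1 /h2 -(eaa _ _ _ _ d1 d2) -(eab _ _ _ _ d1 d2) -(ebb _ _ _ _ d1 d2).
  rewrite !homE // invrK.
  have [_ ->] := AB a0; have [_ ->] := AB b0.
  have [_ ->] : B.[X (a + b)%N] != 0 /\ A.[X (a + b)%N] = Y (a + b)%N * B.[X (a + b)%N].
    by apply: AB; rewrite addn_gt0 a0.
  have [_ ->] : B.[X (a - b)%N] != 0 /\ A.[X (a - b)%N] = Y (a - b)%N * B.[X (a - b)%N].
    by apply: AB; rewrite subn_gt0.
  set P := _ ^+ (N + N); set Q := _ ^+ N.
  move: B.[X a] B.[X b] B.[X (a + b)%N] B.[X (a - b)%N] e1 e2.
  move: (Y (a + b)%N) (Y (a - b)%N) (Y a) (Y b) => s t x y r1 r2 r3 r4 e1 e2.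
  split.
    have -> : Vh (Q * (x * r1)) (Q * r1) (y * r2) r2 = (Q * r1 * r2) ^+ 2 * kV k x y.
      by rewrite /Vh /kV; ring.
    by rewrite -e1 /Dh; ring.
  have -> : Uh (Q * (x * r1)) (Q * r1) (y * r2) r2 = (Q * r1 * r2) ^+ 2 * kU k x y.
    by rewrite /Uh /kU; ring.
  by rewrite -e2 /Dh; ring.
have [z1 z2] : (forall w y, h1 w y = 0) /\ (forall w y, h2 w y = 0).
  have xi : injective (fun a => (X (a + n0)%N)^-1).
    move=> a b /invr_inj /X_inj; rewrite !addn_gt0 n00 !orbT => /(_ isT isT).
    exact: addIn.
  have yi : injective (fun b => X (b + n0)%N).
    move=> a b /X_inj; rewrite !addn_gt0 n00 !orbT => /(_ isT isT).
    exact: addIn.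
  have g b a : (b < a)%N -> h1 (X (a + n0)%N)^-1 (X (b + n0)%N) = 0 /\
      h2 (X (a + n0)%N)^-1 (X (b + n0)%N) = 0.
    move=> ba; apply: (grid _ (a + n0)%N) => //.
      by rewrite addn_gt0 n00 orbT ltn_add2r.
    by apply: Xn0; rewrite leq_addl.
  by split; apply: (poly2_zero _ xi yi) => // b a /g[].
move=> w y s t D0 d1 d2.
have P0 : D w y ^+ (N + N) != 0 by rewrite expf_neq0.
split; apply: (mulfI (mulf_neq0 two P0)); apply/eqP; rewrite -subr_eq0; apply/eqP.
  rewrite -(z1 w y) /h1 -(eaa _ _ _ _ d1 d2) -(ebb _ _ _ _ d1 d2); ring.
rewrite -(z2 w y) /h2 -(eab _ _ _ _ d1 d2) -(ebb _ _ _ _ d1 d2); ring.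
Qed.

Lemma orbit_lattes : lattes k A B.
Proof.
have main x y s t : x != 0 -> x != y -> kum k x y s t ->
    B.[x] != 0 -> B.[y] != 0 -> B.[s] != 0 -> B.[t] != 0 ->
    kum k (A.[x] / B.[x]) (A.[y] / B.[y]) (A.[s] / B.[s]) (A.[t] / B.[t]).
  move=> x0 xy /(kumw _ _ _ x0)[d1 d2] Bx By Bs Bt.
  have w0 : x^-1 != 0 by rewrite invr_eq0.
  have D0 : D x^-1 y != 0.
    have -> : D x^-1 y = ((x - y) / x) ^+ 2 by rewrite /D; field.
    by rewrite expf_neq0 // mulf_neq0 // subr_eq0.
  have [] := identity D0 d1 d2; rewrite !homE // invrK => i1 i2.
  have Q0 : x^-1 ^+ N != 0 by rewrite expf_neq0.
  move: (x^-1 ^+ N) A.[x] A.[y] A.[s] A.[t] B.[x] B.[y] B.[s] B.[t] Q0 Bx By Bs Bt i1 i2.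
  move=> Q ax ay as_ at_ bx by_ bs bt Q0 Bx By Bs Bt i1 i2.
  pose c := (Q * bx * by_) ^+ 2 * (bs * bt).
  have c0 : c != 0 by rewrite /c !(mulf_neq0, expf_neq0).
  split; apply: (mulfI c0).
    have -> : c * ((ax / bx - ay / by_) ^+ 2 * (as_ / bs * (at_ / bt))) =
        Dh (Q * ax) (Q * bx) ay by_ * (as_ * at_).
      by rewrite /c /Dh; field; apply/and4P; split.
    by rewrite i1 /c /Vh /kV; field; apply/andP.
  have -> : c * ((ax / bx - ay / by_) ^+ 2 * (as_ / bs + at_ / bt)) =
      Dh (Q * ax) (Q * bx) ay by_ * (as_ * bt + at_ * bs).
    by rewrite /c /Dh; field; apply/and4P; split.
  by rewrite i2 /c /Uh /kU; field; apply/andP.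
(* [main] inverts x; when x = 0, y is non-zero and the two points change roles. *)
move=> x y s t xy kk Bx By Bs Bt; have [x0|x0] := eqVneq x 0; last exact: main.
apply: kumC; apply: main => //; last exact: kumC.
  by rewrite -x0 eq_sym.
by rewrite eq_sym.
Qed.

(** O has to be mapped to O. If B had full degree N, O would be sent to a finite c, and the identity
    at w = 0 would make every Y b a root of the monic quartic [phi2] - c [psi2]. *)
Lemma orbit_size : (size B < size A)%N.
Proof.
have B0 : B != 0.
  by have [b1 _] := AB (isT : 0 < 1)%N; apply: contra_neq b1 => ->; rewrite horner0.
have BN : B`_N = 0.
  apply: contrapT => /eqP b0; pose c := A`_N / B`_N.
  have key b : (0 < b)%N -> phi2 k (Y b) - c * psi2 k (Y b) = 0.
    move=> b0'; have [By eA] := AB b0'; set y := X b in By eA.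
    (* At w = 0 the first point is O, so both s and t equal y. *)
    have [|||] := @identity 0 y y y.
    - by rewrite /D mulr0 subr0 expr1n oner_eq0.
    - by rewrite /D /V; ring.
    - by rewrite /D /U; ring.
    rewrite !hom0 eA => i1 i2.
    have kk : kum k c (Y b) (Y b) (Y b).
      have c0 : (B`_N * B.[y]) ^+ 2 * (B.[y] * B.[y]) != 0.
        by rewrite !(mulf_neq0, expf_neq0).
      split; apply: (mulfI c0).
        transitivity (Dh A`_N B`_N (Y b * B.[y]) B.[y] * (Y b * B.[y] * (Y b * B.[y]))).
          by rewrite /Dh /c; field.
        by rewrite i1 /Vh /kV /c; field.
      transitivity (Dh A`_N B`_N (Y b * B.[y]) B.[y] *
          (Y b * B.[y] * B.[y] + Y b * B.[y] * B.[y])).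
        by rewrite /Dh /c; field.
      by rewrite i2 /Uh /kU /c; field.
    have := kum_sym (Y b) (kumC kk); rewrite !subrr mulr0 expr0n mul0r add0r => <-.
    by rewrite /phi2 /psi2 /kU /kV; ring.
  pose f : {poly L} := 'X^4 - ((4 * c) *: 'X^3 + (c4 k + c * c2 k) *: 'X^2
    + (2 * c6 k + 2 * c * c4 k) *: 'X + (c8 k + c * c6 k)%:P).
  have f0 : f != 0.
    apply/eqP => /(congr1 (fun p : {poly L} => p`_4)).
    rewrite coefB !coefD !coefZ coefX !coefXn coefC coef0 /= !mulr0 !addr0 subr0.
    by move/eqP; rewrite oner_eq0.
  have yi : injective (fun n => Y n.+1) by move=> a b e; have [] := Y_inj (ltn0Sn a) (ltn0Sn b) e.
  have [n h] := avoid_roots f0 yi; move: (h n (leqnn n)).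
  rewrite /f !(hornerD, hornerN, hornerZ, hornerXn, hornerX, hornerC).
  rewrite [X in X != 0](_ : _ = phi2 k (Y n.+1) - c * psi2 k (Y n.+1)).
    by rewrite key // eqxx.
  by rewrite /phi2 /psi2; ring.
have sB0 : (0 < size B)%N by rewrite size_poly_gt0.
have lB : (size B <= N)%N.
  rewrite leqNgt; apply/negP => NB; have eN : size B = N.+1 by apply/eqP; rewrite eqn_leq sB.
  by move/eqP: BN; rewrite -[N]/(N.+1.-1) -eN -lead_coefE lead_coef_eq0 (negPf B0).
move: lB sB0; rewrite /N; move: (size A) (size B); lia.
Qed.

End Orbit.

(** * The rational function by which omega acts on x-coordinates *)

Section CMLattes.
Variables (K : fieldExtType rat) (iota : {rmorphism K -> algC}).
Variables (E : weierstrass K) (omega : K) (m : K -> wpoint algC -> wpoint algC).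
Variable P : wpoint K.
Hypotheses (omega_quadratic : imaginary_quadratic_integer omega)
  (E_cm : complex_multiplication iota E omega m)
  (P_on : on_curve E P) (P_nontorsion : nontorsion E P).
Implicit Types (z w : K).
Local Notation Zw := (Zomega omega).
Local Notation Ebar := (map_curve iota E).
Local Notation xP := (xP iota E m P).
Local Notation yP := (yP iota E m P).
Local Notation pt := (pt iota E m P).

Lemma omega_neq0 : omega != 0.
Proof.
have [t [n [e tn]]] := omega_quadratic; apply/eqP => w0; move: e tn.
rewrite w0 expr0n mulr0 subr0 add0r => /eqP; rewrite intK_eq0 => /eqP ->.
by rewrite mulr0 ltNge sqr_ge0.
Qed.

Lemma Zw_nat n : Zw n%:R.
Proof. exact: (Zw_int omega n). Qed.

Let Zo := Zw_omega omega.

Lemma map_pt z : Zw z -> z != 0 -> map_point iota (pt z) = Some (iota (xP z), iota (yP z)).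
Proof. by move=> Zz z0; rewrite (pt_affine omega_quadratic E_cm P_on P_nontorsion Zz z0). Qed.

Lemma regular_form (F : {mpoly K[3]}) :
  regular Ebar (fun x y => mmap iota (proj (Some (x, y))) F).
Proof.
apply: regular_sum => mm; apply: regularM; first exact: regular_const.
have [p [q h]] : regular Ebar (fun x y => x ^+ mm 0 * y ^+ mm 1).
  by apply: regularM; apply: regularX; [exact: regular_x | exact: regular_y].
exists p, q => x y o; rewrite -h // /mmap1 !big_ord_recl big_ord0 /proj !(tnth_nth 0) /=.
rewrite expr1n !mulr1; congr (_ ^+ mm _ * _ ^+ mm _); exact: val_inj.
Qed.

(** The two functions are the first and third of the forms describing omega near [z0]P. The third
    does not vanish there because the image is not O. At points where all three forms vanish the
    relation is trivially true. *)
Lemma local_forms z0 : Zw z0 -> z0 != 0 -> exists f0 f2,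
  [/\ regular Ebar f0, regular Ebar f2, f2 (iota (xP z0)) (iota (yP z0)) != 0 &
   forall z, Zw z -> z != 0 -> f0 (iota (xP z)) (iota (yP z)) =
     iota (xP (omega * z)) * f2 (iota (xP z)) (iota (yP z))].
Proof.
move=> Zz0 z00; have [[hc hF] _] := cm_endo E_cm Zo.
have on z : Zw z -> z != 0 -> on_curve Ebar (map_point iota (pt z)).
  by move=> Zz nz; rewrite map_on_curve; case: (ptP E_cm P_on Zz).
have [d [F [_ Fn FE]]] := hF _ (on z0 Zz0 z00).
pose f (i : nat) (x y : algC) := mmap iota (proj (Some (x, y))) (F (inord i)).
have img z : Zw z -> z != 0 -> m omega (map_point iota (pt z)) =
    Some (iota (xP (omega * z)), iota (yP (omega * z))).
  move=> Zz nz; rewrite -(ptM omega_quadratic E_cm P_on Zo Zz) map_pt //.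
    exact: ZwM.
  by rewrite mulf_neq0 // omega_neq0.
have fE z i : Zw z -> z != 0 -> f i (iota (xP z)) (iota (yP z)) =
    mmap iota (proj (map_point iota (pt z))) (F (inord i)).
  by move=> Zz nz; rewrite map_pt.
have key z : Zw z -> z != 0 ->
    (exists i, mmap iota (proj (map_point iota (pt z))) (F i) != 0) ->
    f 2 (iota (xP z)) (iota (yP z)) != 0 /\ f 0 (iota (xP z)) (iota (yP z)) =
      iota (xP (omega * z)) * f 2 (iota (xP z)) (iota (yP z)).
  move=> Zz nz ex; rewrite !fE //; have := FE _ (on z Zz nz) ex; rewrite img // => h.
  have n2 : mmap iota (proj (map_point iota (pt z))) (F (inord 2)) != 0.
    by apply/eqP => e; have := same_proj_O h e.
  by split=> //; have := same_proj_affine h n2 => -[-> _]; rewrite divfK.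
exists (f 0), (f 2); split.
- exact: regular_form.
- exact: regular_form.
- by case: (key z0 Zz0 z00).
- move=> z Zz nz; have [ex|nex] := pselect (exists i,
    mmap iota (proj (map_point iota (pt z))) (F i) != 0); first by case: (key z).
  have all0 i : f i (iota (xP z)) (iota (yP z)) = 0.
    by rewrite fE //; apply: contrapT => /eqP h; apply: nex; exists (inord i).
  by rewrite !all0 mulr0.
Qed.

Let xs n := iota (xP n.+1%:R).

Lemma xs_inj : injective xs.
Proof.
move=> a b /fmorph_inj /(xP_inj omega_quadratic E_cm P_on P_nontorsion
  (Zw_nat _) (Zw_nat _) (natK_neq0 K (ltn0Sn _)) (natK_neq0 K (ltn0Sn _))).
case=> /eqP; last first.
  by rewrite -subr_eq0 opprK -natrD (negPf (natK_neq0 K _)).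
rewrite -subr_eq0.
have -> : a.+1%:R - b.+1%:R = (a.+1%:Z - b.+1%:Z)%:~R :> K by rewrite intrB.
by rewrite intK_eq0; lia.
Qed.

(** The quotient f0 / f2 depends on x and y, but x([omega z]P) is unchanged under z -> - z, so
    averaging over the two conjugates gives a function of x alone. Dividing by the gcd makes
    numerator and denominator coprime. *)
Lemma xmap : exists A B : {poly algC}, (forall x, A.[x] = 0 -> B.[x] != 0) /\
  forall z, Zw z -> z != 0 ->
    A.[iota (xP z)] = iota (xP (omega * z)) * B.[iota (xP z)].
Proof.
have [f0 [f2 [[p0 [q0 h0]] [p2 [q2 h2]] nf f02]]] := local_forms (Zw1 omega) (oner_neq0 K).
have on z : Zw z -> z != 0 -> on_curve Ebar (Some (iota (xP z), iota (yP z))).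
  move=> Zz nz; rewrite -map_pt // map_on_curve; by case: (ptP E_cm P_on Zz).
pose c := cubic Ebar; pose l := lin_part Ebar.
(* A0 is the trace of f0 times the conjugate of f2, and B0 is twice the norm of f2. *)
pose A0 := 2 *: (p0 * p2) - l * (p0 * q2 + q0 * p2) - 2 *: (c * q0 * q2).
pose B0 := 2 *: curve_norm Ebar p2 q2.
have B00 : B0 != 0.
  rewrite scaler_eq0 negb_or pnatr_eq0 /=; apply/eqP => /curve_norm_eq0[e1 e2].
  move: nf; rewrite h2; last by apply: on; [exact: Zw1 | exact: oner_neq0].
  by rewrite e1 e2 !horner0 mulr0 addr0 eqxx.
have AB0 z : Zw z -> z != 0 -> A0.[iota (xP z)] = iota (xP (omega * z)) * B0.[iota (xP z)].
  move=> Zz nz; have Zn := ZwN Zz; have nn : - z != 0 by rewrite oppr_eq0.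
  have e1 := f02 z Zz nz; have e2 := f02 (- z) Zn nn.
  rewrite mulrN !(xPN E_cm P_on) // in e2; last exact: ZwM.
  rewrite h0 ?h2 ?on // in e1.
  have o2 := on _ Zn nn; rewrite (xPN E_cm P_on) // in o2.
  rewrite h0 // h2 // in e2.
  have sq := on_curve_sq (on z Zz nz); rewrite -/c -/l in sq.
  have ey : iota (yP (- z)) = - iota (yP z) - l.[iota (xP z)].
    have := ptN E_cm P_on Zz.
    rewrite (pt_affine omega_quadratic E_cm P_on P_nontorsion Zn nn).
    rewrite (pt_affine omega_quadratic E_cm P_on P_nontorsion Zz nz) /= => -[_ ->].
    by rewrite /l lin_part_horner /= !(rmorphB, rmorphN, rmorphM); ring.
  rewrite ey in e2; move: sq e1 e2; rewrite /A0 /B0 /curve_norm -/c -/l.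
  move: (c) (l) => c' l'.
  rewrite !(hornerD, hornerN, hornerM, hornerZ, horner_exp).
  move: c'.[_] l'.[_] p0.[_] q0.[_] p2.[_] q2.[_] (iota (yP z)) (iota (xP (omega * z))).
  move=> cx lx p0x q0x p2x q2x y X sq e1 e2.
  have -> : 2 * (p0x * p2x) - lx * (p0x * q2x + q0x * p2x) - 2 * (cx * q0x * q2x) =
      (p0x + y * q0x) * (p2x + (- y - lx) * q2x) + (p0x + (- y - lx) * q0x) * (p2x + y * q2x).
    by ring: sq.
  by rewrite e1 e2; ring: sq.
pose g := gcdp A0 B0; pose A := A0 %/ g; pose B := B0 %/ g.
have eA : A0 = A * g by rewrite divpK // dvdp_gcdl.
have eB : B0 = B * g by rewrite divpK // dvdp_gcdr.
have g0 : g != 0 by rewrite gcdp_eq0 negb_and B00 orbT.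
have cop : coprimep A B by apply: coprimep_div_gcd; rewrite B00 orbT.
exists A, B; split; first by move=> x /rootP /(coprimep_root cop).
have good z : Zw z -> z != 0 -> g.[iota (xP z)] != 0 ->
    A.[iota (xP z)] = iota (xP (omega * z)) * B.[iota (xP z)].
  move=> Zz nz gz; apply: (mulIf gz); rewrite -mulrA -!hornerM -eA -eB.
  exact: AB0.
(* The gcd g may vanish at [z]P and cannot be cancelled there. The forms valid near [z]P give a
   regular function that vanishes at all but finitely many multiples of P, hence on the whole
   curve. *)
move=> z Zz nz; have [f0' [f2' [r0 r2 nf' f02']]] := local_forms Zz nz.
have [n0 hn0] := avoid_roots g0 xs_inj.
have rh : regular Ebar (fun x y => A.[x] * f2' x y - B.[x] * f0' x y).
  have [p [q h]] : regular Ebar (fun x y => A.[x] * f2' x y + (-1) * (B.[x] * f0' x y)).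
    apply: regularD; first by apply: regularM => //; exact: regular_poly.
    by apply: regularM; [exact: regular_const | apply: regularM => //; exact: regular_poly].
  by exists p, q => x y o; rewrite -h // mulN1r.
have := regular_zero (ys := fun n => iota (yP n.+1%:R)) (n0 := n0) rh xs_inj.
move=> /(_ _ _ _ (on z Zz nz)) h; apply: (mulIf nf'); rewrite -mulrA mulrCA -f02' //.
apply/eqP; rewrite -subr_eq0; apply/eqP; apply: h => n nn.
have nk := natK_neq0 K (ltn0Sn n); split; first by apply: on => //; exact: Zw_nat.
rewrite /xs (good _ (Zw_nat _) nk (hn0 n nn)) (f02' _ (Zw_nat _) nk); ring.
Qed.

End CMLattes.

(** * Compatibility of the Kummer data with field embeddings *)

Section Morphism.
Variables (k L : fieldType) (f : {rmorphism k -> L}).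

Definition map_kummer (c : kummer k) : kummer L :=
  Kummer (f (c2 c)) (f (c4 c)) (f (c6 c)) (f (c8 c)).

Let fn n : f n%:R = n%:R. Proof. exact: rmorph_nat. Qed.

Lemma kum_of_map E : kum_of (map_curve f E) = map_kummer (kum_of E).
Proof.
by rewrite /kum_of /map_kummer /=; congr Kummer;
   rewrite !(fn, rmorphXn, rmorphM, rmorphN, rmorphD).
Qed.

Lemma psi2_map c x : psi2 (map_kummer c) (f x) = f (psi2 c x).
Proof. by rewrite /psi2 /= !(fn, rmorphXn, rmorphM, rmorphN, rmorphD). Qed.

Lemma phi2_map c x : phi2 (map_kummer c) (f x) = f (phi2 c x).
Proof. by rewrite /phi2 /= !(fn, rmorphXn, rmorphM, rmorphN, rmorphD). Qed.

Lemma kdisc_map c : kdisc (map_kummer c) = f (kdisc c).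
Proof. by rewrite /kdisc /= !(fn, rmorphXn, rmorphM, rmorphN, rmorphD). Qed.

Lemma kum_map c x y s t : kum c x y s t -> kum (map_kummer c) (f x) (f y) (f s) (f t).
Proof.
have eU : kU (map_kummer c) (f x) (f y) = f (kU c x y).
  by rewrite /kU /= !(fn, rmorphXn, rmorphM, rmorphN, rmorphD).
have eV : kV (map_kummer c) (f x) (f y) = f (kV c x y).
  by rewrite /kV /= !(fn, rmorphXn, rmorphM, rmorphN, rmorphD).
by move=> [e1 e2]; rewrite /kum eU eV -e1 -e2 !(rmorphXn, rmorphM, rmorphN, rmorphD).
Qed.

End Morphism.

(** * Valuation rings above a prime of K *)

Section DominatingRing.
Variables (K : fieldExtType rat) (L : fieldType) (iota : {rmorphism K -> L}).
Variables (p : set K) (pp : is_prime p).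
Local Notation OK := (@ringOfIntegers K).

(** Domination gives one inclusion. For the other, an x outside the local ring has its inverse in
    the maximal ideal of that ring, hence in that of V; then x cannot lie in V. *)
Lemma valring_over_prime : exists2 V : set L, valring V &
  forall x, V (iota x) <-> loc p x.
Proof.
have [[pO p0 pD pM] _ n1 _] := pp.
have [||||||||V [HV RV PV]] := @valring_dominating L (iota @` OK) (iota @` p).
- by exists 1; [exact: OK1 | rewrite rmorph1].
- move=> _ _ [x Ox <-] [y Oy <-]; exists (x - y); [exact: OKB | exact: rmorphB].
- move=> _ _ [x Ox <-] [y Oy <-]; exists (x * y); [exact: OKM | exact: rmorphM].
- by move=> _ [x px <-]; exists x => //; apply: pO.
- by exists 0; rewrite ?rmorph0.
- move=> _ _ [x px <-] [y py <-]; exists (x + y); [exact: pD | exact: rmorphD].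
- move=> _ _ [x px <-] [y Oy <-]; exists (y * x); [exact: pM|].
  by rewrite rmorphM mulrC.
- by move=> [x px]; rewrite -(rmorph1 iota) => /fmorph_inj e; apply: n1; rewrite -e.
have VO x : OK x -> V (iota x) by move=> Ox; apply: RV; exists x.
have Mp x : p x -> vmax V (iota x) by move=> px; apply: PV; exists x.
have un s : OK s -> ~ p s -> V (iota s^-1).
  move=> Os ns; have [r Or prs] := prime_maximal pp Os ns.
  have Ms : ~ vmax V (iota s).
    move=> Ms; apply: (vmax1 HV).
    have -> : 1 = iota r * iota s - iota (r * s - 1).
      by rewrite rmorphB rmorphM rmorph1; ring.
    by apply: (vmaxB HV); [apply: (vmaxMl HV) => //; apply: VO | apply: Mp].
  by rewrite fmorphV; have [] := vunit (VO s Os) Ms.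
exists V => // x; split=> [Vx|[s [Os ns Osx]]]; last first.
  have s0 : s != 0 by apply/eqP => s0; apply: ns; rewrite s0.
  by rewrite -(mulKf s0 x) rmorphM; apply: (vrM HV); [apply: un | apply: VO].
have [->|x0] := eqVneq x 0; first by apply: (loc_OK pp); exact: OK0.
apply: contrapT => nl; have Mi := not_vr_inv nl.
have [s [Os ns psx]] := vmax_locP pp Mi; apply: (vmax1 HV).
have s0 : s != 0 by apply/eqP => s0; apply: ns; rewrite s0.
have -> : 1 = iota (s * x^-1) * (iota s^-1 * iota x).
  have e : s * x^-1 * (s^-1 * x) = 1 by field; apply/andP.
  by rewrite -!rmorphM e rmorph1.
by apply: (vmaxMr HV); [apply: Mp | apply: (vrM HV) => //; apply: un].
Qed.

End DominatingRing.

(** * Stability of non-singular points under omega *)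

Section Stability.
Variables (K : fieldExtType rat) (iota : {rmorphism K -> algC}).
Variables (E : weierstrass K) (omega : K) (m : K -> wpoint algC -> wpoint algC).
Variables (p : set K) (P : wpoint K).
Hypotheses (E_integral : integral_coefficients E) (E_elliptic : elliptic E)
  (omega_quadratic : imaginary_quadratic_integer omega)
  (E_cm : complex_multiplication iota E omega m)
  (pp : is_prime p)
  (P_on : on_curve E P) (P_nontorsion : nontorsion E P).
Implicit Types (x y z w : K).
Local Notation Zw := (Zomega omega).
Local Notation xP := (xP iota E m P).
Local Notation k := (kum_of E).

Lemma kint_of : kint (loc p) k.
Proof.
have [o1 o2 o3 o4 o6] := E_integral; have HV := loc_valring pp.
have [l1 l2 l3] := And3 (loc_OK pp o1) (loc_OK pp o2) (loc_OK pp o3).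
have [l4 l6] := conj (loc_OK pp o4) (loc_OK pp o6).
by split; rewrite /=; vr_solve HV.
Qed.

(** The orbits a -> [a]P and a -> [omega a]P both satisfy the Kummer relation, which makes the
    function of [xmap] a Lattes map over [algC]; [lattes_nonsing] applies to it with a valuation
    ring above p. *)
Theorem omega_stable z : Zw z -> z != 0 -> ~ sing (loc p) k (xP z) ->
  ~ sing (loc p) k (xP (omega * z)).
Proof.
move=> Zz z0; have [V HV VK'] := valring_over_prime iota pp.
have VK x : V (iota x) = loc p x by apply: propext; exact: VK'.
have Zo := Zw_omega omega; have o0 := omega_neq0 omega_quadratic.
have MK x : vmax V (iota x) = vmax (loc p) x.
  apply: propext; rewrite /vmax /= -fmorphV VK; split=> -[e|?]; try by right.
    by left; apply/eqP; rewrite -(fmorph_eq0 iota) e.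
  by left; rewrite e rmorph0.
have sK x : sing V (map_kummer iota k) (iota x) = sing (loc p) k x.
  by rewrite /sing psi2_map phi2_map !MK VK.
have ki : kint V (map_kummer iota k).
  by have [? ? ? ?] := kint_of; split; rewrite /= VK.
have wf : kwf (map_kummer iota k) by rewrite -kum_of_map; exact: kwf_of.
have d0 : kdisc (map_kummer iota k) != 0 by rewrite kdisc_map fmorph_eq0.
have [A [B [cop AB]]] := xmap omega_quadratic E_cm P_on P_nontorsion.
have nB w : Zw w -> w != 0 -> B.[iota (xP w)] != 0.
  move=> Zw' w0; apply/eqP => e; have := AB w Zw' w0; rewrite e mulr0 => /cop.
  by rewrite e eqxx.
have Zn := Zw_nat omega.
have nn a : (0 < a)%N -> a%:R != 0 :> K := @natK_neq0 K a.
have inj (c : K) : Zw c -> c != 0 -> forall a b, (0 < a)%N -> (0 < b)%N ->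
    iota (xP (c * a%:R)) = iota (xP (c * b%:R)) -> a = b.
  move=> Zc c0 a b a0 b0 /fmorph_inj.
  move=> /(xP_inj omega_quadratic E_cm P_on P_nontorsion (ZwM omega_quadratic Zc (Zn a))
    (ZwM omega_quadratic Zc (Zn b)) (mulf_neq0 c0 (nn a a0)) (mulf_neq0 c0 (nn b b0))).
  rewrite -mulrN => -[] /(mulfI c0) /eqP; last first.
    by rewrite -subr_eq0 opprK -natrD (negPf (nn _ _)) // addn_gt0 a0.
  rewrite -subr_eq0; have -> : a%:R - b%:R = (a%:Z - b%:Z)%:~R :> K by rewrite intrB.
  by rewrite intK_eq0; lia.
have kk (c : K) : Zw c -> c != 0 -> forall a b, (0 < b < a)%N ->
    kum (map_kummer iota k) (iota (xP (c * a%:R))) (iota (xP (c * b%:R)))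
      (iota (xP (c * (a + b)%:R))) (iota (xP (c * (a - b)%:R))).
  move=> Zc c0 a b /andP[b0 ba]; apply: kum_map.
  have a0 : (0 < a)%N by apply: leq_ltn_trans ba.
  rewrite natrD mulrDr natrB ?(ltnW ba) // mulrBr.
  apply: (xP_kum omega_quadratic E_cm P_on P_nontorsion); rewrite ?mulf_neq0 ?nn //.
  - exact: ZwM.
  - exact: ZwM.
  - by rewrite -mulrDr -natrD mulf_neq0 // nn // addn_gt0 a0.
  - by rewrite -mulrBr -natrB ?(ltnW ba) // mulf_neq0 // nn // subn_gt0.
have two : (2 : algC) != 0 by rewrite pnatr_eq0.
have inj1 := inj 1 (Zw1 omega) (oner_neq0 K); have kk1 := kk 1 (Zw1 omega) (oner_neq0 K).
have injo := inj omega Zo o0; have kko := kk omega Zo o0.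
have ABn a : (0 < a)%N -> B.[iota (xP (1 * a%:R))] != 0 /\
    A.[iota (xP (1 * a%:R))] = iota (xP (omega * a%:R)) * B.[iota (xP (1 * a%:R))].
  by move=> a0; rewrite mul1r; split; [apply: nB => //; exact: nn | apply: AB => //; exact: nn].
have lat := orbit_lattes two inj1 kk1 kko ABn.
have sz := orbit_size two inj1 injo kk1 kko ABn.
have := @lattes_nonsing _ V HV _ A B wf ki d0 lat sz cop (iota (xP z)).
rewrite AB // mulfK ?nB // !sK => h nz; exact: h nz isT.
Qed.

End Stability.

(** * Points with non-singular reduction *)

Section WeierstrassPartials.
Variable L : fieldType.
Implicit Types (E : weierstrass L) (u : 'I_3 -> L).

Lemma mderiv_var (i j : 'I_3) : mderiv i ('X_j : {mpoly L[3]}) = ((i == j)%:R)%:MP.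
Proof.
rewrite mderivX mnm1E [j == i]eq_sym; case: eqP => [->|_]; last by rewrite scale0r mpolyC0.
by rewrite scale1r (_ : (U_(j) - U_(j))%MM = 0%MM) ?mpolyX0 //; apply/mnmP => l; rewrite mnmBE mnm0E subnn.
Qed.

Lemma weierstrass_partials E u (i : 'I_3) :
  let x := u 0 in let y := u 1 in let z := u (2 : 'I_3) in
  (mderiv i (weierstrass_form E)).@[u] =
  (i == 0)%:R * (a1 E * y * z - 3 * x ^+ 2 - 2 * a2 E * x * z - a4 E * z ^+ 2) +
  (i == 1)%:R * (2 * y * z + a1 E * x * z + a3 E * z ^+ 2) +
  (i == 2)%:R * (y ^+ 2 + a1 E * x * y + 2 * a3 E * y * z - a2 E * x ^+ 2
     - 2 * a4 E * x * z - 3 * a6 E * z ^+ 2).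
Proof.
rewrite /= /weierstrass_form !exprS !expr0 !mulr1.
rewrite !(mderivB, mderivD, mderivZ, mderivM, mderiv_var).
rewrite !(mevalB, mevalD, mevalZ, mevalM, mevalC, mevalXU); ring.
Qed.

End WeierstrassPartials.

Section NonsingularPoints.
Variables (K : fieldExtType rat) (E : weierstrass K) (p : set K).
Hypotheses (E_integral : integral_coefficients E) (pp : is_prime p).
Implicit Types (x y : K).
Local Notation V := (loc p).
Local Notation M := (vmax (loc p)).
Local Notation v := (vK p).
Local Notation k := (kum_of E).

Let HV : valring V. Proof. exact: loc_valring. Qed.

Let Va : [/\ V (a1 E), V (a2 E), V (a3 E), V (a4 E) & V (a6 E)].
Proof. by have [? ? ? ? ?] := E_integral; split; apply: loc_OK. Qed.

Lemma nu_ge0 x : (0 <= nu p x)%E <-> V x.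
Proof.
rewrite nuE; case: eqP => [->|/eqP x0]; last by rewrite lee_fin loc_vK.
by split=> // _; exact: (vr0 HV).
Qed.

Lemma nu_eq0 x : nu p x = 0%E <-> V x /\ ~ M x.
Proof.
rewrite nuE; case: eqP => [->|/eqP x0]; last by rewrite unit_vK //; split=> [[]|->].
by split=> // -[_ []]; exact: vmax0.
Qed.

(* Off the integers, y / x is not integral either, and x = (y / x)^2 up to a
   unit of the form 1 + M. *)
Lemma pole_ratio x y : on_curve E (Some (x, y)) -> ~ V x ->
  [/\ y != 0, M (x / y) & exists2 e, [/\ V e, ~ M e & e != 0] & x = (y / x) ^+ 2 * e].
Proof.
move=> /on_curveE e0 nVx; have [V1 V2 V3 V4 V6] := Va.
have Mi := not_vr_inv nVx; have Vi := vmax_sub HV Mi.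
have x0 : x != 0 by apply/eqP => x0; apply: nVx; rewrite x0; exact: (vr0 HV).
pose w := y / x.
have ew : w ^+ 2 + a1 E * w + a3 E * w * x^-1 =
    x + a2 E + a4 E * x^-1 + a6 E * x^-1 ^+ 2.
  have -> : w ^+ 2 = y ^+ 2 / x ^+ 2 by rewrite /w; field.
  by rewrite e0 /w; field.
have nw : ~ V w.
  move=> Vw; apply: nVx.
  have -> : x = w ^+ 2 + a1 E * w + a3 E * w * x^-1 - (a2 E + a4 E * x^-1 + a6 E * x^-1 ^+ 2).
    by rewrite ew; ring.
  by vr_solve HV.
have w0 : w != 0 by apply/eqP => w0; apply: nw; rewrite w0; exact: (vr0 HV).
have y0 : y != 0 by apply: contra_neq w0 => y0; rewrite /w y0 mul0r.
have Mw := not_vr_inv nw; have Vw := vmax_sub HV Mw; split=> //.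
  by rewrite -invf_div; exact: Mw.
pose e1 := 1 + (a1 E * w^-1 + a3 E * w^-1 * x^-1).
pose e2 := 1 + (a2 E * x^-1 + a4 E * x^-1 ^+ 2 + a6 E * x^-1 ^+ 3).
have n1 : ~ M e1.
  by rewrite /e1; apply: (nvmaxDl HV); [vm_solve HV | exact: (vmax1 HV)].
have n2 : ~ M e2.
  by rewrite /e2; apply: (nvmaxDl HV); [vm_solve HV | exact: (vmax1 HV)].
have U1 : V e1 by rewrite /e1; vr_solve HV.
have U2 : V e2 by rewrite /e2; vr_solve HV.
have [e10 _] := vunit U1 n1; have [e20 Vi2] := vunit U2 n2.
exists (e1 / e2); first split.
- exact: (vrM HV).
- move=> Mm; apply: n1; rewrite -(divfK e20 e1); exact: (vmaxMr HV).
- by rewrite mulf_neq0 // invr_eq0.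
have eq : w ^+ 2 * e1 = x * e2.
  have -> : x * e2 = x + a2 E + a4 E * x^-1 + a6 E * x^-1 ^+ 2 by rewrite /e2; field.
  by rewrite -ew /e1; field; apply/andP.
by rewrite -/w mulrA eq mulfK.
Qed.

Lemma vK_pole_even x y : on_curve E (Some (x, y)) -> x != 0 -> v x < 0 ->
  exists d, v x = - (2 * d).
Proof.
move=> o x0 vx; have nV : ~ V x by rewrite loc_vK // => h; move: vx; rewrite ltNge h.
have [y0 _ [e [Ve ne e0] ->]] := pole_ratio o nV; exists (- v (y / x)).
have w0 : y / x != 0 by rewrite mulf_neq0 // invr_eq0.
rewrite vKM ?expf_neq0 // vKX //; have /(unit_vK pp e0) -> : V e /\ ~ M e by [].
by rewrite addr0; ring.
Qed.

Lemma E0_O : E0 E p None.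
Proof.
have o1 : nu p (1 : K) = 0%E.
  by apply/nu_eq0; split; [exact: (vr1 HV) | exact: (vmax1 HV)].
split=> //; exists (proj None); split.
- by exists 1; [exact: oner_neq0 | move=> i; rewrite mul1r].
- move=> i; apply/nu_ge0; rewrite /proj (tnth_nth 0).
  by case: i => [[|[|[|i]]] hi] //=; rewrite ?nth_nil; (exact: (vr0 HV) || exact: (vr1 HV)).
- by exists 1; rewrite /proj (tnth_nth 0).
- exists 2; rewrite weierstrass_partials /proj !(tnth_nth 0) /= -[RHS]o1; congr (nu p _).
  ring.
Qed.

(** On the curve [psi2] and [phi2] are quadratic forms in the two affine partial derivatives: [psi2]
    is the square of the y-derivative, and [phi2] is the square of the x-derivative modulo the other
    one. *)
Lemma singE x y : on_curve E (Some (x, y)) -> V x ->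
  V y /\ (sing V k x <-> M (3 * x ^+ 2 + 2 * a2 E * x + a4 E - a1 E * y) /\
    M (2 * y + a1 E * x + a3 E)).
Proof.
move=> /on_curveE e0 Vx; have [V1 V2 V3 V4 V6] := Va.
have Vy : V y.
  apply: (@vr_quad _ _ HV (- (a1 E * x + a3 E))
    (x ^+ 3 + a2 E * x ^+ 2 + a4 E * x + a6 E)); [by vr_solve HV..|].
  by rewrite e0; ring.
split=> //; set fx := 3 * _ + _ + _ - _; set fy := 2 * y + _ + _.
have ep : psi2 k x = fy ^+ 2 by rewrite /psi2 /fy /=; ring: e0.
have ef : phi2 k x = fx ^+ 2 + a1 E * fx * fy - (a2 E + 2 * x) * fy ^+ 2.
  by rewrite /phi2 /fx /fy /=; ring: e0.
have Vfx : V fx by rewrite /fx; vr_solve HV.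
have Vfy : V fy by rewrite /fy; vr_solve HV.
rewrite /sing ep ef; split=> [[_ m1 m2]|[m1 m2]].
  have my : M fy by apply: (vmaxX_inv HV Vfy m1).
  split=> //; apply: (@vmaxX_inv _ _ HV _ 2) => //.
  have -> : fx ^+ 2 = fx ^+ 2 + a1 E * fx * fy - (a2 E + 2 * x) * fy ^+ 2
      - a1 E * fx * fy + (a2 E + 2 * x) * fy ^+ 2 by ring.
  apply: (vmaxD HV); last by apply: (vmaxMl HV) => //; vr_solve HV.
  by apply: (vmaxB HV) => //; apply: (vmaxMl HV) => //; vr_solve HV.
split=> //; first by vm_solve HV.
apply: (vmaxB HV); last by apply: (vmaxMl HV); [vr_solve HV | vm_solve HV].
apply: (vmaxD HV); first by vm_solve HV.
by apply: (vmaxMl HV) => //; vr_solve HV.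
Qed.

Lemma E0P x y : on_curve E (Some (x, y)) -> E0 E p (Some (x, y)) <-> ~ sing V k x.
Proof.
move=> o; have [V1 V2 V3 V4 V6] := Va; split.
  move=> [_ [u [[c c0 eu] Vu _ [i]]]] /nu_eq0[_ nM] sx; apply: nM.
  have Vx : V x by case: sx.
  have [Vy h] := singE o Vx; have [+ +] := h.1 sx.
  set fx := 3 * _ + _ + _ - _; set fy := 2 * y + _ + _ => mx my.
  have Vc : V c.
    have /nu_ge0 := Vu 2; rewrite eu /proj (tnth_nth 0) /= mulr1; exact.
  rewrite weierstrass_partials !eu /proj !(tnth_nth 0) /= !mulr1.
  apply: (vmaxD HV); first apply: (vmaxD HV).
  - apply: (vmaxMl HV); first exact: (vrn HV).
    have -> : a1 E * (c * y) * c - 3 * (c * x) ^+ 2 - 2 * a2 E * (c * x) * c - a4 E * c ^+ 2 =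
      - (c ^+ 2) * fx by rewrite /fx; ring.
    by apply: (vmaxMl HV) => //; vr_solve HV.
  - apply: (vmaxMl HV); first exact: (vrn HV).
    have -> : 2 * (c * y) * c + a1 E * (c * x) * c + a3 E * c ^+ 2 = c ^+ 2 * fy.
      by rewrite /fy; ring.
    by apply: (vmaxMl HV) => //; vr_solve HV.
  - apply: (vmaxMl HV); first exact: (vrn HV).
    have e0 := on_curveE o.
    (* Euler's relation expresses the derivative in Z through the other two. *)
    have -> : (c * y) ^+ 2 + a1 E * (c * x) * (c * y) + 2 * a3 E * (c * y) * c
        - a2 E * (c * x) ^+ 2 - 2 * a4 E * (c * x) * c - 3 * a6 E * c ^+ 2 =
      c ^+ 2 * (x * fx - y * fy).
      by rewrite /fx /fy; ring: e0.
    apply: (vmaxMl HV); first by vr_solve HV.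
    by apply: (vmaxB HV); apply: (vmaxMl HV).
move=> ns; split=> //; have [Vx|nVx] := pselect (V x).
  have [Vy h] := singE o Vx.
  exists (proj (Some (x, y))); split.
  - by exists 1; [exact: oner_neq0 | move=> i; rewrite mul1r].
  - move=> i; apply/nu_ge0; rewrite /proj (tnth_nth 0).
    by case: i => [[|[|[|i]]] hi] //=; exact: (vr1 HV).
  - exists 2; apply/nu_eq0; rewrite /proj (tnth_nth 0) /=.
    by split; [exact: (vr1 HV) | exact: (vmax1 HV)].
  have [nx|Mx] := pselect (~ M (3 * x ^+ 2 + 2 * a2 E * x + a4 E - a1 E * y)).
    exists 0; rewrite weierstrass_partials /proj !(tnth_nth 0) /=.
    set f := (X in nu p X); have -> : f = - (3 * x ^+ 2 + 2 * a2 E * x + a4 E - a1 E * y).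
      by rewrite /f; ring.
    apply/nu_eq0; split; [vr_solve HV | by move=> /(vmaxN HV); rewrite opprK].
  exists 1; rewrite weierstrass_partials /proj !(tnth_nth 0) /=.
  set f := (X in nu p X); have -> : f = 2 * y + a1 E * x + a3 E by rewrite /f; ring.
  apply/nu_eq0; split; first by vr_solve HV.
  by move=> My; apply: ns; apply/h; split=> //; apply: contrapT.
have [y0 Mxy _] := pole_ratio o nVx; have Mi := not_vr_inv nVx.
have x0 : x != 0 by apply/eqP => x0; apply: nVx; rewrite x0; exact: (vr0 HV).
have Mz : M y^-1.
  have -> : y^-1 = (x / y) * x^-1 by field; apply/andP.
  by apply: (vmaxMl HV) => //; apply: (vmax_sub HV).
have Vxy := vmax_sub HV Mxy; have Vz := vmax_sub HV Mz.
(* A non-integral point has primitive coordinates (x / y : 1 : 1 / y) and reduces to O, where the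
   derivative in Z equals 1. *)
exists (fun i => y^-1 * proj (Some (x, y)) i); split.
- by exists y^-1; rewrite ?invr_eq0.
- move=> i; apply/nu_ge0; rewrite /proj (tnth_nth 0).
  case: i => [[|[|[|i]]] hi] //=; rewrite ?mulr1 ?mulVf //; first by rewrite mulrC.
  exact: (vr1 HV).
- exists 1; apply/nu_eq0; rewrite /proj (tnth_nth 0) /= mulVf //.
  by split; [exact: (vr1 HV) | exact: (vmax1 HV)].
exists 2; rewrite weierstrass_partials /proj !(tnth_nth 0) /=.
rewrite [y^-1 * x]mulrC mulVf // mulr1.
set f := (X in nu p X).
have -> : f = 1 + (a1 E * (x / y) + 2 * a3 E * y^-1 - a2 E * (x / y) ^+ 2
     - 2 * a4 E * (x / y) * y^-1 - 3 * a6 E * y^-1 ^+ 2) by rewrite /f; ring.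
apply/nu_eq0; split; first by vr_solve HV.
by apply: (nvmaxDl HV); [vm_solve HV | exact: (vmax1 HV)].
Qed.

End NonsingularPoints.

(** * Elliptic nets of rank 2 *)

Section SomosLine.
Variables (K : fieldType) (u X : int -> K) (xe A2 W3 : K).
Hypotheses (somos : forall n, u (n + 2) * u (n - 2) = A2 * (u (n + 1) * u (n - 1)) - W3 * u n ^+ 2)
  (Xe : forall n, X n != xe)
  (X_add : forall n, A2 * (xe - X n) - W3 =
     (X n - xe) ^+ 2 * (xe - X (n + 1)) * (xe - X (n - 1))).

Let T n := u (n + 1) * u (n - 1) = u n ^+ 2 * (xe - X n).

(** Here u is a row of the net and X its x-coordinates; xe, A2 and W3 are x, psi_2^2 and psi_3 for
    the direction of the row. The Somos recursion at n + 1 contains u (n - 1), which [T n] expresses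
    through later terms, and [X_add], the addition law along the row, matches what remains.
    Non-vanishing is carried along because each step divides by earlier terms. *)
Lemma somos_step n : u n != 0 -> u (n + 1) != 0 -> T n -> T (n + 1) ->
  u (n + 2) != 0 /\ T (n + 2).
Proof.
have ex m : xe - X m != 0 by rewrite subr_eq0 eq_sym.
move=> un un1 Tn Tn1; rewrite /T in Tn Tn1.
have e2 : n + 1 + 1 = n + 2 by ring.
have e0 : n + 1 - 1 = n by rewrite addrK.
rewrite e2 e0 in Tn1.
have un2 : u (n + 2) != 0.
  apply/eqP => z; move/eqP: Tn1; rewrite z mul0r eq_sym mulf_eq0 expf_eq0 /=.
  by rewrite (negPf un1) (negPf (ex _)).
split=> //; rewrite /T.
have e3 : n + 2 + 1 = (n + 1) + 2 by ring.
have e1 : n + 2 - 1 = n + 1 by ring.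
have em : n - 1 = (n + 1) - 2 by ring.
have S := somos (n + 1); rewrite e2 e0 -e3 -em in S.
have XA := X_add (n + 1); rewrite e2 e0 in XA.
rewrite e1; rewrite Tn1 in S.
have S' : u (n + 2 + 1) * u (n - 1) = u (n + 1) ^+ 2 *
    ((X (n + 1) - xe) ^+ 2 * (xe - X (n + 2)) * (xe - X n)).
  by rewrite S -XA; ring.
have nz : u n ^+ 2 * (xe - X n) != 0 by rewrite mulf_neq0 // expf_neq0.
apply: (mulfI nz); rewrite -{1}Tn.
have -> : u (n + 1) * u (n - 1) * (u (n + 2 + 1) * u (n + 1)) =
  (u (n + 2 + 1) * u (n - 1)) * u (n + 1) ^+ 2 by ring.
rewrite S'.
have -> : u n ^+ 2 * (xe - X n) * (u (n + 2) ^+ 2 * (xe - X (n + 2))) =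
  (u (n + 2) * u n) ^+ 2 * (xe - X (n + 2)) * (xe - X n) by ring.
by rewrite Tn1; ring.
Qed.

Lemma somos_up : u 0 != 0 -> u 1 != 0 -> T 0 -> T 1 -> forall n : nat,
  [/\ u n%:Z != 0, u (n%:Z + 1) != 0, T n%:Z & T (n%:Z + 1)].
Proof.
move=> u0 u1 T0 T1; elim=> [|n [h1 h2 h3 h4]]; first by rewrite add0r.
have [h5 h6] := somos_step h1 h2 h3 h4.
have e : n.+1%:Z = n%:Z + 1 by rewrite -addn1 PoszD.
by rewrite e -addrA; split.
Qed.

End SomosLine.

Lemma somos_line (K : fieldType) (u X : int -> K) (xe A2 W3 : K) :
  (forall n, u (n + 2) * u (n - 2) = A2 * (u (n + 1) * u (n - 1)) - W3 * u n ^+ 2) ->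
  (forall n, X n != xe) ->
  (forall n, A2 * (xe - X n) - W3 =
     (X n - xe) ^+ 2 * (xe - X (n + 1)) * (xe - X (n - 1))) ->
  forall n0, u n0 != 0 -> u (n0 + 1) != 0 ->
  u (n0 + 1) * u (n0 - 1) = u n0 ^+ 2 * (xe - X n0) ->
  u (n0 + 1 + 1) * u (n0 + 1 - 1) = u (n0 + 1) ^+ 2 * (xe - X (n0 + 1)) ->
  forall n, u n != 0 /\ u (n + 1) * u (n - 1) = u n ^+ 2 * (xe - X n).
Proof.
move=> hs hX hA n0 u0 u1 T0 T1 n.
move: (erefl (n - n0)); case: {-1}(n - n0) / intP => [|m|m] e.
- by have en : n = n0; [lia | rewrite en; split].
- have h0 : n = n0 + m.+1%:Z by lia.
  have S : forall i, u (n0 + (i + 2)) * u (n0 + (i - 2)) =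
      A2 * (u (n0 + (i + 1)) * u (n0 + (i - 1))) - W3 * u (n0 + i) ^+ 2.
    by move=> i; have := hs (n0 + i); rewrite -!addrA.
  have A : forall i, A2 * (xe - X (n0 + i)) - W3 =
      (X (n0 + i) - xe) ^+ 2 * (xe - X (n0 + (i + 1))) * (xe - X (n0 + (i - 1))).
    by move=> i; have := hA (n0 + i); rewrite -!addrA.
  have := somos_up S (fun i => hX (n0 + i)) A.
  rewrite !addr0 add0r => /(_ u0 u1 _ _ m.+1)[].
  + by rewrite sub0r T0.
  + by move: T1; rewrite -!addrA subrr addr0.
  + by move=> h1 _ h2 _; rewrite h0; move: h2; rewrite !addrA.
(* Backwards the row is reflected by i -> n0 + 1 - i, which exchanges the two initial indices. *)
- have h0 : n = n0 + 1 - m.+2%:Z by lia.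
  have r2 i : n0 + 1 - (i + 2) = n0 + 1 - i - 2 by ring.
  have r2' i : n0 + 1 - (i - 2) = n0 + 1 - i + 2 by ring.
  have r1 i : n0 + 1 - (i + 1) = n0 + 1 - i - 1 by ring.
  have r1' i : n0 + 1 - (i - 1) = n0 + 1 - i + 1 by ring.
  have S : forall i, u (n0 + 1 - (i + 2)) * u (n0 + 1 - (i - 2)) =
      A2 * (u (n0 + 1 - (i + 1)) * u (n0 + 1 - (i - 1))) - W3 * u (n0 + 1 - i) ^+ 2.
    by move=> i; rewrite r2 r2' r1 r1' mulrC hs [u _ * u _]mulrC.
  have A : forall i, A2 * (xe - X (n0 + 1 - i)) - W3 =
      (X (n0 + 1 - i) - xe) ^+ 2 * (xe - X (n0 + 1 - (i + 1))) * (xe - X (n0 + 1 - (i - 1))).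
    by move=> i; rewrite r1 r1' hA; ring.
  have e0 : n0 + 1 - 0 = n0 + 1 by rewrite subr0.
  have e1 : n0 + 1 - 1 = n0 by ring.
  have := somos_up S (fun i => hX (n0 + 1 - i)) A.
  rewrite e0 add0r sub0r opprK opprD addrA e1 => /(_ u1 u0 _ _ m.+2)[].
  + by rewrite mulrC -T1 e1.
  + by rewrite mulrC -T0.
  + by rewrite r1 r1' -h0 => h1 _ h2 _; rewrite mulrC.
Qed.

Section Net.
Variables (K : fieldType) (k : kummer K) (w x : int -> int -> K).
Hypothesis net : forall p1 p2 q1 q2 t1 t2 s1 s2,
  w (p1 + q1 + s1) (p2 + q2 + s2) * w (p1 - q1) (p2 - q2) * w (t1 + s1) (t2 + s2) * w t1 t2
  + w (q1 + t1 + s1) (q2 + t2 + s2) * w (q1 - t1) (q2 - t2) * w (p1 + s1) (p2 + s2) * w p1 p2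
  + w (t1 + p1 + s1) (t2 + p2 + s2) * w (t1 - p1) (t2 - p2) * w (q1 + s1) (q2 + s2) * w q1 q2 = 0.
Hypotheses (w00 : w 0 0 = 0) (w10 : w 1 0 = 1) (w01 : w 0 1 = 1) (w11 : w 1 1 = 1).

Definition nz (i j : int) : bool := (i != 0) || (j != 0).

Hypotheses (wf : kwf k)
  (x_kum : forall i j a b, nz i j -> nz a b -> nz (i + a) (j + b) -> nz (i - a) (j - b) ->
     kum k (x i j) (x a b) (x (i + a) (j + b)) (x (i - a) (j - b)))
  (x_even : forall i j, x (- i) (- j) = x i j)
  (x_inj : forall i j a b, nz i j -> nz a b -> x i j = x a b ->
     (i = a /\ j = b) \/ (i = - a /\ j = - b)).
Hypotheses (w20 : w 2 0 ^+ 2 = psi2 k (x 1 0)) (w02 : w 0 2 ^+ 2 = psi2 k (x 0 1))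
  (w20_02 : w 2 0 * w 0 2 = (x 1 0 - x 0 1) ^+ 2 * (x 1 (-1) - x 1 1))
  (w21 : w 2 1 = x 1 0 - x 1 1) (w12 : w 1 2 = x 0 1 - x 1 1).

Lemma net_odd i j : w (- i) (- j) = - w i j.
Proof.
have key a b : w a b * (w a b + w (- a) (- b)) = 0.
  have := net 1 0 0 0 a b 0 0; rewrite !(addr0, add0r, subr0, sub0r) w00 w10.
  by rewrite !(mulr0, mul0r, mul1r, mulr1, addr0) => e; rewrite mulrDr; rewrite -[RHS]e; ring.
move/eqP: (key i j); rewrite mulf_eq0 => /orP[/eqP h|].
  rewrite h oppr0; move/eqP: (key (- i) (- j)); rewrite !opprK h addr0.
  by rewrite mulf_eq0 orbb => /eqP.
by rewrite addrC addr_eq0 => /eqP.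
Qed.

Lemma net0 p1 p2 q1 q2 t1 t2 :
  w (p1 + q1) (p2 + q2) * w (p1 - q1) (p2 - q2) * w t1 t2 ^+ 2
  + w (q1 + t1) (q2 + t2) * w (q1 - t1) (q2 - t2) * w p1 p2 ^+ 2
  - w (p1 + t1) (p2 + t2) * w (p1 - t1) (p2 - t2) * w q1 q2 ^+ 2 = 0.
Proof.
have := net p1 p2 q1 q2 t1 t2 0 0; rewrite !addr0.
rewrite -[t1 - p1]opprB -[t2 - p2]opprB net_odd (addrC t1 p1) (addrC t2 p2) => e.
by rewrite -[RHS]e; ring.
Qed.

Lemma wm10 : w (-1) 0 = -1.
Proof. by have := net_odd 1 0; rewrite oppr0 w10. Qed.

Lemma w0m1 : w 0 (-1) = -1.
Proof. by have := net_odd 0 1; rewrite oppr0 w01. Qed.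

Lemma w1m1 : w 1 (-1) = x 0 1 - x 1 0.
Proof.
have e : w 1 1 * w 1 (-1) * w 1 1 ^+ 2 + w 1 2 * w (-1) 0 * w 1 0 ^+ 2
    - w 2 1 * w 0 (-1) * w 0 1 ^+ 2 = 0 := net0 1 0 0 1 1 1.
rewrite w11 w10 w01 wm10 w0m1 w21 w12 in e.
by apply/eqP; rewrite -subr_eq0 -e; apply/eqP; ring.
Qed.

Lemma w2m1 : w 2 (-1) = w 2 0 * w 0 2 - w 2 1 * (x 0 1 - x 1 0) ^+ 2.
Proof.
have := net 1 0 0 (-1) 0 1 1 0.
rewrite !(addr0, add0r, subr0, sub0r, opprK) -[1 + 1]/(2 : int) -[-1 - 1]/(- 2 : int).
rewrite subrr w10 w01 w11 !mulr1.
have -> : w 0 (- 2) = - w 0 2 by have := net_odd 0 2; rewrite oppr0.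
have -> : w 0 (-1) = - 1 by have := net_odd 0 1; rewrite oppr0 w01.
have -> : w (-1) 1 = - w 1 (-1) by have := net_odd 1 (-1); rewrite opprK.
rewrite w1m1 mul1r => e; apply/eqP; rewrite -subr_eq0 -e; apply/eqP; ring.
Qed.

Lemma x_neq i j a b : nz i j -> nz a b -> nz (i - a) (j - b) -> nz (i + a) (j + b) ->
  x i j != x a b.
Proof.
move=> n1 n2 n3 n4; apply/eqP => /(x_inj n1 n2)[[e1 e2]|[e1 e2]].
  by move: n3; rewrite e1 e2 !subrr.
by move: n4; rewrite e1 e2 !addNr.
Qed.

(** If it vanished, x(S + T) and x(S - T) would coincide by [kum_psi2], against the injectivity of x
    up to sign. *)
Lemma psi2_neq0 : psi2 k (x 1 0) != 0.
Proof.
have kk : kum k (x 1 0) (x 0 1) (x 1 1) (x 1 (-1)).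
  by have := @x_kum 1 0 0 1; rewrite !(addr0, add0r, subr0, sub0r); apply.
apply/eqP => e; have := kum_psi2 wf kk; rewrite e mul0r => /eqP.
rewrite expf_eq0 /= mulf_eq0 expf_eq0 /= !subr_eq0.
by rewrite (negPf (@x_neq 1 0 0 1 _ _ _ _)) // (negPf (@x_neq 1 1 1 (-1) _ _ _ _)).
Qed.

(* The division polynomial psi_3 is forced by the initial values. *)
Lemma w30 : w 3 0 = x 1 0 * psi2 k (x 1 0) - phi2 k (x 1 0).
Proof.
have e : w 2 1 * w (-2) 1 * w 1 0 ^+ 2 + w 3 0 * w 1 0 * w 0 1 ^+ 2
    - w 1 1 * w (-1) 1 * w 2 0 ^+ 2 = 0 := net0 0 1 2 0 1 0.
have wm21 : w (-2) 1 = - w 2 (-1) := net_odd 2 (-1).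
have wm11 : w (-1) 1 = - w 1 (-1) := net_odd 1 (-1).
rewrite w11 w10 w01 w20 w21 wm21 wm11 w2m1 w20_02 w21 w1m1 in e.
have kk : kum k (x 0 1) (x 1 0) (x 1 1) (x 1 (-1)).
  apply: kumC; have := @x_kum 1 0 0 1.
  by rewrite !(addr0, add0r, subr0, sub0r); apply.
have := kum_sym (x 1 0) kk.
have -> : (x 0 1 - x 1 0) ^+ 2 * x 1 0 ^+ 2 - kU k (x 0 1) (x 1 0) * x 1 0
    + kV k (x 0 1) (x 1 0) = phi2 k (x 1 0) - psi2 k (x 1 0) * x 0 1.
  by rewrite /kU /kV /phi2 /psi2; ring.
move=> e'; apply/eqP; rewrite -subr_eq0.
have -> : w 3 0 - (x 1 0 * psi2 k (x 1 0) - phi2 k (x 1 0)) =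
  (w 3 0 - psi2 k (x 1 0) * (x 1 0 - x 0 1)) + (phi2 k (x 1 0) - psi2 k (x 1 0) * x 0 1).
  by ring.
by rewrite e' -[X in _ == X]e; apply/eqP; ring.
Qed.

Lemma dup_x : psi2 k (x 1 0) * x 2 0 = phi2 k (x 1 0).
Proof.
have kk : kum k (x 2 0) (x 1 0) (x 3 0) (x 1 0) := @x_kum 2 0 1 0 isT isT isT isT.
have := kum_sym (x 1 0) (kumC kk).
rewrite subrr mulr0 expr0n mul0r add0r => e.
apply/eqP; rewrite -subr_eq0 -[X in _ == X]oppr0 -e; apply/eqP.
by rewrite /kU /kV /phi2 /psi2; ring.
Qed.

Lemma somos1 i j : w (i + 2) j * w (i - 2) j =
  psi2 k (x 1 0) * (w (i + 1) j * w (i - 1) j) - w 3 0 * w i j ^+ 2.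
Proof.
have e : w (i + 2) (j + 0) * w (i - 2) (j - 0) * w 1 0 ^+ 2
    + w 3 0 * w 1 0 * w i j ^+ 2 - w (i + 1) (j + 0) * w (i - 1) (j - 0) * w 2 0 ^+ 2 = 0
  := net0 i j 2 0 1 0.
rewrite !addr0 ?subr0 w10 w20 in e.
by apply/eqP; rewrite -subr_eq0 -[X in _ == X]e; apply/eqP; ring.
Qed.

Lemma line1 j : j != 0 -> forall i0, w i0 j != 0 -> w (i0 + 1) j != 0 ->
  w (i0 + 1) j * w (i0 - 1) j = w i0 j ^+ 2 * (x 1 0 - x i0 j) ->
  w (i0 + 1 + 1) j * w (i0 + 1 - 1) j = w (i0 + 1) j ^+ 2 * (x 1 0 - x (i0 + 1) j) ->
  forall i, w i j != 0 /\ w (i + 1) j * w (i - 1) j = w i j ^+ 2 * (x 1 0 - x i j).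
Proof.
move=> j0; have nzj i : nz i j by rewrite /nz j0 orbT.
apply: (@somos_line _ (fun i => w i j) (fun i => x i j) _ (psi2 k (x 1 0)) (w 3 0)).
- by move=> i; exact: somos1.
- by move=> i; apply: x_neq; rewrite ?subr0 ?addr0.
- move=> i; have := @x_kum i j 1 0; rewrite addr0 ?subr0 => /(_ (nzj _) isT (nzj _) (nzj _)).
  move=> /(kum_sym (x 1 0)) <-; rewrite w30 /kU /kV /phi2 /psi2; ring.
Qed.

(** Lets a vector settled on a horizontal line serve as initial value on a vertical one, and
    conversely. *)
Lemma line12 i j :
  w (i + 1) j * w (i - 1) j = w i j ^+ 2 * (x 1 0 - x i j) <->
  w i (j + 1) * w i (j - 1) = w i j ^+ 2 * (x 0 1 - x i j).
Proof.
have e : w (i + 1) (j + 0) * w (i - 1) (j - 0) * w 0 1 ^+ 2 + w 1 1 * w 1 (-1) * w i j ^+ 2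
    - w (i + 0) (j + 1) * w (i - 0) (j - 1) * w 1 0 ^+ 2 = 0 := net0 i j 1 0 0 1.
rewrite !addr0 ?subr0 w10 w01 w11 w1m1 in e.
have e' : w (i + 1) j * w (i - 1) j - w i j ^+ 2 * (x 1 0 - x i j) =
    w i (j + 1) * w i (j - 1) - w i j ^+ 2 * (x 0 1 - x i j).
  by apply/eqP; rewrite -subr_eq0 -[X in _ == X]e; apply/eqP; ring.
by split=> h; apply/eqP; rewrite -subr_eq0; [rewrite -e' | rewrite e']; rewrite h subrr.
Qed.

End Net.

Section NetFormula.
Variables (K : fieldType) (k : kummer K) (w x : int -> int -> K).

(** Bundled so that [net_data_swap] can exchange the two coordinates and turn every result about
    rows into one about columns. *)
Record net_data : Prop := NetData {
  nd_net : forall p1 p2 q1 q2 t1 t2 s1 s2,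
    w (p1 + q1 + s1) (p2 + q2 + s2) * w (p1 - q1) (p2 - q2) * w (t1 + s1) (t2 + s2) * w t1 t2
    + w (q1 + t1 + s1) (q2 + t2 + s2) * w (q1 - t1) (q2 - t2) * w (p1 + s1) (p2 + s2) * w p1 p2
    + w (t1 + p1 + s1) (t2 + p2 + s2) * w (t1 - p1) (t2 - p2) * w (q1 + s1) (q2 + s2) * w q1 q2
    = 0;
  nd_00 : w 0 0 = 0; nd_10 : w 1 0 = 1; nd_01 : w 0 1 = 1; nd_11 : w 1 1 = 1;
  nd_wf : kwf k;
  nd_kum : forall i j a b, nz i j -> nz a b -> nz (i + a) (j + b) -> nz (i - a) (j - b) ->
     kum k (x i j) (x a b) (x (i + a) (j + b)) (x (i - a) (j - b));
  nd_even : forall i j, x (- i) (- j) = x i j;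
  nd_inj : forall i j a b, nz i j -> nz a b -> x i j = x a b ->
     (i = a /\ j = b) \/ (i = - a /\ j = - b);
  nd_20 : w 2 0 ^+ 2 = psi2 k (x 1 0); nd_02 : w 0 2 ^+ 2 = psi2 k (x 0 1);
  nd_20_02 : w 2 0 * w 0 2 = (x 1 0 - x 0 1) ^+ 2 * (x 1 (-1) - x 1 1);
  nd_21 : w 2 1 = x 1 0 - x 1 1; nd_12 : w 1 2 = x 0 1 - x 1 1
}.

End NetFormula.

Lemma net_data_swap (K : fieldType) (k : kummer K) (w x : int -> int -> K) :
  net_data k w x -> net_data k (fun i j => w j i) (fun i j => x j i).
Proof.
have nzC i j : nz i j = nz j i by rewrite /nz orbC.
case=> h1 h2 h3 h4 h5 h6 h7 h8 h9 h10 h11 h12 h13 h14; split=> //.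
- by move=> i j a b n1 n2 n3 n4; apply: h7; rewrite nzC.
- move=> i j a b n1 n2 e; rewrite nzC in n1; rewrite nzC in n2.
  by case: (h9 _ _ _ _ n1 n2 e) => -[]; [left | right].
- have -> : x (-1) 1 = x 1 (-1) := h8 1 (-1).
  by rewrite mulrC h12 -sqrrN opprB.
Qed.

Section NetNonzero.
Variables (K : fieldType) (k : kummer K) (w x : int -> int -> K).
Hypothesis D : net_data k w x.

Let G i j := w i j != 0 /\ w (i + 1) j * w (i - 1) j = w i j ^+ 2 * (x 1 0 - x i j).

Let horizontal j i0 : j != 0 -> G i0 j -> G (i0 + 1) j -> forall i, G i j.
Proof.
case: D => h1 h2 h3 h4 h5 h6 h7 h8 h9 h10 h11 h12 h13 h14 j0 [g1 g2] [g3 g4].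
exact: (@line1 _ k w x h1 h2 h3 h4 h5 h7 h9 h10 h12 h13 h14 _ j0 i0 g1 g3 g2 g4).
Qed.

Let vertical i j0 : i != 0 -> G i j0 -> G i (j0 + 1) -> forall j, G i j.
Proof.
have L a b := iffLR (@line12 _ w x (nd_net D) (nd_00 D) (nd_10 D) (nd_01 D) (nd_11 D)
  (nd_21 D) (nd_12 D) a b).
have R a b := iffRL (@line12 _ w x (nd_net D) (nd_00 D) (nd_10 D) (nd_01 D) (nd_11 D)
  (nd_21 D) (nd_12 D) a b).
case: (net_data_swap D) => h1 h2 h3 h4 h5 h6 h7 h8 h9 h10 h11 h12 h13 h14.
move=> i0 [g1 /L g2] [g3 /L g4] j.
have [] : w i j != 0 /\ w i (j + 1) * w i (j - 1) = w i j ^+ 2 * (x 0 1 - x i j).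
  exact: (@line1 _ k (fun a b => w b a) (fun a b => x b a) h1 h2 h3 h4 h5 h7 h9 h10
    h12 h13 h14 i i0 j0 g1 g3 g2 g4 j).
by move=> g5 /R g6.
Qed.

(* The lines j = 1, i = 1, i = 2 determine all horizontal lines j <> 0, which in
   turn determine the line j = 0. *)
Lemma net_line i j : nz i j -> G i j.
Proof.
have G01 : G 0 1.
  split; rewrite ?(nd_01 D) ?oner_eq0 //.
  have -> : w (0 + 1) 1 = 1 := nd_11 D.
  have -> : w (0 - 1) 1 = - w 1 (-1).
    by have := net_odd (nd_net D) (nd_00 D) (nd_10 D) 1 (-1).
  rewrite (@w1m1 _ w x (nd_net D) (nd_00 D) (nd_10 D) (nd_01 D) (nd_11 D) (nd_21 D) (nd_12 D)).
  by ring.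
have G11 : G 1 1.
  split; rewrite ?(nd_11 D) ?oner_eq0 //.
  have -> : w (1 + 1) 1 = x 1 0 - x 1 1 := nd_21 D.
  have -> : w (1 - 1) 1 = 1 := nd_01 D.
  by ring.
have G_1 := horizontal (isT : (1 : int) != 0) G01 G11.
have G10 : G 1 0.
  split; rewrite ?(nd_10 D) ?oner_eq0 //.
  have -> : w (1 - 1) 0 = 0 := nd_00 D.
  by ring.
have G1_ := vertical (isT : (1 : int) != 0) G10 G11.
have w20 : w 2 0 != 0.
  have := @psi2_neq0 _ k x (nd_wf D) (nd_kum D) (nd_inj D).
  by rewrite -(nd_20 D) expf_eq0.
have G20 : G 2 0.
  split=> //.
  have -> : w (2 - 1) 0 = 1 := nd_10 D.
  have -> : w (2 + 1) 0 = w 3 0 by [].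
  case: D => h1 h2 h3 h4 h5 h6 h7 h8 h9 h10 h11 h12 h13 h14.
  rewrite (@w30 _ k w x h1 h2 h3 h4 h5 h7 h10 h12 h13 h14) h10 mulr1 -(dup_x h7).
  by ring.
have G2_ := vertical (isT : (2 : int) != 0) G20 (G_1 2).
have Gj a b : b != 0 -> G a b.
  by move=> b0; apply: (horizontal b0 (G1_ b)); exact: G2_.
case/orP=> [i0|j0]; last exact: Gj.
by apply: (vertical i0 (Gj i 1 isT)); exact: Gj.
Qed.

Lemma net_neq0 i j : nz i j -> w i j != 0.
Proof. by case/net_line. Qed.

(** Any two vectors are compared through the third vector (1, 0): the net relation for the three
    expresses the product by the two instances of [net_line]. *)
Lemma net_x p1 p2 q1 q2 : nz p1 p2 -> nz q1 q2 ->
  w (p1 + q1) (p2 + q2) * w (p1 - q1) (p2 - q2) =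
  w p1 p2 ^+ 2 * w q1 q2 ^+ 2 * (x q1 q2 - x p1 p2).
Proof.
move=> /net_line[_ hp] /net_line[_ hq].
have := net0 (nd_net D) (nd_00 D) (nd_10 D) p1 p2 q1 q2 1 0.
rewrite !addr0 ?subr0 (nd_10 D) hp hq => e.
by apply/eqP; rewrite -subr_eq0 -[X in _ == X]e; apply/eqP; ring.
Qed.

End NetNonzero.

(** * Coordinates in the lattice Z + Z omega *)

Section QuadraticLattice.
Variables (K : fieldExtType rat) (omega : K).
Hypothesis omega_quadratic : imaginary_quadratic_integer omega.
Local Notation Zw := (Zomega omega).
Local Notation lat i j := (i%:~R + j%:~R * omega).

Lemma lat_eq0 (i j : int) : (lat i j == 0) = (i == 0) && (j == 0).
Proof.
have [t [n [e tn]]] := omega_quadratic.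
apply/eqP/andP=> [h|[/eqP -> /eqP ->]]; last by rewrite mul0r addr0.
have : ((i ^+ 2 + t * (i * j) + n * j ^+ 2)%:~R : K) = 0.
  have ei : i%:~R = - (j%:~R * omega) by apply/eqP; rewrite -addr_eq0 h.
  rewrite !(intrD, intrM, rmorphXn) /= ei.
  by rewrite -[RHS](mulr0 (j%:~R ^+ 2)) -[in RHS]e; ring.
move/eqP; rewrite intK_eq0 => /eqP h'.
have h4 : (2 * i + t * j) ^+ 2 + (4 * n - t ^+ 2) * j ^+ 2 = 0.
  by rewrite -[RHS](mulr0 4) -h'; ring.
have j0 : j = 0.
  apply/eqP; apply/negPn/negP => j0; have := sqr_ge0 (2 * i + t * j).
  have : 0 < j ^+ 2 by rewrite exprn_even_gt0.
  by nia.
by split; apply/eqP => //; move: h; rewrite j0 mul0r addr0 => /eqP; rewrite intK_eq0 => /eqP.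
Qed.

Lemma lat_nz i j : (lat i j != 0) = nz i j.
Proof. by rewrite lat_eq0 negb_and. Qed.

Lemma latZ i j : Zw (lat i j). Proof. by exists i, j. Qed.

Lemma latD i j a b : lat i j + lat a b = lat (i + a) (j + b).
Proof. by rewrite !intrD; ring. Qed.

Lemma latN i j : - lat i j = lat (- i) (- j).
Proof. by rewrite !rmorphN /=; ring. Qed.

Lemma latB i j a b : lat i j - lat a b = lat (i - a) (j - b).
Proof. by rewrite latN latD. Qed.

Lemma Zcoord_lat i j : Zcoord omega (lat i j) = (i, j).
Proof.
apply: xget_unique => // -[a b] /= e.
have : lat (i - a) (j - b) == 0 by rewrite -latB e subrr.
by rewrite lat_eq0 !subr_eq0 => /andP[/eqP -> /eqP ->].
Qed.

End QuadraticLattice.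

(** * The net attached to P and [omega]P *)

Section CMNet.
Variables (K : fieldExtType rat) (iota : {rmorphism K -> algC}).
Variables (E : weierstrass K) (omega : K) (m : K -> wpoint algC -> wpoint algC).
Variables (P : wpoint K) (Psi : 'rV[int]_2 -> K).
Hypotheses (omega_quadratic : imaginary_quadratic_integer omega)
  (E_cm : complex_multiplication iota E omega m)
  (P_on : on_curve E P) (P_nontorsion : nontorsion E P)
  (Psi_net : net_polynomials E (cm_pair iota E omega m P) Psi).
Local Notation Zw := (Zomega omega).
Local Notation xP := (xP iota E m P).
Local Notation yP := (yP iota E m P).
Local Notation psi := (psi omega Psi).
Local Notation phi := (phi iota E omega m P Psi).
Local Notation lat i j := (i%:~R + j%:~R * omega).

Let lat_eq0 := lat_eq0 omega_quadratic.
Let lat_nz := lat_nz omega_quadratic.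
Let latZ := latZ omega.
Let Zcoord_lat := Zcoord_lat omega_quadratic.

Let vec (i j : int) : 'rV[int]_2 := \row_k tnth [tuple i; j] k.

Let Zvec_lat i j : Zvec omega (lat i j) = vec i j.
Proof. by rewrite /Zvec Zcoord_lat. Qed.

Let vecP i j (v : 'rV[int]_2) : v 0 0 = i -> v 0 1 = j -> v = vec i j.
Proof.
move=> <- <-; apply/rowP => k; rewrite mxE.
by case: k => -[|[|//]] h; rewrite (tnth_nth 0) /=; congr (v 0 _); apply: val_inj.
Qed.

Let vec0 i j : vec i j 0 0 = i. Proof. by rewrite mxE. Qed.
Let vec1 i j : vec i j 0 1 = j. Proof. by rewrite mxE. Qed.

Let vecD i j a b : vec i j + vec a b = vec (i + a) (j + b).
Proof. by apply: vecP; rewrite mxE ?vec0 ?vec1. Qed.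

Let vecN i j : - vec i j = vec (- i) (- j).
Proof. by apply: vecP; rewrite mxE ?vec0 ?vec1. Qed.

Let e0 : unit_vec 0 = vec 1 0. Proof. by apply: vecP; rewrite mxE. Qed.
Let e1 : unit_vec 1 = vec 0 1. Proof. by apply: vecP; rewrite mxE. Qed.

Let w i j := Psi (vec i j).
Let x i j := xP (lat i j).

Let xE : x 1 0 = xP 1 /\ x 0 1 = xP omega.
Proof. by rewrite /x !mul0r addr0 add0r mul1r. Qed.

Lemma cm_net_data : net_data (kum_of E) w x.
Proof.
have Zo := Zw_omega omega; have Z1 := Zw1 omega; have o0 := omega_neq0 omega_quadratic.
have [x10 x01] := xE.
have pair0 : tnth (cm_pair iota E omega m P) 0 = (xP 1, yP 1).
  rewrite (tnth_nth (0, 0)) /= -{1}(pt1 E_cm P_on).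
  by rewrite (pt_affine omega_quadratic E_cm P_on P_nontorsion Z1 (oner_neq0 K)).
have pair1 : tnth (cm_pair iota E omega m P) 1 = (xP omega, yP omega).
  rewrite (tnth_nth (0, 0)) /= -/(pt iota E m P omega).
  by rewrite (pt_affine omega_quadratic E_cm P_on P_nontorsion Zo o0).
have on1 := pt_on omega_quadratic E_cm P_on P_nontorsion Z1 (oner_neq0 K).
have ono := pt_on omega_quadratic E_cm P_on P_nontorsion Zo o0.
have xne : xP 1 != xP omega.
  rewrite -x10 -x01; apply/eqP => /(xP_inj omega_quadratic E_cm P_on P_nontorsion
    (latZ 1 0) (latZ 0 1)).
  rewrite !lat_nz /nz => /(_ isT isT)[/eqP|/eqP].
    by rewrite -subr_eq0 latB lat_eq0.
  by rewrite -addr_eq0 latD lat_eq0.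
have xne' : xP omega - xP 1 != 0 by rewrite subr_eq0 eq_sym.
have xne'' : xP 1 - xP omega != 0 by rewrite subr_eq0.
set lam := (yP omega - yP 1) / (xP omega - xP 1).
have x11 : x 1 1 = lam ^+ 2 + a1 E * lam - a2 E - xP 1 - xP omega.
  rewrite /x mul1r xPE (ptD E_cm P_on Z1 Zo).
  by rewrite !(pt_affine omega_quadratic E_cm P_on P_nontorsion) ?oner_neq0 //= xne.
set lam' := (- yP omega - a1 E * xP omega - a3 E - yP 1) / (xP omega - xP 1).
have x1m1 : x 1 (-1) = lam' ^+ 2 + a1 E * lam' - a2 E - xP 1 - xP omega.
  rewrite /x mulN1r xPE (ptD E_cm P_on Z1 (ZwN Zo)) (ptN E_cm P_on Zo).
  by rewrite !(pt_affine omega_quadratic E_cm P_on P_nontorsion) ?oner_neq0 //= xne.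
have psiE (a b : K) : on_curve E (Some (a, b)) ->
    (2 * b + a1 E * a + a3 E) ^+ 2 = psi2 (kum_of E) a.
  move/on_curveE => e; rewrite /psi2 /=; apply/eqP; rewrite -subr_eq0; apply/eqP.
  transitivity (4 * (b ^+ 2 - (a ^+ 3 + a2 E * a ^+ 2 + a4 E * a + a6 E - a1 E * a * b
    - a3 E * b))); first by ring.
  by rewrite e subrr mulr0.
have w20 : w 2 0 = 2 * yP 1 + a1 E * xP 1 + a3 E.
  have := net_2e Psi_net 0; rewrite pair0 mulr2n e0 vecD /= => <-.
  by congr Psi; apply: vecP; rewrite ?vec0 ?vec1.
have w02 : w 0 2 = 2 * yP omega + a1 E * xP omega + a3 E.
  have := net_2e Psi_net 1; rewrite pair1 mulr2n e1 vecD /= => <-.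
  by congr Psi; apply: vecP; rewrite ?vec0 ?vec1.
split.
- move=> p1 p2 q1 q2 t1 t2 s1 s2.
  by have := net_elliptic Psi_net (vec p1 p2) (vec q1 q2) (vec t1 t2) (vec s1 s2);
    rewrite !vecN !vecD.
- by rewrite /w -(net_0 Psi_net); congr Psi; apply/esym/vecP; rewrite mxE.
- by rewrite /w -e0 (net_e Psi_net).
- by rewrite /w -e1 (net_e Psi_net).
- rewrite /w -(net_ee Psi_net (isT : (0 : 'I_2) != 1)) e0 e1 vecD.
  by congr Psi; apply: vecP; rewrite ?vec0 ?vec1.
- exact: kwf_of.
- move=> i j a b n1 n2 n3 n4.
  have := xP_kum omega_quadratic E_cm P_on P_nontorsion (latZ i j) (latZ a b).
  by rewrite latD latB !lat_nz => /(_ n1 n2 n3 n4).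
- by move=> i j; rewrite /x -latN (xPN E_cm P_on) //; exact: latZ.
- move=> i j a b n1 n2 /(xP_inj omega_quadratic E_cm P_on P_nontorsion (latZ _ _) (latZ _ _)).
  rewrite !lat_nz => /(_ n1 n2)[] /eqP.
    by rewrite -subr_eq0 latB lat_eq0 !subr_eq0 => /andP[/eqP -> /eqP ->]; left.
  by rewrite -addr_eq0 latD lat_eq0 !addr_eq0 => /andP[/eqP -> /eqP ->]; right.
- by rewrite w20 x10; apply: psiE.
- by rewrite w02 x01; apply: psiE.
- by rewrite w20 w02 x10 x01 x11 x1m1 /lam /lam'; field.
- have := net_2ee Psi_net (isT : (0 : 'I_2) != 1); rewrite pair0 pair1 -/lam => e.
  rewrite x10 x11; transitivity (Psi (unit_vec 0 *+ 2 + unit_vec 1)).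
    by rewrite [unit_vec _ *+ 2]mulr2n e0 e1 !vecD; congr Psi; apply: vecP; rewrite ?vec0 ?vec1.
  by rewrite e; ring.
- have := net_2ee Psi_net (isT : (1 : 'I_2) != 0); rewrite pair0 pair1 => e.
  rewrite x01 x11; transitivity (Psi (unit_vec 1 *+ 2 + unit_vec 0)).
    by rewrite [unit_vec _ *+ 2]mulr2n e0 e1 !vecD; congr Psi; apply: vecP; rewrite ?vec0 ?vec1.
  rewrite e; have -> : (yP 1 - yP omega) / (xP 1 - xP omega) = lam.
    by rewrite /lam; field; apply/andP.
  by ring.
Qed.

Lemma psi_lat i j : psi (lat i j) = w i j.
Proof. by rewrite /Defs.psi Zvec_lat. Qed.

Lemma psi_neq0 z : Zw z -> z != 0 -> psi z != 0.
Proof. by case=> i [j ->]; rewrite lat_nz psi_lat; apply: net_neq0; exact: cm_net_data. Qed.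

Lemma psiN z : Zw z -> psi (- z) = - psi z.
Proof.
case=> i [j ->]; rewrite latN !psi_lat.
exact: (net_odd (nd_net cm_net_data) (nd_00 cm_net_data) (nd_10 cm_net_data)).
Qed.

Lemma psi_initial : [/\ psi 1 = 1, psi omega = 1 & psi (1 + omega) = 1].
Proof.
split.
- by have := psi_lat 1 0; rewrite mul0r addr0 => ->; exact: nd_10 cm_net_data.
- by have := psi_lat 0 1; rewrite mul1r add0r => ->; exact: nd_01 cm_net_data.
- by have := psi_lat 1 1; rewrite mul1r => ->; exact: nd_11 cm_net_data.
Qed.

Lemma psi_prod z u : Zw z -> Zw u -> z != 0 -> u != 0 ->
  psi (z + u) * psi (z - u) = psi z ^+ 2 * psi u ^+ 2 * (xP u - xP z).
Proof.
case=> i [j ->] [a [b ->]]; rewrite latD latB !lat_nz !psi_lat.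
exact: (net_x cm_net_data).
Qed.

Lemma phiE z : Zw z -> z != 0 -> phi z = psi z ^+ 2 * xP z.
Proof.
case=> i [j ->] z0; have [p1 _ _] := psi_initial.
have := psi_prod (latZ i j) (Zw1 omega) z0 (oner_neq0 K); rewrite p1 expr1n mulr1.
rewrite /Defs.phi /Phi Zvec_lat e0 vecN !vecD.
have -> : lat i j + 1 = lat (i + 1) (j + 0) by rewrite -latD mul0r addr0.
have -> : lat i j - 1 = lat (i - 1) (j - 0) by rewrite -latB mul0r addr0.
rewrite !psi_lat => ->.
have -> : (tnth (cm_pair iota E omega m P) 0).1 = xP 1.
  by rewrite xPE (pt1 E_cm P_on) (tnth_nth (0, 0)).
by rewrite /w; ring.
Qed.

End CMNet.

(** * The parallelogram law *)

Lemma int_affine (u : int -> int) : (forall a, u (a + 1) + u (a - 1) = 2 * u a) ->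
  forall a, u a = u 0 + a * (u 1 - u 0).
Proof.
move=> h; suff H (n : nat) : (u n%:Z = u 0 + n%:Z * (u 1 - u 0) /\
    u (n%:Z + 1) = u 0 + (n%:Z + 1) * (u 1 - u 0)) /\
    (u (- n%:Z) = u 0 - n%:Z * (u 1 - u 0) /\
    u (1 - n%:Z) = u 0 + (1 - n%:Z) * (u 1 - u 0)).
  by move=> [n|n]; [have [[]] := H n | rewrite NegzE; have [_ [-> _]] := H n.+1; rewrite mulNr].
elim: n => [|n [[h1 h2] [h3 h4]]].
  rewrite oppr0 subr0 add0r; split; split; ring.
have e1 : n.+1%:Z = n%:Z + 1 by lia.
have e2 : n.+1%:Z + 1 = n%:Z + 1 + 1 by lia.
have e3 : - n.+1%:Z = - n%:Z - 1 by lia.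
have e4 : 1 - n.+1%:Z = - n%:Z by lia.
have p := h (n%:Z + 1); rewrite addrK in p.
have q := h (- n%:Z); rewrite [- _ + 1]addrC in q.
rewrite e2 e4 e3 e1; split; split=> //.
- have e : u (n%:Z + 1 + 1) = 2 * u (n%:Z + 1) - u n by rewrite -p addrK.
  by rewrite e h2 h1; ring.
- apply: (addrI (u (1 - n%:Z))); rewrite q h3 h4; ring.
- by rewrite h3; ring.
Qed.

(** Subtracting the quadratic form with the prescribed second differences leaves a function affine
    in each variable; its possible term in a b is killed by the relation along the diagonal. *)
Lemma int_biquadratic (f : int -> int -> int) (A B M : int) :
  (forall a b, f (a + 1) b + f (a - 1) b = 2 * f a b + 2 * A) ->
  (forall a b, f a (b + 1) + f a (b - 1) = 2 * f a b + 2 * B) ->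
  (forall a b, f (a + 1) (b + 1) + f (a - 1) (b - 1) = 2 * f a b + 2 * M) ->
  forall a b, f a b = f 0 0 + (a ^+ 2 - a * b) * A + (b ^+ 2 - a * b) * B + a * b * M
    + a * (f 1 0 - f 0 0 - A) + b * (f 0 1 - f 0 0 - B).
Proof.
move=> hA hB hM a b.
pose q a b : int := (a ^+ 2 - a * b) * A + (b ^+ 2 - a * b) * B + a * b * M.
pose D a b := f a b - q a b.
have DA a' b' : D (a' + 1) b' + D (a' - 1) b' = 2 * D a' b'.
  by rewrite /D -[LHS](addrK (2 * A)); have := hA a' b'; rewrite /q => e; lia.
have DB a' b' : D a' (b' + 1) + D a' (b' - 1) = 2 * D a' b'.
  by have := hB a' b'; rewrite /D /q => e; lia.
have DM a' b' : D (a' + 1) (b' + 1) + D (a' - 1) (b' - 1) = 2 * D a' b'.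
  by have := hM a' b'; rewrite /D /q => e; lia.
have lA a' b' := int_affine (fun c => DA c b') a'.
have lB a' b' := int_affine (fun c => DB a' c) b'.
have e : D a b = D 0 0 + a * (D 1 0 - D 0 0) + b * (D 0 1 - D 0 0).
  have s1 := DM 0 0; rewrite !add0r in s1.
  have := lA (-1) (-1); rewrite (lB 0) (lB 1 (-1)) => s2; rewrite s2 in s1.
  have s3 : D 1 1 = D 1 0 + D 0 1 - D 0 0
    by move: s1; move: (D 0 0) (D 0 1) (D 1 0) (D 1 1) => d0 d1 d2 d3; lia.
  by rewrite (lA a b) (lB 0 b) (lB 1 b) s3; ring.
by move: e; rewrite /D /q; lia.
Qed.

(** * The quadratic behaviour of g on cosets of the annihilator *)

Section Annihilator.
Variables (K : fieldExtType rat) (iota : {rmorphism K -> algC}).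
Variables (E : weierstrass K) (omega : K) (m : K -> wpoint algC -> wpoint algC).
Variables (p : set K) (P : wpoint K) (Psi : 'rV[int]_2 -> K).
Hypotheses (E_integral : integral_coefficients E) (E_elliptic : elliptic E)
  (omega_quadratic : imaginary_quadratic_integer omega)
  (E_cm : complex_multiplication iota E omega m)
  (pp : is_prime p)
  (P_on : on_curve E P) (P_nontorsion : nontorsion E P)
  (Psi_net : net_polynomials E (cm_pair iota E omega m P) Psi).
Local Notation Zw := (Zomega omega).
Local Notation x z := (xP iota E m P z).
Local Notation psi := (psi omega Psi).
Local Notation g := (g_nu iota E omega m P Psi p).
Local Notation Ann := (Ann iota E omega m P p).
Local Notation V := (loc p).
Local Notation v := (vK p).
Local Notation k := (kum_of E).
Local Notation S z := (sing V k (x z)).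
Let HV := loc_valring pp.
Let wf := kwf_of E.
Let ki := kint_of E_integral pp.
Let ZM := @ZwM K omega omega_quadratic.
Let psi0 := psi_neq0 omega_quadratic E_cm P_on P_nontorsion Psi_net.
Let psiNE := psiN omega_quadratic E_cm P_on P_nontorsion Psi_net.

Let h z : int := v (hgt V (x z)).

Let hE z : h z = if x z == 0 then 0 else Order.min 0 (v (x z)).
Proof.
rewrite /h; case: eqP => [->|/eqP x0]; first by rewrite hgtV ?vK1 //; exact: vr0 HV.
have [Vx|nVx] := pselect (V (x z)).
  by rewrite hgtV // vK1 //; rewrite min_l //; apply/loc_vK.
rewrite hgtNV // min_r //; apply: ltW; rewrite ltNge; apply/negP => h0; apply: nVx.
exact/loc_vK.
Qed.

Let hS z : S z -> h z = 0.
Proof. by case=> Vx _ _; rewrite /h hgtV // vK1. Qed.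

Let hN z : Zw z -> h (- z) = h z.
Proof. by move=> Zz; rewrite /h (xPN E_cm P_on). Qed.

(** As [phi z] is [psi z]^2 times x, the minimum of 2 v(psi) and 2 v(psi) + v(x) is 2 v(psi) +
    min(0, v(x)). *)
Let G z : int := if z == 0 then 0 else 2 * v (psi z) + h z.

Let gE z : Zw z -> g z = G z.
Proof.
move=> Zz; rewrite /g_nu /G; case: (eqVneq z 0) => [->|z0].
  by rewrite -/(pt iota E m P 0) (pt0 E_cm P_on).
rewrite -/(pt iota E m P z) (pt_affine omega_quadratic E_cm P_on P_nontorsion Zz z0) /=.
rewrite (phiE omega_quadratic E_cm P_on P_nontorsion Psi_net Zz z0) hE !nuE.
have p0 := psi0 Zz z0; rewrite (negPf p0) mulf_eq0 expf_eq0 /= (negPf p0) /=.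
case: eqP => [_|/eqP x0]; first by rewrite addr0 -EFinM min_l ?leey.
rewrite -EFinM -EFin_min /= vKM ?expf_neq0 // vKX //.
by rewrite addr_minr addr0 mulr_natl.
Qed.

(** O is non-singular, but the value of x at z = 0 is only a default; hence the separate clause. *)
Let N z := z = 0 \/ ~ S z.

Let AnnE z : Ann z <-> Zw z /\ N z.
Proof.
rewrite /Ann /=; split=> -[Zz H]; split=> //; case: (eqVneq z 0) => z0.
- by left.
- right; move: H; rewrite -/(pt iota E m P z).
  rewrite (pt_affine omega_quadratic E_cm P_on P_nontorsion Zz z0) => H.
  apply/(E0P E_integral pp _).1: H.
  exact: (pt_on omega_quadratic E_cm P_on P_nontorsion Zz z0).
- by rewrite z0 -/(pt iota E m P 0) (pt0 E_cm P_on); exact: E0_O.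
- case: H => [e|H]; first by rewrite e eqxx in z0.
  rewrite -/(pt iota E m P z) (pt_affine omega_quadratic E_cm P_on P_nontorsion Zz z0).
  apply/(E0P E_integral pp) => //.
  exact: (pt_on omega_quadratic E_cm P_on P_nontorsion Zz z0).
Qed.

Let NN z : Zw z -> N z -> N (- z).
Proof.
by move=> Zz [->|nz]; [left; rewrite oppr0 | right; rewrite (xPN E_cm P_on)].
Qed.

Let S_add z l : Zw z -> Zw l -> z != 0 -> S z -> N l -> S (z + l) /\ z + l != 0.
Proof.
move=> Zz Zl z0 Sz [->|nl]; first by rewrite addr0.
case: (eqVneq l 0) => [->|l0]; first by rewrite addr0.
have zl : z + l != 0.
  by apply/eqP => /eqP; rewrite addr_eq0 => /eqP e; apply: nl; rewrite -(xPN E_cm P_on) // -e.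
split=> //; have [e|zl'] := eqVneq (z - l) 0.
  by move/eqP: e; rewrite subr_eq0 => /eqP e; case: nl; rewrite -e.
exact: (sing_add HV wf ki Sz nl (xP_kum omega_quadratic E_cm P_on P_nontorsion Zz Zl z0 l0 zl zl')).1.
Qed.

Let ND z u : Zw z -> Zw u -> N z -> N u -> N (z + u).
Proof.
move=> Zz Zu Nz Nu; have [|zu] := eqVneq (z + u) 0; first by left.
case: Nz => [->|nz]; first by rewrite add0r.
right=> Szu; have [] := S_add (ZwD Zz Zu) (ZwN Zu) zu Szu (NN Zu Nu).
by rewrite addrK.
Qed.

Let Nomega z : Zw z -> N z -> N (omega * z).
Proof.
move=> Zz [->|nz]; first by left; rewrite mulr0.
case: (eqVneq z 0) => [->|z0]; first by left; rewrite mulr0.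
right; exact: (omega_stable E_integral E_elliptic omega_quadratic E_cm pp P_on P_nontorsion).
Qed.

Let Nint (n : int) z : Zw z -> N z -> N (n%:~R * z).
Proof.
move=> Zz Nz; have Nn (i : nat) : N (i%:R * z).
  elim: i => [|i IH]; first by left; rewrite mul0r.
  by rewrite mulrS mulrDl mul1r; apply: ND => //; apply: ZM => //; exact: (Zw_int omega i).
case: n => i; first exact: Nn.
rewrite NegzE rmorphN mulNr; apply: NN; last exact: Nn.
by apply: ZM => //; exact: (Zw_int omega i.+1).
Qed.

Let NM a z : Zw a -> Zw z -> N z -> N (a * z).
Proof.
case=> i [j ->] Zz Nz; rewrite mulrDl -mulrA.
have Zoz : Zw (omega * z) by apply: ZM => //; exact: Zw_omega.
have Zi n : Zw n%:~R := Zw_int omega n.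
apply: ND; [exact: ZM | exact: ZM | exact: Nint |].
by apply: Nint => //; exact: Nomega.
Qed.

Let GN z : Zw z -> G (- z) = G z.
Proof.
move=> Zz; rewrite /G oppr_eq0; case: (eqVneq z 0) => // z0.
by rewrite psiNE // vKN ?psi0 // hN.
Qed.

(** By [psi_prod] the net values cancel and there remains an equality between v(x l - x z) and the
    valuations of the contents. It is [sing_sub] when z is singular and [nonsing_add] otherwise. *)
Let G_generic z l : Zw z -> Zw l -> z != 0 -> l != 0 -> z + l != 0 -> z - l != 0 -> N l ->
  G (z + l) + G (z - l) = 2 * G z + 2 * G l.
Proof.
move=> Zz Zl z0 l0 zl zl' Nl; have nl : ~ S l by case: Nl => // e; rewrite e eqxx in l0.
have kk := xP_kum omega_quadratic E_cm P_on P_nontorsion Zz Zl z0 l0 zl zl'.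
have xx : x l - x z != 0.
  rewrite subr_eq0; apply/eqP => /(xP_inj omega_quadratic E_cm P_on P_nontorsion Zl Zz l0 z0).
  by case=> e; [move: zl'; rewrite e subrr eqxx | move: zl; rewrite e subrr eqxx].
have pz := psi0 Zz z0; have pl := psi0 Zl l0.
have ps := psi0 (ZwD Zz Zl) zl; have pd := psi0 (ZwB Zz Zl) zl'.
have := psi_prod omega_quadratic E_cm P_on P_nontorsion Psi_net Zz Zl z0 l0.
move/(congr1 v); rewrite !vKM ?mulf_neq0 ?expf_neq0 // ?vKX // => e.
suff : 2 * v (x l - x z) + h (z + l) + h (z - l) = 2 * h z + 2 * h l.
  rewrite /G (negPf z0) (negPf l0) (negPf zl) (negPf zl'); lia.
have g0 y : hgt V y != 0 := hgt_neq0 HV y.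
have g0i y : (hgt V y)^-1 != 0 by rewrite invr_eq0.
have xx' : x z - x l != 0 by rewrite -opprB oppr_eq0.
have vx : v (x z - x l) = v (x l - x z) by rewrite -opprB vKN.
have [Sz|nz] := pselect (S z).
  rewrite (hS (S_add Zz Zl z0 Sz Nl).1) (hS (S_add Zz (ZwN Zl) z0 Sz (NN Zl Nl)).1) hS //.
  have /(unit_vK pp (mulf_neq0 xx' (g0i _))) := sing_sub HV wf ki Sz nl.
  by rewrite (vKM pp xx' (g0i _)) (vKV pp (g0 _)) vx /h; lia.
have w0 : hgt V (x z) ^+ 2 * hgt V (x l) ^+ 2 != 0.
  exact: (mulf_neq0 (expf_neq0 2 (g0 _)) (expf_neq0 2 (g0 _))).
have w1 : (x z - x l) ^+ 2 * hgt V (x (z + l)) != 0.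
  exact: (mulf_neq0 (expf_neq0 2 xx') (g0 _)).
have w2 : (x z - x l) ^+ 2 * hgt V (x (z + l)) * hgt V (x (z - l)) != 0.
  exact: (mulf_neq0 w1 (g0 _)).
have w0i : (hgt V (x z) ^+ 2 * hgt V (x l) ^+ 2)^-1 != 0 by rewrite invr_eq0.
have /(unit_vK pp (mulf_neq0 w2 w0i)) := nonsing_add HV ki nz nl kk.
rewrite (vKM pp w2 w0i) (vKM pp w1 (g0 _)) (vKM pp (expf_neq0 2 xx') (g0 _)) (vKV pp w0).
rewrite (vKM pp (expf_neq0 2 (g0 _)) (expf_neq0 2 (g0 _))).
rewrite (vKX pp 2 xx') (vKX pp 2 (g0 (x z))) (vKX pp 2 (g0 (x l))) vx /h !mulr2n.
move: (v (x l - x z)) (v (hgt V (x (z + l)))) (v (hgt V (x (z - l)))) (v (hgt V (x z)))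
  (v (hgt V (x l))) => c1 c2 c3 c4 c5; clear; lia.
Qed.

(* The relations between l and omega l, which are independent. *)
Let G_double l : Zw l -> N l -> G (l + l) = 4 * G l.
Proof.
move=> Zl Nl; case: (eqVneq l 0) => [->|l0]; first by rewrite addr0 /G eqxx.
have Zu : Zw (omega * l) by apply: ZM => //; exact: Zw_omega.
have Nu := Nomega Zl Nl.
have E' i j : nz i j -> (i%:~R + j%:~R * omega) * l != 0.
  by move=> n; rewrite mulf_neq0 // (lat_nz omega_quadratic).
set u := omega * l in Zu Nu *.
have rel z u' i j i1 j1 i2 j2 i3 j3 : Zw z -> Zw u' -> N u' ->
    z = (i%:~R + j%:~R * omega) * l -> nz i j ->
    u' = (i1%:~R + j1%:~R * omega) * l -> nz i1 j1 ->
    z + u' = (i2%:~R + j2%:~R * omega) * l -> nz i2 j2 ->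
    z - u' = (i3%:~R + j3%:~R * omega) * l -> nz i3 j3 ->
    G (z + u') + G (z - u') = 2 * G z + 2 * G u'.
  move=> Zz Zu' Nu' e n e1 n1 e2 n2 e3 n3.
  by apply: G_generic => //; rewrite ?e2 ?e3 ?e ?e1; apply: E'.
(* Adding r1 and r2 and inserting r3 and r4 leaves 2 G (2 l) = 8 G l. The independence of l and u
   keeps every sum and difference non-zero. *)
have r1 : G (l + u + l) + G (l + u - l) = 2 * G (l + u) + 2 * G l.
  apply: (@rel _ _ 1 1 1 0 2 1 0 1) => //; rewrite /u; try ring.
  exact: ZwD.
have r2 : G (l - u + l) + G (l - u - l) = 2 * G (l - u) + 2 * G l.
  apply: (@rel _ _ 1 (-1) 1 0 2 (-1) 0 (-1)) => //; rewrite /u; try ring.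
  exact: ZwB.
have r3 : G (l + l + u) + G (l + l - u) = 2 * G (l + l) + 2 * G u.
  apply: (@rel _ _ 2 0 0 1 2 1 2 (-1)) => //; rewrite /u; try ring.
  exact: ZwD.
have r4 : G (l + u) + G (l - u) = 2 * G l + 2 * G u.
  apply: (@rel _ _ 1 0 0 1 1 1 1 (-1)) => //; rewrite /u; ring.
rewrite (addrAC l u l) (addrC l u) addrK in r1.
rewrite (addrAC l (- u) l) (addrC l (- u)) addrK GN // in r2.
rewrite (addrC u l) in r1; rewrite (addrC (- u) l) in r2.
move: r1 r2 r3 r4; move: (G (l + l + u)) (G (l + l - u)) (G (l + u)) (G (l - u)) (G (l + l)) (G l) (G u).
by move=> c1 c2 c3 c4 c5 c6 c7; clear; lia.
Qed.

Let G0 : G 0 = 0. Proof. by rewrite /G eqxx. Qed.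

Lemma G_parallelogram z l : Zw z -> Zw l -> N l -> G (z + l) + G (z - l) = 2 * G z + 2 * G l.
Proof.
move=> Zz Zl Nl; case: (eqVneq l 0) => [->|l0]; first by rewrite subr0 addr0 G0; lia.
case: (eqVneq z 0) => [->|z0]; first by rewrite add0r sub0r GN // G0; lia.
case: (eqVneq (z + l) 0) => [e|zl].
  move/eqP: (e); rewrite addr_eq0 => /eqP ->; rewrite addNr -opprD !GN ?G_double // ?G0; first lia.
  exact: ZwD.
case: (eqVneq (z - l) 0) => [e|zl'].
  by move/eqP: (e); rewrite subr_eq0 => /eqP ->; rewrite subrr G_double // G0; lia.
exact: G_generic.
Qed.

(** The directions r, r omega and r (1 + omega) all belong to the annihilator, so the parallelogram
    law gives the second differences of (a, b) -> G along both axes and the diagonal. *)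
Lemma G_lattice z r a b : Zw z -> Zw r -> N r ->
  G (z + (a%:~R + b%:~R * omega) * r) = G z +
    (a ^+ 2 - a * b) * G r + (b ^+ 2 - a * b) * G (r * omega) + a * b * G (r * (1 + omega))
    + a * (G (z + r) - G z - G r) + b * (G (z + r * omega) - G z - G (r * omega)).
Proof.
move=> Zz Zr Nr; have Zo := Zw_omega omega; have Z1 := Zw1 omega.
have Zro := ZM Zr Zo; have Z1o := ZwD Z1 Zo; have Zr1 := ZM Zr Z1o.
pose f (a b : int) := G (z + (a%:~R + b%:~R * omega) * r).
have Zf a' b' : Zw (z + (a'%:~R + b'%:~R * omega) * r).
  by apply: ZwD => //; apply: ZM => //; exact: latZ.
have f00 : f 0 0 = G z by rewrite /f; congr G; ring.
have f10 : f 1 0 = G (z + r) by rewrite /f; congr G; ring.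
have f01 : f 0 1 = G (z + r * omega) by rewrite /f; congr G; ring.
rewrite -/(f a b) -f00 -f10 -f01; apply: int_biquadratic => a' b'; rewrite /f.
- rewrite -G_parallelogram //; congr (G _ + G _); rewrite ?intrD ?rmorphN; ring.
- rewrite -G_parallelogram //; last by rewrite mulrC; apply: Nomega.
  congr (G _ + G _); rewrite ?intrD ?rmorphN; ring.
- rewrite -G_parallelogram //; last by rewrite mulrC; apply: NM.
  congr (G _ + G _); rewrite ?intrD ?rmorphN; ring.
Qed.

Let NP : E0 E p P <-> ~ S 1.
Proof.
have P1 := pt1 E_cm P_on; have Z1 := Zw1 omega.
rewrite -{1}P1 (pt_affine omega_quadratic E_cm P_on P_nontorsion Z1 (oner_neq0 K)).
exact: (E0P E_integral pp (pt_on omega_quadratic E_cm P_on P_nontorsion Z1 (oner_neq0 K))).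
Qed.

Let pole z := fine (maxe 0 (- nu p (x z)))%E.

Let poleE z : pole z = - h z.
Proof.
rewrite /pole hE nuE; case: eqP => _; first by rewrite max_l ?leNye // oppr0.
by rewrite -EFinN -EFin_max /= oppr_min oppr0.
Qed.

Let denominatorP z : Zw z -> z != 0 ->
  exists e, factors (denominator (x z)) e /\ 2 * e p = pole z.
Proof.
move=> Zz z0; have [|e [Fe he]] := @denominator_vK _ p (x z) pp.
  move=> x0 q pq; apply: (vK_pole_even E_integral pq) => //.
  exact: (pt_on omega_quadratic E_cm P_on P_nontorsion Zz z0).
exists e; split=> //; rewrite he poleE hE; case: eqP => // _.
by rewrite oppr_min oppr0.
Qed.

Let dp_net a b : 2 * dp p (net_ideal iota E omega m P a b) =
  (a ^+ 2 - a * b) * pole 1 + (b ^+ 2 - a * b) * pole omega + a * b * pole (1 + omega).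
Proof.
have ex : exists q : set K, is_prime q by exists p.
have Z1 := Zw1 omega; have Zo := Zw_omega omega; have Z1o := ZwD Z1 Zo.
have n1o : 1 + omega != 0.
  by have := lat_nz omega_quadratic 1 1; rewrite mul1r => ->.
have [e1 [F1 h1]] := denominatorP Z1 (oner_neq0 K).
have [e2 [F2 h2]] := denominatorP Zo (omega_neq0 omega_quadratic).
have [e3 [F3 h3]] := denominatorP Z1o n1o.
have D1 : xcoord P = x 1 by rewrite xPE (pt1 E_cm P_on).
have D3 : xcoord (padd E P (pt iota E m P omega)) = x (1 + omega).
  by rewrite xPE (ptD E_cm P_on) // (pt1 E_cm P_on).
rewrite /net_ideal -/(pt iota E m P omega) D1 D3 -/(x omega) -h1 -h2 -h3.
have F4 := factors_mul F3 (factors_mul (factors_inv ex F1) (factors_inv ex F2)).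
have F5 := factors_mul (factors_exp (a ^+ 2) ex F1)
  (factors_mul (factors_exp (b ^+ 2) ex F2) (factors_exp (a * b) ex F4)).
by rewrite (dpE pp F5); ring.
Qed.

(** Here 1 annihilates P, so the lattice formula applies with z = 0 and r = 1. Since psi takes the
    value 1 at 1, omega and 1 + omega, its three coefficients are minus the pole orders of the
    x-coordinates, which [dp_net] identifies with the exponent of the net ideal. *)
Lemma nonsingular_case (a b : int) : E0 E p P ->
  let z := a%:~R + b%:~R * omega in
  g z = - 2 * dp p (net_ideal iota E omega m P a b) /\
  - 2 * dp p (net_ideal iota E omega m P a b) =
    (a * b - a ^+ 2) * pole 1 + (a * b - b ^+ 2) * pole omega
    - a * b * pole (1 + omega).
Proof.
move=> /NP N1; set z := _ + _; have Z1 := Zw1 omega; have Zo := Zw_omega omega.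
have n1o : 1 + omega != 0.
  by have := lat_nz omega_quadratic 1 1; rewrite mul1r => ->.
have [p1 po p1o] := psi_initial omega_quadratic E_cm P_on P_nontorsion Psi_net.
have e : - 2 * dp p (net_ideal iota E omega m P a b) =
    (a * b - a ^+ 2) * pole 1 + (a * b - b ^+ 2) * pole omega - a * b * pole (1 + omega).
  by rewrite mulNr dp_net; ring.
split=> //; rewrite e gE; last by exists a, b.
have G1 : G 1 = h 1 by rewrite /G oner_eq0 p1 vK1 // mulr0 add0r.
have Go : G omega = h omega.
  by rewrite /G (negPf (omega_neq0 omega_quadratic)) po vK1 // mulr0 add0r.
have G1o : G (1 + omega) = h (1 + omega) by rewrite /G (negPf n1o) p1o vK1 // mulr0 add0r.
have := @G_lattice 0 1 a b (Zw0 omega) Z1 (or_intror N1).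
rewrite mulr1 !add0r !mul1r G0 G1 Go G1o -/z => ->; rewrite !poleE; ring.
Qed.

(** Neither beta nor any u - beta with u in the annihilator is itself in it, so there g is 2 v(psi).
    The linear coefficients of [G_lattice] at beta become quotients of psi values once the
    parallelogram law replaces beta + u by u - beta. The equality lives in [rat] because of the
    halves of mu. *)
Lemma singular_coset r a b beta z (s : bool) : ~ E0 E p P -> Ann r -> Zw beta ->
  z = (a%:~R + b%:~R * omega) * r + (-1) ^+ s * beta -> ~ Ann z ->
  let quad := (a ^+ 2 - a * b) * g r + (b ^+ 2 - a * b) * g (r * omega)
    + a * b * g (r * (1 + omega)) in
  (g z)%:~R = 2 * (fine (nu p (psi beta)))%:~R
    + (-1) ^+ s * 2 * a%:~R *
      ((fine (nu p (psi beta / psi (r - beta))))%:~R + (g r)%:~R / 2)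
    + (-1) ^+ s * 2 * b%:~R *
      ((fine (nu p (psi beta / psi (r * omega - beta))))%:~R + (g (r * omega))%:~R / 2)
    + quad%:~R :> rat.
Proof.
move=> nP /AnnE[Zr Nr] Zb ez nAz quad.
have Zo := Zw_omega omega; have Z1o := ZwD (Zw1 omega) Zo.
have Zro := ZM Zr Zo; have Zr1 := ZM Zr Z1o; have Zl := latZ omega a b.
have Nro : N (r * omega) by rewrite mulrC; apply: Nomega.
have nNb : ~ N beta.
  move=> Nb; apply: nAz; apply/AnnE; rewrite ez; split.
    by case: (s); rewrite ?expr0 ?expr1 ?mul1r ?mulN1r; [apply: ZwB | apply: ZwD] => //; exact: ZM.
  apply: ND; [exact: ZM | | exact: NM |]; case: (s); rewrite ?expr0 ?expr1 ?mul1r ?mulN1r //.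
    exact: ZwN.
  exact: NN.
have sing_of u : ~ N u -> u != 0 /\ S u.
  by move=> nN; split; [apply/eqP => u0; apply: nN; left | apply: contrapT => nS; apply: nN; right].
have val u : Zw u -> ~ N u -> G u = 2 * v (psi u) /\ psi u != 0.
  move=> Zu /sing_of[u0 Su]; rewrite /G (negPf u0) hS // addr0; split=> //.
  exact: psi0.
have shift u : Zw u -> N u -> ~ N (u - beta).
  by move=> Zu Nu Nub; apply: nNb; rewrite -(subKr u beta); apply: ND => //;
    [exact/ZwN/ZwB | apply: NN => //; exact: ZwB].
have quot u : Zw u -> N u ->
    2 * fine (nu p (psi beta / psi (u - beta))) = G beta - G (u - beta).
  move=> Zu Nu; have [-> b0] := val _ Zb nNb.
  have [-> ub0] := val _ (ZwB Zu Zb) (shift _ Zu Nu).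
  rewrite nuE mulf_eq0 invr_eq0 (negPf b0) (negPf ub0) /= vKM ?invr_eq0 // vKV //.
  by rewrite mulrBr.
have quot2 u : Zw u -> N u -> 2 * ((fine (nu p (psi beta / psi (u - beta))))%:~R + (G u)%:~R / 2)
    = (G beta - G (u - beta) + G u)%:~R :> rat.
  by move=> Zu Nu; rewrite intrD -quot // intrM; field.
have Gb : 2 * (fine (nu p (psi beta)))%:~R = (G beta)%:~R :> rat.
  have [-> b0] := val _ Zb nNb; by rewrite nuE (negPf b0) /= intrM.
have Zz : Zw z.
  rewrite ez; apply: ZwD; first exact: ZM.
  by case: (s); rewrite ?expr0 ?expr1 ?mul1r ?mulN1r //; exact: ZwN.
rewrite Gb /quad !gE // -!mulrA [2 * (a%:~R * _)]mulrCA [2 * (b%:~R * _)]mulrCA.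
rewrite (quot2 r) // (quot2 (r * omega)) //.
(* Turns [G (beta + u)] into [G (u - beta)], the only form in which the quotients contain it; for
   the lower sign [G (u - beta)] appears directly. *)
have par u : Zw u -> N u -> G (beta + u) = 2 * G beta + 2 * G u - G (u - beta).
  move=> Zu Nu; rewrite -G_parallelogram // -(opprB u beta) GN ?addrK //; exact: ZwB.
rewrite ez addrC; case: (s); rewrite ?expr0 ?expr1 ?mul1r ?mulN1r.
  rewrite (G_lattice a b (ZwN Zb)) // GN // !(addrC (- beta)).
  by rewrite !(intrD, intrM, rmorphN, rmorphB) /=; ring.
rewrite (G_lattice a b Zb) // !par //.
by rewrite !(intrD, intrM, rmorphN, rmorphB) /=; ring.
Qed.

Lemma annihilator_case r a b : Ann r ->
  g ((a%:~R + b%:~R * omega) * r) = (a ^+ 2 - a * b) * g r + (b ^+ 2 - a * b) * g (r * omega)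
    + a * b * g (r * (1 + omega)).
Proof.
move=> /AnnE[Zr Nr]; have Zo := Zw_omega omega; have Z1o := ZwD (Zw1 omega) Zo.
have Zl := latZ omega a b.
rewrite !gE //; try exact: ZM.
have := @G_lattice 0 r a b (Zw0 omega) Zr Nr; rewrite !add0r G0 => ->; ring.
Qed.

Lemma singular_integral : ~ E0 E p P -> (0 <= nu p (xcoord P))%E.
Proof.
move=> nP; have S1 : S 1 by apply: contrapT => nS; apply: nP; apply/NP.
by apply/nu_ge0 => //; case: S1; rewrite xPE (pt1 E_cm P_on).
Qed.

End Annihilator.

Theorem theorem1p5 (K : fieldExtType rat) (iota : {rmorphism K -> algC})
    (E : weierstrass K) (omega : K) (m : K -> wpoint algC -> wpoint algC)
    (p : set K) (P : wpoint K) (Psi : 'rV[int]_2 -> K)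
    (E_integral : integral_coefficients E) (E_elliptic : elliptic E)
    (omega_quadratic : imaginary_quadratic_integer omega)
    (E_cm : complex_multiplication iota E omega m)
    (p_prime : is_prime p)
    (P_on : on_curve E P) (P_nontorsion : nontorsion E P)
    (Psi_net : net_polynomials E (cm_pair iota E omega m P) Psi) :
  let v := nu p in
  let psi := psi omega Psi in
  let g := g_nu iota E omega m P Psi p in
  let Ann := Ann iota E omega m P p in
  let pole x := fine (maxe 0 (- v x))%E in
  (E0 E p P ->
    forall z1 z2 : int,
      let z := z1%:~R + z2%:~R * omega in
      g z = - 2 * dp p (net_ideal iota E omega m P z1 z2) /\
      - 2 * dp p (net_ideal iota E omega m P z1 z2) =
        (z1 * z2 - z1 ^+ 2) * pole (xcoord P)
        + (z1 * z2 - z2 ^+ 2) * pole (xcoord (cm_act iota E m omega P))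
        - z1 * z2 * pole (xcoord (cm_act iota E m (1 + omega) P))) /\
  (~ E0 E p P ->
    [/\ (0 <= v (xcoord P))%E,
        forall r : K, Ann r ->
          let mu := g r in
          let mu_w := g (r * omega) in
          let mu_1w := g (r * (1 + omega)) in
          forall a b : int,
            let alpha := a%:~R + b%:~R * omega in
            let quad := (a ^+ 2 - a * b) * mu + (b ^+ 2 - a * b) * mu_w
                        + a * b * mu_1w in
            (forall z : K, z = alpha * r -> Ann z -> g z = quad) /\
            (forall (z beta : K) (s : bool), Zomega omega beta ->
               z = alpha * r + (-1) ^+ s * beta -> ~ Ann z ->
               (g z)%:~R =
                 2 * (fine (v (psi beta)))%:~R
                 + (-1) ^+ s * 2 * a%:~R *
                   ((fine (v (psi beta / psi (r - beta))))%:~R + mu%:~R / 2)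
                 + (-1) ^+ s * 2 * b%:~R *
                   ((fine (v (psi beta / psi (r * omega - beta))))%:~R
                    + mu_w%:~R / 2)
                 + quad%:~R :> rat) &
        Zomega_PID omega ->
          forall r : K, Ann = principal_ideal (Zomega omega) r ->
          forall z : K, Zomega omega z ->
            (exists2 alpha, Zomega omega alpha & z = alpha * r /\ Ann z) \/
            (exists alpha beta (s : bool),
               [/\ Zomega omega alpha, Zomega omega beta,
                   z = alpha * r + (-1) ^+ s * beta & ~ Ann z])]).
Proof.
have Z1 := Zw1 omega; have ZwE := Zw0 omega.
move=> v psi g A pole; split=> [E0P z1 z2 z|nE0P].
  have := nonsingular_case E_integral E_elliptic omega_quadratic E_cm p_prime P_on P_nontorsion
    Psi_net z1 z2 E0P.
  by rewrite /xP (pt1 E_cm P_on).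
split.
- exact: (singular_integral E_integral omega_quadratic E_cm p_prime P_on P_nontorsion).
- move=> r Ar mu mu_w mu_1w a b alpha quad; split=> [z -> _|z beta s Zb ez nAz].
    exact: (annihilator_case E_integral E_elliptic omega_quadratic E_cm p_prime P_on P_nontorsion
      Psi_net).
  exact: (singular_coset E_integral E_elliptic omega_quadratic E_cm p_prime P_on P_nontorsion
      Psi_net nE0P Ar Zb ez nAz).
- move=> _ r eA z Zz; have [Az|nAz] := pselect (A z).
    have [alpha Za e] : principal_ideal (Zomega omega) r z by rewrite -eA.
    by left; exists alpha.
  (* The representative beta is arbitrary in its coset, so alpha = 0 and beta = z are admissible. *)
  by right; exists 0, z, false; rewrite mul0r add0r expr0 mul1r.
Qed.
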